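(* Let $g\in L^\infty$ and let $k$ be a maximal vector for $\ker T_g$. Then for every nonconstant inner function $\psi$ with $\psi(0)=0$ and every $h_+\in\mathcal{G}H^\infty$, $h_-\in\mathcal{G}\overline{H^\infty}$, the function $h_+^{-1}(k\circ\psi)\psi/z$ is a maximal vector for $\ker T_{h_-(g\circ\psi)h_+}=h_+^{-1}\ker T_{g\circ\psi}$. That is, $$\mathrm{K}_{\min}\big(h_+^{-1}(k\circ\psi)\psi/z\big)=\ker T_{h_-(g\circ\psi)h_+}=h_+^{-1}\ker T_{g\circ\psi}.$$
   Context: $\mathbb{T}$ is the unit circle with normalized Lebesgue measure, $L^\infty=L^\infty(\mathbb{T})$, $H^2$ is the Hardy space of the unit disc $\mathbb{D}$, regarded as a closed subspace of $L^2(\mathbb{T})$ via boundary values, and $H^\infty$ is the algebra of bounded analytic functions on $\mathbb{D}$; $\overline{H^\infty}$ is the set of complex conjugates of (boundary functions of) elements of $H^\infty$. $\mathcal{G}H^\infty$ and $\mathcal{G}\overline{H^\infty}$ denote the sets of invertible elements of these algebras. For $g\in L^\infty$, $T_g:H^2\to H^2$, $T_gf=P_{H^2}(gf)$ with $P_{H^2}:L^2(\mathbb{T})\to H^2$ the orthogonal projection. For an inner function $\psi$, $g\circ\psi$ is the composition of $g$ with the boundary function of $\psi$. For $k\in H^2\setminus\{0\}$, $\mathrm{K}_{\min}(k)$ denotes the minimal Toeplitz kernel containing $k$: $\mathrm{K}_{\min}(k)=\ker T_f$ for some $f\in L^\infty$, $k\in\ker T_f$, and $\ker T_f\subseteq\ker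 T_h$ for every $h\in L^\infty$ with $k\in\ker T_h$. $k$ is a maximal vector for $\ker T_g$ if $\mathrm{K}_{\min}(k)=\ker T_g$. In this statement $g$ is not the zero function. *)

(* Defs.v *)
From mathcomp Require Import all_boot all_order all_algebra.
From mathcomp Require Import complex.
From mathcomp Require Import all_classical all_reals all_analysis.
Import Order.TTheory GRing.Theory Num.Theory numFieldNormedType.Exports.
Import ComplexField.Normc.

Set Implicit Arguments.
Unset Strict Implicit.
Unset Printing Implicit Defensive.

Local Open Scope ring_scope.
Local Open Scope classical_set_scope.
Local Open Scope complex_scope.

(* A function on the unit circle is represented by a map u : R[i] -> R[i] of
   which only the values at expi t, 0 <= t <= 2 pi, matter.  Two such maps stand
   for the same element of L^p when they are equal a.e. (eqT); every class of
   functions below is a set of representatives, stable under eqT.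
   The modulus is the real-valued normc (`|z| lives in R[i]), and R[i]^o is
   R[i] with the topology of its modulus. *)

Definition expi (R : realType) (t : R) : R[i] := cos t +i* sin t.

Definition aeT (R : realType) (P : R[i] -> Prop) : Prop :=
  {ae lebesgue_measure, forall t : R, t \in `[0, 2 * pi] -> P (expi t)}.

Definition eqT (R : realType) (u v : R[i] -> R[i]) : Prop :=
  aeT (fun z => u z = v z).

(* Lebesgue measurability: equality a.e. with a Borel function (the measurable
   sets of R are the Borel sets). *)
Definition measurableT_fun (R : realType) (u : R[i] -> R[i]) : Prop :=
  exists v : R[i] -> R[i],
    [/\ measurable_fun setT (fun t : R => complex.Re (v (expi t))),
        measurable_fun setT (fun t : R => complex.Im (v (expi t))) & eqT u v].

Definition Linfty (R : realType) : set (R[i] -> R[i]) :=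
  [set u | measurableT_fun u /\
           exists M : R, aeT (fun z => normc (u z) <= M)].

(* \int_T f dm for the normalized Lebesgue measure m *)
Definition integralT (R : realType) (f : R[i] -> R[i]) : R[i] :=
  ((2 * pi)^-1 * \int[lebesgue_measure]_(t in `[0, 2 * pi]) complex.Re (f (expi t)))
  +i*
  ((2 * pi)^-1 * \int[lebesgue_measure]_(t in `[0, 2 * pi]) complex.Im (f (expi t))).

Definition dotT (R : realType) (u v : R[i] -> R[i]) : R[i] :=
  integralT (fun z => u z * (v z)^*).

Definition analytic_disc (R : realType) (F : R[i] -> R[i]) : Prop :=
  exists a : nat -> R[i], forall z : R[i], normc z < 1 ->
    \sum_(0 <= j < n) a j * z ^+ j @[n --> \oo] --> (F z : R[i]^o).

Definition hardy2_disc (R : realType) : set (R[i] -> R[i]) :=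
  [set F | analytic_disc F /\ exists M : R, forall r : R, 0 <= r < 1 ->
     (\int[lebesgue_measure]_(t in `[0%R, (2 * pi)%R])
        (normc (F (r%:C * expi t)) ^+ 2)%:E <= M%:E)%E].

Definition bounded_analytic_disc (R : realType) : set (R[i] -> R[i]) :=
  [set F | analytic_disc F /\
           exists M : R, forall z : R[i], normc z < 1 -> normc (F z) <= M].

Definition boundary_function (R : realType) (F u : R[i] -> R[i]) : Prop :=
  aeT (fun z => F (r%:C * z) @[r --> (1 : R)^'-] --> (u z : R[i]^o)).

Definition H2 (R : realType) : set (R[i] -> R[i]) :=
  [set u | exists2 F, hardy2_disc F & boundary_function F u].

Definition Hinfty (R : realType) : set (R[i] -> R[i]) :=
  [set u | exists2 F, bounded_analytic_disc F & boundary_function F u].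

Definition Hinfty_conj (R : realType) : set (R[i] -> R[i]) :=
  [set u | Hinfty (fun z => (u z)^*)].

Definition invertible_in (R : realType) (A : set (R[i] -> R[i])) :
    set (R[i] -> R[i]) :=
  [set u | A u /\ exists2 v, A v & eqT (fun z => u z * v z) (fun=> 1)].

Definition inner_function (R : realType) (Psi psi : R[i] -> R[i]) : Prop :=
  [/\ bounded_analytic_disc Psi, boundary_function Psi psi
    & aeT (fun z => normc (psi z) = 1)].

(* p = P_{H^2} u; such a p is unique up to a.e. equality. *)
Definition is_projH2 (R : realType) (u p : R[i] -> R[i]) : Prop :=
  H2 p /\ forall h, H2 h -> dotT (fun z => u z - p z) h = 0.

(* p = T_g f *)
Definition is_toeplitz (R : realType) (g f p : R[i] -> R[i]) : Prop :=
  is_projH2 (fun z => g z * f z) p.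

Definition ker_toeplitz (R : realType) (g : R[i] -> R[i]) :
    set (R[i] -> R[i]) :=
  [set f | H2 f /\ is_toeplitz g f (fun=> 0)].

(* K = K_min(k) *)
Definition is_Kmin (R : realType) (k : R[i] -> R[i])
    (K : set (R[i] -> R[i])) : Prop :=
  (exists f, [/\ Linfty f, K = ker_toeplitz f & ker_toeplitz f k]) /\
  (forall h, Linfty h -> ker_toeplitz h k -> K `<=` ker_toeplitz h).

Definition maximal_vector (R : realType) (g k : R[i] -> R[i]) : Prop :=
  [/\ Linfty g, H2 k, ~ eqT k (fun=> 0) & is_Kmin k (ker_toeplitz g)].

(* the set w K, as a set of representatives *)
Definition mul_set (R : realType) (w : R[i] -> R[i])
    (K : set (R[i] -> R[i])) : set (R[i] -> R[i]) :=
  [set u | exists2 f, K f & eqT u (fun z => w z * f z)].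

(* Main.v *)
(* A function f of H^2 lies in ker T_g exactly when the conjugate of z g f lies in H^2.
   Let k be maximal for ker T_g, and let p be the conjugate of z g k.  Beurling's theorem
   gives a unimodular theta in the closure of p H^oo for which p conj(theta) is in H^2;
   then k is in ker T_(g theta), so minimality gives theta ker T_g <= ker T_g.  Hence p is
   divisible in H^2 by every power of theta, which forces theta to be constant: p is
   cyclic, i.e. 1 is in the closure of p H^oo.
   Conversely, if G kappa is the conjugate of z P with P cyclic, then kappa is maximal for
   ker T_G: for kappa in ker T_h and f in ker T_G,
     conj(z h f) P = conj(z h kappa) conj(z G f),
   and multiplying by functions a_n of H^oo with P a_n -> 1 puts conj(z h f) in H^2.
   With G = h_- (g o psi) h_+ and kappa = h_+^-1 (k o psi) psi / z one has
   P = conj(h_-) (p o psi), and P inherits cyclicity because composition with psi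
   contracts L^2: an inner function vanishing at 0 pushes the measure of the circle
   forward to itself, as seen on Poisson integrals. *)
Require Import Defs.
From mathcomp Require Import all_boot all_order all_algebra.
From mathcomp Require Import complex ring lra.
From mathcomp Require Import all_classical all_reals all_analysis measurable_realfun.
Import Order.TTheory GRing.Theory Num.Theory numFieldNormedType.Exports.
Import ComplexField.Normc.
Set Implicit Arguments.
Unset Strict Implicit.
Unset Printing Implicit Defensive.
Local Open Scope ring_scope.
Local Open Scope classical_set_scope.
Local Open Scope complex_scope.
(* Inside arguments in ring_scope, [^*] would otherwise be Num.conj. *)
Local Notation "x ^*" := (conjc x) : ring_scope.

(** The factor psi / z is forced. On the circle p satisfies conj(g k) = z p, so after substitution
    the conjugate of (g k) o psi is psi (p o psi), while the criterion for maximality asks for a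
    factor z. Since psi is unimodular, multiplying k o psi by psi / z trades one factor for the
    other, and psi / z stays in H^oo because psi(0) = 0. Radial limits, by which H^2 is defined, are
    awkward for products and L^2 limits. Much of the work therefore describes H^2 by the vanishing
    of the negative Fourier coefficients: one direction is a mean value property, the other rebuilds
    the analytic function as a Cauchy integral and needs Fatou's theorem, obtained from Lebesgue
    differentiation. A product of two H^2 functions is only integrable, so such products enter
    through the mean of z u v, which is 0. Two points concern null sets: g o psi is meaningful for
    classes only if psi pulls null sets back to null sets, and p is nonzero only because k is
    nonzero almost everywhere, which itself follows from Beurling's theorem. *)

Lemma conjcM (R : realType) (z w : R[i]) : (z * w)^* = z^* * w^*.
Proof. exact: rmorphM. Qed.

Lemma conjcX (R : realType) (z : R[i]) n : (z ^+ n)^* = z^* ^+ n.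
Proof. exact: rmorphXn. Qed.

(** * The real-valued modulus on [R[i]] *)

Section ComplexModulus.
Variable R : realType.
Implicit Types z w : R[i].

Lemma normcE z : normc z = Num.sqrt (complex.Re z ^+ 2 + complex.Im z ^+ 2).
Proof. by case: z. Qed.

Lemma normc_ge0 z : 0 <= normc z.
Proof. by rewrite normcE sqrtr_ge0. Qed.

Lemma normc_sqr z : normc z ^+ 2 = complex.Re z ^+ 2 + complex.Im z ^+ 2.
Proof. by rewrite normcE sqr_sqrtr// addr_ge0 ?sqr_ge0. Qed.

Lemma normc_conj z : normc z^* = normc z.
Proof. by case: z => a b; rewrite /= sqrrN. Qed.

Lemma mul_conjc z : z * z^* = (normc z ^+ 2)%:C.
Proof.
rewrite normc_sqr; case: z => a b; apply/eqP; rewrite eq_complex /=.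
by apply/andP; split; apply/eqP; ring.
Qed.

Lemma normcR (x : R) : normc x%:C = `|x|.
Proof. by rewrite /= expr0n addr0 sqrtr_sqr. Qed.

Lemma normc_eq0 z : (normc z == 0) = (z == 0).
Proof.
by apply/eqP/eqP => [/eq0_normc//|->]; rewrite -[0]/(0%:C) normcR normr0.
Qed.

Lemma normcX z n : normc (z ^+ n) = normc z ^+ n.
Proof.
elim: n => [|n IH]; first by rewrite !expr0 normc1.
by rewrite !exprS normcM IH.
Qed.

Lemma normcB z w : normc (z - w) = normc (w - z).
Proof. by rewrite -normcN opprB. Qed.

Lemma lerB_normc z w : normc z - normc w <= normc (z - w).
Proof. by rewrite lerBlDr -{1}(subrK w z) le_normcD. Qed.

Lemma abs_lerB_normc z w : `|normc z - normc w| <= normc (w - z).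
Proof.
have := lerB_normc z w; have := lerB_normc w z; rewrite (normcB z w) ler_norml => h1 h2.
by apply/andP; split; lra.
Qed.

Lemma normc_sum (I : Type) (s : seq I) (P : pred I) (F : I -> R[i]) :
  normc (\sum_(j <- s | P j) F j) <= \sum_(j <- s | P j) normc (F j).
Proof.
elim/big_ind2: _ => [|x1 x2 y1 y2 H1 H2|//]; first by rewrite -[0]/(0%:C) normcR normr0.
by rewrite (le_trans (le_normcD _ _))// lerD.
Qed.

Lemma abs_Re z : `|complex.Re z| <= normc z.
Proof.
by rewrite normcE -sqrtr_sqr ler_wsqrtr// lerDl sqr_ge0.
Qed.

Lemma abs_Im z : `|complex.Im z| <= normc z.
Proof.
by rewrite normcE -sqrtr_sqr ler_wsqrtr// lerDr sqr_ge0.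
Qed.

Lemma normc_le_ReIm z : normc z <= `|complex.Re z| + `|complex.Im z|.
Proof.
rewrite -(@ler_pXn2r _ 2)// ?nnegrE ?normc_ge0// ?addr_ge0//.
rewrite normc_sqr sqrrD !real_normK ?num_real// lerD2r lerDl.
by rewrite mulrn_wge0 ?mulr_ge0.
Qed.

Lemma sqr_normcD z w : normc (z + w) ^+ 2 <= 2 * normc z ^+ 2 + 2 * normc w ^+ 2.
Proof.
have := le_normcD z w; have := normc_ge0 (z + w).
have := normc_ge0 z; have := normc_ge0 w; set a := normc _; set b := normc _.
set c := normc _ => a0 b0 c0 cab.
have h : c ^+ 2 <= (b + a) ^+ 2 by rewrite ler_pXn2r// nnegrE addr_ge0.
have := sqr_ge0 (a - b); nra.
Qed.

Lemma conjc_unit z : normc z = 1 -> z^* = z^-1.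
Proof.
move=> z1; have zz : z * z^* = 1 by rewrite mul_conjc z1 expr1n.
have z0 : z != 0 by rewrite -normc_eq0 z1 oner_eq0.
by apply: (mulfI z0); rewrite zz divff.
Qed.

Lemma normc2_ge0 z : (0 : R) <= normc z ^+ 2.
Proof. exact: sqr_ge0. Qed.

End ComplexModulus.

#[local] Hint Extern 0 (is_true (Order.le _ (normc _))) => exact: normc_ge0 : core.
#[local] Hint Extern 0 (is_true (Order.le _ (normc _ ^+ 2))) => exact: normc2_ge0 : core.

(** * Angles and points of the unit circle *)

Section Circle.
Variable R : realType.
Implicit Types (z : R[i]) (t x : R).
Local Notation pi := (@pi R).

Lemma normc_expi t : normc (expi t) = 1.
Proof. by rewrite normcE /= cos2Dsin2 sqrtr1. Qed.

Lemma expiD t x : expi (t + x) = expi t * expi x.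
Proof.
rewrite /expi cosD sinD; apply/eqP; rewrite eq_complex /=.
by apply/andP; split; apply/eqP; ring.
Qed.

Lemma conj_expi t : (expi t)^* = expi (- t).
Proof. by rewrite /expi /= cosN sinN. Qed.

Definition clip (x : R) : R := Num.max (-1) (Num.min 1 x).

Lemma clip_itv x : -1 <= clip x <= 1.
Proof.
rewrite /clip le_max lexx /= ge_max; apply/andP; split; first lra.
by rewrite ge_min lexx.
Qed.

Lemma clip_id x : -1 <= x <= 1 -> clip x = x.
Proof. by move=> /andP[x1 x2]; rewrite /clip (min_idPr x2) (max_idPr x1). Qed.

(* The argument in [0, 2 pi]; clipping the real part makes it a Borel function
   of all complex numbers. *)
Definition Arg (z : R[i]) : R :=
  if 0 <= complex.Im z then acos (clip (complex.Re z))
  else 2 * pi - acos (clip (complex.Re z)).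

Lemma Arg_itv z : 0 <= Arg z <= 2 * pi.
Proof.
have c1 := clip_itv (complex.Re z).
have := acos_ge0 c1; have := acos_lepi c1.
have := @pi_gt0 R; rewrite /Arg; case: ifP => _; lra.
Qed.

Lemma ArgK z : normc z = 1 -> expi (Arg z) = z.
Proof.
move=> z1; have zz : complex.Re z ^+ 2 + complex.Im z ^+ 2 = 1.
  by rewrite -normc_sqr z1 expr1n.
have h : -1 <= complex.Re z <= 1 by rewrite -ler_norml -z1 abs_Re.
have hs : Num.sqrt (1 - complex.Re z ^+ 2) = `|complex.Im z|.
  by rewrite -zz [_ + _ - _]addrAC subrr add0r sqrtr_sqr.
rewrite /Arg clip_id//; case: ifP => Imz.
  rewrite /expi acosK// sin_acos// hs ger0_norm//; by case: z {zz h hs Imz z1}.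
rewrite addrC mulr_natl /expi cosD2pi sinD2pi cosN sinN acosK// sin_acos// hs.
rewrite ltr0_norm ?opprK; first by case: z {zz h hs Imz z1}.
by rewrite ltNge Imz.
Qed.

Lemma expiK t : 0 <= t < 2 * pi -> Arg (expi t) = t.
Proof.
move=> /andP[t0 t2]; have pi0 := @pi_gt0 R.
rewrite /Arg /= clip_id; last by rewrite cos_geN1 cos_le1.
have [tp|tp] := leP t pi.
  rewrite sin_ge0_pi; last by rewrite t0 tp.
  by rewrite cosK// in_itv/= t0 tp.
have s0 : sin t < 0.
  have : 0 < sin (t - pi) by apply: sin_gt0_pi; apply/andP; split; lra.
  by rewrite sinB sinpi cospi mulr0 subr0 mulrN1 oppr_gt0.
rewrite leNgt s0 /=.
have -> : cos t = cos (2 * pi - t) by rewrite addrC mulr_natl cosD2pi cosN.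
rewrite cosK; first by ring.
by rewrite in_itv /=; apply/andP; split; lra.
Qed.

Lemma measurable_clip : measurable_fun setT clip.
Proof.
apply: measurable_maxr => //.
by apply: measurable_minr => //.
Qed.

Lemma measurable_acos_clip : measurable_fun setT (acos \o clip).
Proof.
apply: (@measurable_comp _ _ _ _ _ _ `[(-1 : R), 1]%classic) => //.
- by move=> _ [x _ <-]; rewrite /= in_itv /= clip_itv.
- apply: (measurable_fun_itv_cc (b0 := false) (b1 := true)).
  apply: open_continuous_measurable_fun; first exact: interval_open.
  by move=> x; rewrite inE /= in_itv /= => /continuous_acos.
- exact: measurable_clip.
Qed.

Lemma measurable_Arg d (T : measurableType d) (a b : T -> R) :
  measurable_fun setT a -> measurable_fun setT b ->
  measurable_fun setT (fun s => Arg (a s +i* b s)).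
Proof.
move=> ma mb; rewrite /Arg /=.
have mc : measurable_fun setT (fun s => acos (clip (a s))).
  exact: (measurableT_comp measurable_acos_clip ma).
apply: measurable_fun_ifT => //.
  by apply: measurable_fun_ler => //.
by apply: measurable_funB.
Qed.

Lemma measurable_cos (D : set R) : measurable_fun D (@cos R).
Proof.
apply: measurable_funTS; apply: continuous_measurable_fun; exact: continuous_cos.
Qed.

Lemma measurable_sin (D : set R) : measurable_fun D (@sin R).
Proof.
apply: measurable_funTS; apply: continuous_measurable_fun; exact: continuous_sin.
Qed.

End Circle.

Lemma ae_imp d (T : ringOfSetsType d) (R : realType)
    (mu : {measure set T -> \bar R}) (P Q : T -> Prop) :
  {ae mu, forall x, P x} -> (forall x, P x -> Q x) -> {ae mu, forall x, Q x}.
Proof. by move=> hP h; apply: filterS hP. Qed.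

Lemma ae_and d (T : ringOfSetsType d) (R : realType)
    (mu : {measure set T -> \bar R}) (P Q : T -> Prop) :
  {ae mu, forall x, P x} -> {ae mu, forall x, Q x} ->
  {ae mu, forall x, P x /\ Q x}.
Proof. by move=> hP h; apply: filterI. Qed.

(** * Integration on the circle *)

Section AlmostEverywhere.
Variable R : realType.
Implicit Types (P Q S : R[i] -> Prop).
Local Notation mu := (@lebesgue_measure R).

Lemma aeT_itv P : aeT P <->
  {ae mu, forall t : R, `[0, 2 * pi]%classic t -> P (expi t)}.
Proof.
by split => h; apply: ae_imp h _ => t h tD; apply: h; move: tD; rewrite ?inE.
Qed.

Lemma aeTW P : (forall z, normc z = 1 -> P z) -> aeT P.
Proof. by move=> h; apply: aeW => t _; apply: h; exact: normc_expi. Qed.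

Lemma aeT1 P S : aeT P -> (forall z, normc z = 1 -> P z -> S z) -> aeT S.
Proof.
move=> hP h; apply: ae_imp hP _ => t hP tD.
by apply: h; [exact: normc_expi|exact: hP].
Qed.

Lemma aeT_and P Q : aeT P -> aeT Q -> aeT (fun z => P z /\ Q z).
Proof.
by move=> hP hQ; apply: ae_imp (ae_and hP hQ) _ => t [h1 h2] tD; split;
  [exact: h1|exact: h2].
Qed.

Lemma aeT2 P Q S : aeT P -> aeT Q ->
  (forall z, normc z = 1 -> P z -> Q z -> S z) -> aeT S.
Proof.
by move=> hP hQ h; apply: (aeT1 (aeT_and hP hQ)) => z z1 [hp hq]; exact: h.
Qed.

Lemma aeT3 P Q P' S : aeT P -> aeT Q -> aeT P' ->
  (forall z, normc z = 1 -> P z -> Q z -> P' z -> S z) -> aeT S.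
Proof.
move=> hP hQ hP' h; apply: (aeT2 (aeT_and hP hQ) hP') => z z1 [hp hq] hp'.
exact: h.
Qed.

Lemma aeT_forall (P : nat -> R[i] -> Prop) :
  (forall n, aeT (P n)) -> aeT (fun z => forall n, P n z).
Proof.
by move=> /ae_foralln h; apply: ae_imp h _ => t h tD n; exact: h.
Qed.

Lemma eqT_refl (u : R[i] -> R[i]) : eqT u u.
Proof. exact: aeTW. Qed.

End AlmostEverywhere.

(* Representatives are only a.e. equal to Borel functions, so the integrals of
   the definitions may have non-measurable integrands. *)
Section NonMeasurableIntegrand.
Local Open Scope ereal_scope.
Import HBNNSimple.
Context d (T : measurableType d) (R : realType).
Variable mu : {measure set T -> \bar R}.

(** The integral of a nonnegative function is a supremum over simple functions below it, measurable
    or not. Cutting such a simple function to 0 on the exceptional null set keeps its integral and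
    puts it below [g]. *)
Lemma ge0_ae_le_integral_gen (D : set T) (f g : T -> \bar R) :
  (forall x, 0 <= f x) -> (forall x, 0 <= g x) ->
  {ae mu, forall x, D x -> f x <= g x} ->
  \int[mu]_(x in D) f x <= \int[mu]_(x in D) g x.
Proof.
move=> f0 g0 [N [mN N0 hN]].
rewrite !ge0_integralE//; apply: ge_ereal_sup => _ [h /= hf <-].
have mNc : measurable (~` N) by exact: measurableC.
have pE x : proj_nnsfun h mNc x = if x \in ~` N then h x else 0%R.
  by rewrite -mrestrict patchE.
have <- : sintegral mu (proj_nnsfun h mNc) = sintegral mu h.
  rewrite -!integralT_nnsfun; apply: ge0_ae_eq_integral => //.
  - exact/measurable_EFinP.
  - exact/measurable_EFinP.
  - by move=> x _; rewrite lee_fin.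
  - by move=> x _; rewrite lee_fin.
  - exists N; split => // x; rewrite /mkset => xN; apply: contrapT => nNx.
    by apply: xN => _; rewrite pE mem_set.
apply: ereal_sup_ubound; exists (proj_nnsfun h mNc) => // x.
rewrite pE; have [xN|xN] := pselect (N x).
  rewrite memNset; last by move=> /(_ xN).
  by rewrite patchE; case: ifPn.
rewrite mem_set// (le_trans (hf x))// !patchE; case: ifPn => // /set_mem xD.
by apply: contrapT => hn; apply: xN; apply: hN => /= /(_ xD).
Qed.

Lemma ge0_ae_eq_integral_gen (D : set T) (f g : T -> \bar R) :
  (forall x, 0 <= f x) -> (forall x, 0 <= g x) ->
  {ae mu, forall x, D x -> f x = g x} ->
  \int[mu]_(x in D) f x = \int[mu]_(x in D) g x.
Proof.
move=> f0 g0 h; apply/eqP; rewrite eq_le; apply/andP; split;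
  by apply: ge0_ae_le_integral_gen => //; apply: filterS h => x h /h ->.
Qed.

Lemma ae_eq_integral_gen (D : set T) (f g : T -> \bar R) :
  {ae mu, forall x, D x -> f x = g x} ->
  \int[mu]_(x in D) f x = \int[mu]_(x in D) g x.
Proof.
move=> h; rewrite integralE [RHS]integralE; congr (_ - _);
  by apply: ge0_ae_eq_integral_gen => //; apply: filterS h => x h /h;
    rewrite ?funeposE ?funenegE => ->.
Qed.

End NonMeasurableIntegrand.

(** Fatou's lemma for a limit [f] that may fail to be measurable: [f] is only compared almost
    everywhere with the lower limit, which is enough for equal integrals. *)
Lemma fatou_le d (T : measurableType d) (R : realType)
    (mu : {measure set T -> \bar R}) (D : set T) (f_ : (T -> \bar R)^nat)
    (f : T -> \bar R) (M : \bar R) : measurable D ->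
  (forall n, measurable_fun D (f_ n)) -> (forall n t, D t -> (0 <= f_ n t)%E) ->
  {ae mu, forall t, D t -> f_ n t @[n --> \oo] --> f t} ->
  (forall n, (\int[mu]_(t in D) f_ n t <= M)%E) -> (\int[mu]_(t in D) f t <= M)%E.
Proof.
move=> mD mf f0 cf hM; have := fatou mu mD mf f0.
have -> : (\int[mu]_(t in D) limn_einf (fun n => f_ n t))%E = (\int[mu]_(t in D) f t)%E.
  apply: ae_eq_integral_gen; apply: ae_imp cf _ => t h tD.
  by rewrite (is_cvg_limn_einfE (cvgP _ (h tD))); apply/cvg_lim => //; exact: h.
move=> /le_trans; apply; rewrite limn_einf_lim; apply: lime_le; first exact: is_cvg_einfs.
apply: nearW => n; apply: (le_trans _ (hM n)).
by apply: ereal_inf_lbound; exists n => //=.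
Qed.

Section RealFunctions.
Variable R : realType.
Local Notation mu := (@lebesgue_measure R).
Local Notation pi := (@pi R).
Local Notation D := (`[(0 : R), 2 * pi]%classic).
Implicit Types (f g : R[i] -> R) (u v : R[i] -> R[i]).

(** Measurability up to a null set, phrased with a Borel function of the angle; unlike Borel
    measurability it survives a change of representative. *)
Definition measTr f := exists2 h : R -> R, measurable_fun setT h &
  {ae mu, forall t, D t -> f (expi t) = h t}.

(** Extended-real and not normalized: the circle has mass 2 pi here, and the factor (2 pi)^-1
    appears only in [norm1], [norm2sq] and [integralT]. *)
Definition nint f : \bar R := (\int[mu]_(t in D) (f (expi t))%:E)%E.

Lemma measurable_D : measurable D. Proof. exact: measurable_itv. Qed.
Local Hint Resolve measurable_D : core.

Lemma measTr_eq f g : aeT (fun z => f z = g z) -> measTr f -> measTr g.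
Proof.
move=> /aeT_itv fg [h mh hf]; exists h => //.
by apply: ae_imp (ae_and fg hf) _ => t [h1 h2] tD; rewrite -h1// h2.
Qed.

Lemma measTr_op (op : R -> R) f : measurable_fun setT op -> measTr f ->
  measTr (fun z => op (f z)).
Proof.
move=> mop [h mh hf]; exists (fun t => op (h t)).
  exact: (measurableT_comp mop mh).
by apply: ae_imp hf _ => t ht tD; rewrite ht.
Qed.

Lemma measTr_op2 (op : R -> R -> R) f g :
  (forall h k : R -> R, measurable_fun setT h -> measurable_fun setT k ->
    measurable_fun setT (fun t => op (h t) (k t))) ->
  measTr f -> measTr g -> measTr (fun z => op (f z) (g z)).
Proof.
move=> mop [h mh hf] [k mk kg]; exists (fun t => op (h t) (k t)); first exact: mop.
by apply: ae_imp (ae_and hf kg) _ => t [h1 h2] tD; rewrite h1// h2.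
Qed.

Lemma measTr_cst c : measTr (fun=> c).
Proof. by exists (fun=> c) => //; apply: aeW. Qed.

Lemma measTrD f g : measTr f -> measTr g -> measTr (fun z => f z + g z).
Proof. by apply: measTr_op2 => h k; exact: measurable_funD. Qed.

Lemma measTrM f g : measTr f -> measTr g -> measTr (fun z => f z * g z).
Proof. by apply: measTr_op2 => h k; exact: measurable_funM. Qed.

Lemma measTrN f : measTr f -> measTr (fun z => - f z).
Proof. by apply: (@measTr_op -%R); exact: oppr_measurable. Qed.

Lemma measTr_min f g : measTr f -> measTr g -> measTr (fun z => Num.min (f z) (g z)).
Proof. by apply: measTr_op2 => h k; exact: measurable_minr. Qed.

Lemma measTr_norm f : measTr f -> measTr (fun z => `|f z|).
Proof. by apply: (@measTr_op Num.norm); exact: normr_measurable. Qed.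

Lemma measTrX n f : measTr f -> measTr (fun z => f z ^+ n).
Proof. by apply: (@measTr_op (fun x => x ^+ n)); exact: exprn_measurable. Qed.

Lemma measTr_ge0 f : (forall z, 0 <= f z) -> measTr f ->
  exists h : R -> R, [/\ measurable_fun setT h, forall t, 0 <= h t &
  {ae mu, forall t, D t -> f (expi t) = h t}].
Proof.
move=> f0 [h mh hf]; exists (fun t => Num.max 0 (h t)); split.
- by apply: measurable_maxr.
- by move=> t; rewrite le_max lexx.
- by apply: ae_imp hf _ => t ht tD; rewrite -ht// (max_idPr (f0 _)).
Qed.

Lemma measTr_lim (f_ : nat -> R[i] -> R) f : (forall n, measTr (f_ n)) ->
  aeT (fun z => f_ n z @[n --> \oo] --> f z) -> measTr f.
Proof.
move=> mf /aeT_itv cf.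
have /choice[h hh] : forall n, exists h : R -> R, measurable_fun setT h /\
    {ae mu, forall t, D t -> f_ n (expi t) = h t}.
  by move=> n; have [k] := mf n; exists k.
have /ae_foralln hn : forall n, {ae mu, forall t, D t -> f_ n (expi t) = h n t}.
  by move=> n; have [] := hh n.
have [N [mN N0 hN]] := ae_and cf hn.
pose A := D `\` N.
have mA : measurable A by exact: measurableD.
have hA t : A t -> h n t @[n --> \oo] --> f (expi t).
  move=> [tD tN]; have [h1 h2] : (D t -> f_ n (expi t) @[n --> \oo] --> f (expi t)) /\
      (forall n, D t -> f_ n (expi t) = h n t).
    by apply: contrapT => Q; apply: tN; apply: hN.
  by under eq_fun do rewrite -h2//; exact: h1.
exists ((f \o @expi R) \_ A); last first.
  exists N; split => // t /= ht; apply: contrapT => tN; apply: ht => tD.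
  by rewrite patchE mem_set.
apply/(measurable_restrictT _ mA).
apply: (measurable_fun_cvg (h := h)) => // m.
by apply: measurable_funTS; have [] := hh m.
Qed.

Lemma nint_ge0 f : (forall z, 0 <= f z) -> (0 <= nint f)%E.
Proof. by move=> f0; apply: integral_ge0 => t _; rewrite lee_fin. Qed.

Lemma le_nint f g : (forall z, 0 <= f z) -> (forall z, 0 <= g z) ->
  aeT (fun z => f z <= g z) -> (nint f <= nint g)%E.
Proof.
move=> f0 g0 /aeT_itv h; apply: ge0_ae_le_integral_gen => [t|t|]; rewrite ?lee_fin//.
Qed.

Lemma nint_rep f (h : R -> R) : {ae mu, forall t, D t -> f (expi t) = h t} ->
  nint f = (\int[mu]_(t in D) (h t)%:E)%E.
Proof.
by move=> H; apply: ae_eq_integral_gen; apply: ae_imp H _ => t ht tD; rewrite ht.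
Qed.

Lemma nintD f g : (forall z, 0 <= f z) -> (forall z, 0 <= g z) ->
  measTr f -> measTr g -> nint (fun z => f z + g z) = (nint f + nint g)%E.
Proof.
move=> f0 g0 mf mg; have [h [mh h0 hf]] := measTr_ge0 f0 mf.
have [k [mk k0 kg]] := measTr_ge0 g0 mg.
rewrite (nint_rep hf) (nint_rep kg) -ge0_integralD//.
- under [RHS]eq_integral do rewrite -EFinD.
  apply: nint_rep; apply: ae_imp (ae_and hf kg) _ => t [h1 h2] tD.
  by rewrite h1// h2.
- by move=> t _; rewrite lee_fin.
- by apply/measurable_EFinP; apply: measurable_funTS.
- by move=> t _; rewrite lee_fin.
- by apply/measurable_EFinP; apply: measurable_funTS.
Qed.

Lemma nintZ c f : 0 <= c -> (forall z, 0 <= f z) -> measTr f ->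
  nint (fun z => c * f z) = (c%:E * nint f)%E.
Proof.
move=> c0 f0 mf; have [h [mh h0 hf]] := measTr_ge0 f0 mf.
rewrite (nint_rep hf) -ge0_integralZl//.
- under [RHS]eq_integral do rewrite -EFinM.
  by apply: nint_rep; apply: ae_imp hf _ => t ht tD; rewrite ht.
- by apply/measurable_EFinP; apply: measurable_funTS.
- by move=> t _; rewrite lee_fin.
Qed.

Lemma nint_cst c : nint (fun=> c) = (c * (2 * pi))%:E.
Proof.
rewrite /nint integral_cst//= lebesgue_measure_itv /= lte_fin.
by rewrite mulr_gt0 ?pi_gt0// oppr0 addr0 -EFinM.
Qed.

Lemma nint_fatou (f_ : nat -> R[i] -> R) f (M : \bar R) :
  (forall n, measTr (f_ n)) -> (forall n z, 0 <= f_ n z) -> (forall z, 0 <= f z) ->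
  aeT (fun z => f_ n z @[n --> \oo] --> f z) ->
  (forall n, (nint (f_ n) <= M)%E) -> (nint f <= M)%E.
Proof.
move=> mf f_0 f0 /aeT_itv cf hM.
have /choice[h hh] := fun n => measTr_ge0 (f_0 n) (mf n).
have /ae_foralln hn : forall n, {ae mu, forall t, D t -> f_ n (expi t) = h n t}.
  by move=> n; have [] := hh n.
have nintE n : nint (f_ n) = (\int[mu]_(t in D) (h n t)%:E)%E.
  by apply: nint_rep; have [] := hh n.
apply: (@fatou_le _ _ _ mu D (fun n t => (h n t)%:E)) => // [n|n t _||n].
- by apply/measurable_EFinP; apply: measurable_funTS; have [] := hh n.
- by rewrite lee_fin; have [] := hh n.
- apply: ae_imp (ae_and cf hn) _ => t [h1 h2] tD.
  apply: cvg_EFin; first by apply: nearW => n.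
  by rewrite /=; under eq_fun do rewrite -h2//; exact: h1.
- by rewrite -nintE.
Qed.

Lemma nint_dct (f_ : nat -> R[i] -> R) g :
  (forall n, measTr (f_ n)) -> (forall n z, 0 <= f_ n z) ->
  aeT (fun z => f_ n z @[n --> \oo] --> (0 : R)) ->
  (forall z, 0 <= g z) -> measTr g -> (nint g < +oo)%E ->
  (forall n, aeT (fun z => f_ n z <= g z)) ->
  (nint (f_ n) @[n --> \oo] --> 0)%E.
Proof.
move=> mf f_0 /aeT_itv cf g0 mg gfin /aeT_forall /aeT_itv fg.
have /choice[h hh] := fun n => measTr_ge0 (f_0 n) (mf n).
have /ae_foralln hn : forall n, {ae mu, forall t, D t -> f_ n (expi t) = h n t}.
  by move=> n; have [] := hh n.
have [k [mk k0 gk]] := measTr_ge0 g0 mg.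
have mh n : measurable_fun D (EFin \o h n).
  by apply/measurable_EFinP; apply: measurable_funTS; have [] := hh n.
have ik : mu.-integrable D (EFin \o k).
  apply/integrableP; split.
    by apply/measurable_EFinP; apply: measurable_funTS.
  under eq_integral do rewrite /= ger0_norm//.
  by rewrite -(nint_rep gk).
have hch : {ae mu, forall t, D t -> (EFin \o h n) t @[n --> \oo] --> cst 0%E t}.
  apply: ae_imp (ae_and cf hn) _ => t [h1 h2] tD.
  apply: cvg_EFin; first by apply: nearW => n.
  by rewrite /=; under eq_fun do rewrite -h2//; exact: h1.
have hdom : {ae mu, forall t n, D t -> (`|(EFin \o h n) t| <= (EFin \o k) t)%E}.
  apply: ae_imp (ae_and (ae_and fg gk) hn) _ => t [[h1 h2] h3] n tD.
  have [_ hn0 _] := hh n.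
  by rewrite /= ger0_norm// lee_fin -h3// -h2// h1.
have [_ _ +] := @dominated_convergence _ _ _ mu D measurable_D (fun n => EFin \o h n)
   (cst 0%E) (EFin \o k) mh (measurable_cst _) hch ik hdom.
rewrite integral0 (_ : (fun n => (\int[mu]_(t in D) (EFin \o h n) t)%E) =
  (fun n => nint (f_ n)))//.
by apply/funext => n; rewrite (@nint_rep _ (h n))//; have [] := hh n.
Qed.

Lemma nint_eq0 f : (forall z, 0 <= f z) -> measTr f -> nint f = 0%E ->
  aeT (fun z => f z = 0).
Proof.
move=> f0 mf; have [h [mh h0 hf]] := measTr_ge0 f0 mf.
have mh' : measurable_fun D (EFin \o h).
  by apply/measurable_EFinP; apply: measurable_funTS.
rewrite (nint_rep hf) => hi; apply/aeT_itv.
have /(ae_eq_integral_abs mu measurable_D mh') h1 :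
   (\int[mu]_(t in D) `|(EFin \o h) t|)%E = 0%E.
  by rewrite -hi; apply: eq_integral => t _ /=; rewrite ger0_norm.
by apply: ae_imp (ae_and hf h1) _ => t [h2 h3] tD; rewrite h2//; have [] := h3 tD.
Qed.

Definition rint f : R := \int[mu]_(t in D) f (expi t).

Definition intTr f := measTr f /\ (nint (fun z => `|f z|%R) < +oo)%E.

Lemma intTr_rep f : intTr f -> exists2 h : R -> R,
  mu.-integrable D (EFin \o h) & {ae mu, forall t, D t -> f (expi t) = h t}.
Proof.
move=> [[h mh hf] fi]; exists h => //; apply/integrableP; split.
  by apply/measurable_EFinP; apply: measurable_funTS.
rewrite (_ : (\int[mu]_(t in D) _)%E = nint (fun z => `|f z|))//.
by rewrite (@nint_rep _ (fun t => `|h t|))//; apply: ae_imp hf _ => t ht /ht ->.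
Qed.

Lemma rint_rep f (h : R -> R) : {ae mu, forall t, D t -> f (expi t) = h t} ->
  rint f = \int[mu]_(t in D) h t.
Proof.
move=> H; congr fine; apply: ae_eq_integral_gen.
by apply: ae_imp H _ => t ht tD; rewrite ht.
Qed.

Lemma rint_eq f g : aeT (fun z => f z = g z) -> rint f = rint g.
Proof. by move=> /aeT_itv h; apply: rint_rep. Qed.

Lemma rintD f g : intTr f -> intTr g -> rint (fun z => f z + g z) = rint f + rint g.
Proof.
move=> /intTr_rep[h ih hf] /intTr_rep[k ik kg].
rewrite (rint_rep hf) (rint_rep kg) -RintegralD//; apply: rint_rep.
by apply: ae_imp (ae_and hf kg) _ => t [h1 h2] tD; rewrite h1// h2.
Qed.

Lemma rintZ c f : intTr f -> rint (fun z => c * f z) = c * rint f.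
Proof.
move=> /intTr_rep[h ih hf].
rewrite (rint_rep hf) -RintegralZl//; apply: rint_rep.
by apply: ae_imp hf _ => t h1 tD; rewrite h1.
Qed.

Lemma abs_rint f : intTr f -> (`|rint f|%R%:E <= nint (fun z => `|f z|%R))%E.
Proof.
move=> fi; have [h ih hf] := intTr_rep fi; rewrite (rint_rep hf).
have hr : nint (fun z => `|f z|) = (\int[mu]_(t in D) `|h t|%R%:E)%E.
  by apply: nint_rep; apply: ae_imp hf _ => t ht /ht ->.
apply: (@le_trans _ _ (\int[mu]_(t in D) `|h t|)%:E).
  by rewrite lee_fin; apply: le_normr_Rintegral.
rewrite hr fineK// ge0_fin_numE; last by apply: integral_ge0 => t _; rewrite lee_fin.
by rewrite -hr; case: fi.
Qed.

End RealFunctions.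
#[export] Hint Resolve measurable_D : core.

Section ComplexFunctions.
Variable R : realType.
Local Notation mu := (@lebesgue_measure R).
Local Notation pi := (@pi R).
Local Notation D := (`[(0 : R), 2 * pi]%classic).
Implicit Types (f g : R[i] -> R) (u v w : R[i] -> R[i]).

Lemma pi2_gt0 : 0 < 2 * pi. Proof. by rewrite mulr_gt0 ?pi_gt0. Qed.

Lemma pi2V_ge0 : 0 <= (2 * pi)^-1. Proof. by rewrite invr_ge0 ltW ?pi2_gt0. Qed.

Lemma nint_fine f : (forall z, 0 <= f z) -> (nint f < +oo)%E ->
  nint f = (rint f)%:E.
Proof.
by move=> f0 fi; rewrite /rint /Rintegral fineK// ge0_fin_numE// nint_ge0.
Qed.

Lemma intTr_ge0 f : (forall z, 0 <= f z) -> measTr f -> (nint f < +oo)%E -> intTr f.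
Proof.
move=> f0 mf fi; split => //.
rewrite (_ : (fun z => `|f z|) = f)//.
by apply/funext => z; rewrite ger0_norm.
Qed.

Lemma intTr_le f g : measTr f -> aeT (fun z => `|f z| <= g z) ->
  (forall z, 0 <= g z) -> (nint g < +oo)%E -> intTr f.
Proof.
move=> mf fg g0 gi; split => //.
by apply: le_lt_trans gi; apply: le_nint.
Qed.

Lemma rint_ge0 f : (forall z, 0 <= f z) -> 0 <= rint f.
Proof. by move=> f0; apply: fine_ge0; apply: nint_ge0. Qed.

Lemma intTrD f g : intTr f -> intTr g -> intTr (fun z => f z + g z).
Proof.
move=> [mf fi] [mg gi]; apply: (@intTr_le _ (fun z => `|f z| + `|g z|)).
- exact: measTrD.
- by apply: aeTW => z _; exact: ler_normD.
- by move=> z; rewrite addr_ge0.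
- by rewrite nintD//; [rewrite lte_add_pinfty|exact: measTr_norm|exact: measTr_norm].
Qed.

Lemma intTrZ c f : intTr f -> intTr (fun z => c * f z).
Proof.
move=> [mf fi]; split; first by apply: measTrM => //; exact: measTr_cst.
under [X in nint X]eq_fun do rewrite normrM.
rewrite nintZ//; last exact: measTr_norm.
by rewrite lte_mul_pinfty// lee_fin.
Qed.

Lemma le_rint f g : intTr f -> intTr g -> aeT (fun z => f z <= g z) ->
  rint f <= rint g.
Proof.
move=> fi gi fg; rewrite -subr_ge0 -mulN1r -rintZ// -rintD//; last exact: intTrZ.
rewrite (@rint_eq _ _ (fun z => `|g z + -1 * f z|)); first exact: rint_ge0.
by apply: (aeT1 fg) => z _ h; rewrite ger0_norm// mulN1r subr_ge0.
Qed.

(** The converse has to turn Borel functions of the angle into a function of the point; composing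
    with [Arg] does this wherever [Arg] inverts [expi]. *)
Lemma measT_ReIm u : measurableT_fun u <->
  measTr (fun z => complex.Re (u z)) /\ measTr (fun z => complex.Im (u z)).
Proof.
split=> [[v [mr mi /aeT_itv uv]]|[[h mh hu] [k mk ku]]].
  split; [exists (fun t => complex.Re (v (expi t)))|exists (fun t => complex.Im (v (expi t)))] => //;
  by apply: ae_imp uv _ => t h /h ->.
exists (fun z => h (Arg z) +i* k (Arg z)).
have mA : measurable_fun setT (fun t : R => Arg (expi t)).
  by apply: measurable_Arg; [exact: measurable_cos|exact: measurable_sin].
split.
- exact: (measurableT_comp mh mA).
- exact: (measurableT_comp mk mA).
(* The angle 2 pi names the same point as 0, so it is the one angle of the interval that [Arg] does
   not recover. *)
have ne : {ae mu, forall t : R, t <> 2 * pi}.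
  exists [set 2 * pi]; split => //; first exact: lebesgue_measure_set1.
  by move=> t /= /contrapT.
apply/aeT_itv; apply: ae_imp (ae_and (ae_and hu ku) ne) _ => t [[h1 h2] h3] tD.
rewrite expiK; first by rewrite -h1// -h2//; case: (u _).
by move: tD; rewrite /= in_itv/= => /andP[-> /=]; rewrite le_eqVlt => /orP[/eqP|].
Qed.

Lemma measT_eq u v : eqT u v -> measurableT_fun u -> measurableT_fun v.
Proof.
move=> uv /measT_ReIm[h1 h2]; apply/measT_ReIm.
by split; [apply: measTr_eq h1|apply: measTr_eq h2]; apply: (aeT1 uv) => z _ ->.
Qed.

Lemma measTD u v : measurableT_fun u -> measurableT_fun v ->
  measurableT_fun (fun z => u z + v z).
Proof.
move=> /measT_ReIm[h1 h2] /measT_ReIm[k1 k2]; apply/measT_ReIm; split.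
  by under eq_fun do rewrite raddfD; exact: measTrD.
by under eq_fun do rewrite raddfD; exact: measTrD.
Qed.

Lemma ReM (z w : R[i]) : complex.Re (z * w) =
  complex.Re z * complex.Re w + - (complex.Im z * complex.Im w).
Proof. by case: z; case: w. Qed.

Lemma ImM (z w : R[i]) : complex.Im (z * w) =
  complex.Re z * complex.Im w + complex.Im z * complex.Re w.
Proof. by case: z; case: w. Qed.

Lemma measTM u v : measurableT_fun u -> measurableT_fun v ->
  measurableT_fun (fun z => u z * v z).
Proof.
move=> /measT_ReIm[h1 h2] /measT_ReIm[k1 k2]; apply/measT_ReIm; split.
  under eq_fun do rewrite ReM; apply: measTrD; first exact: measTrM.
  by apply: measTrN; exact: measTrM.
by under eq_fun do rewrite ImM; apply: measTrD; exact: measTrM.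
Qed.

Lemma measT_cst c : measurableT_fun (fun=> c : R[i]).
Proof. by apply/measT_ReIm; split; exact: measTr_cst. Qed.

Lemma measT_id : measurableT_fun (fun z : R[i] => z).
Proof.
by exists id; split;
  [exact: measurable_cos|exact: measurable_sin|exact: eqT_refl].
Qed.

Lemma ReJ (z : R[i]) : complex.Re z^* = complex.Re z. Proof. by case: z. Qed.

Lemma ImJ (z : R[i]) : complex.Im z^* = - complex.Im z. Proof. by case: z. Qed.

Lemma measT_conj u : measurableT_fun u -> measurableT_fun (fun z => (u z)^*).
Proof.
move=> /measT_ReIm[h1 h2]; apply/measT_ReIm; split.
  by under eq_fun do rewrite ReJ.
by under eq_fun do rewrite ImJ; exact: measTrN.
Qed.

Lemma measTN u : measurableT_fun u -> measurableT_fun (fun z => - u z).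
Proof.
by move=> mu'; under eq_fun do rewrite -mulN1r; apply: measTM => //; exact: measT_cst.
Qed.

Lemma measTB u v : measurableT_fun u -> measurableT_fun v ->
  measurableT_fun (fun z => u z - v z).
Proof. by move=> mu' mv; apply: measTD => //; exact: measTN. Qed.

Lemma measTX n u : measurableT_fun u -> measurableT_fun (fun z => u z ^+ n).
Proof.
move=> mu'; elim: n => [|n IH]; first exact: measT_cst.
by under eq_fun do rewrite exprS; exact: measTM.
Qed.

Lemma measT_sum n (u_ : nat -> R[i] -> R[i]) : (forall j, measurableT_fun (u_ j)) ->
  measurableT_fun (fun z => \sum_(0 <= j < n) u_ j z).
Proof.
move=> mu'; elim: n => [|n IH].
  by under eq_fun do rewrite big_geq//; exact: measT_cst.
by under eq_fun do rewrite big_nat_recr//=; exact: measTD.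
Qed.

Lemma measTr_normc u : measurableT_fun u -> measTr (fun z => normc (u z)).
Proof.
move=> /measT_ReIm[h1 h2]; under eq_fun do rewrite normcE.
apply: (@measTr_op _ Num.sqrt).
  by apply: continuous_measurable_fun; exact: sqrt_continuous.
by apply: measTrD; exact: measTrX.
Qed.

Lemma measTr_normc2 u : measurableT_fun u -> measTr (fun z => normc (u z) ^+ 2).
Proof. by move=> mu'; apply: measTrX; exact: measTr_normc. Qed.

Lemma measT_lim (u_ : nat -> R[i] -> R[i]) u : (forall n, measurableT_fun (u_ n)) ->
  aeT (fun z => normc (u_ n z - u z) @[n --> \oo] --> (0 : R)) -> measurableT_fun u.
Proof.
move=> mu' h; apply/measT_ReIm; split.
- apply: (@measTr_lim _ (fun n z => complex.Re (u_ n z))) => [n|].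
    by have /measT_ReIm[] := mu' n.
  apply: (aeT1 h) => z _ hz; apply/cvgrPdistC_lt => e e0.
  move/cvgrPdist_lt : hz => /(_ e e0); apply: filterS => n.
  rewrite sub0r normrN ger0_norm ?normc_ge0//; apply: le_lt_trans.
  by rewrite -raddfB; exact: abs_Re.
- apply: (@measTr_lim _ (fun n z => complex.Im (u_ n z))) => [n|].
    by have /measT_ReIm[] := mu' n.
  apply: (aeT1 h) => z _ hz; apply/cvgrPdistC_lt => e e0.
  move/cvgrPdist_lt : hz => /(_ e e0); apply: filterS => n.
  rewrite sub0r normrN ger0_norm ?normc_ge0//; apply: le_lt_trans.
  by rewrite -raddfB; exact: abs_Im.
Qed.

End ComplexFunctions.

(** * Integrable, square integrable and bounded functions on the circle *)

Section CircleIntegral.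
Variable R : realType.
Local Notation pi := (@pi R).
Implicit Types (c : R[i]) (f g : R[i] -> R) (b u v w : R[i] -> R[i]).

Definition L1T u := measurableT_fun u /\ (nint (fun z => normc (u z)) < +oo)%E.
Definition L2T u := measurableT_fun u /\ (nint (fun z => (normc (u z) ^+ 2)%R) < +oo)%E.
Definition norm1 u : R := (2 * pi)^-1 * rint (fun z => normc (u z)).
(** The square is kept throughout, so the triangle inequality takes the form [norm2sqD], with
    factors 2. An infinite integral would be read as 0 by [rint], which is why [L2T] accompanies
    most statements. *)
Definition norm2sq u : R := (2 * pi)^-1 * rint (fun z => normc (u z) ^+ 2).

Lemma integralTE u : integralT u = ((2 * pi)^-1 * rint (fun z => complex.Re (u z)))
  +i* ((2 * pi)^-1 * rint (fun z => complex.Im (u z))).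
Proof. by []. Qed.

Lemma norm2sq_ge0 u : 0 <= norm2sq u.
Proof. by rewrite mulr_ge0 ?pi2V_ge0// rint_ge0. Qed.

Lemma nint_norm2sq u : L2T u ->
  nint (fun z => normc (u z) ^+ 2) = (2 * pi * norm2sq u)%:E.
Proof.
by move=> [_ h]; rewrite nint_fine// /norm2sq mulrA divff ?mul1r// gt_eqF ?pi2_gt0.
Qed.

Lemma L2T_le u (M : R) : measurableT_fun u ->
  (nint (fun z => (normc (u z) ^+ 2)%R) <= (2 * pi * M)%:E)%E -> L2T u /\ norm2sq u <= M.
Proof.
move=> mu' h; have uL : L2T u by split => //; apply: (le_lt_trans h); rewrite ltry.
split => //; move: h; rewrite nint_norm2sq// lee_fin.
by rewrite ler_pM2l// pi2_gt0.
Qed.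

Lemma L1T_int u : L1T u -> intTr (fun z => normc (u z)).
Proof. by move=> [mu' h]; apply: intTr_ge0 => //; exact: measTr_normc. Qed.

Lemma L2T_int u : L2T u -> intTr (fun z => normc (u z) ^+ 2).
Proof. by move=> [mu' h]; apply: intTr_ge0 => //; exact: measTr_normc2. Qed.

Lemma L1T_Re u : L1T u -> intTr (fun z => complex.Re (u z)).
Proof.
move=> [mu' h]; apply: (@intTr_le _ _ (fun z => normc (u z))) => //.
  by have /measT_ReIm[] := mu'.
by apply: aeTW => z _; exact: abs_Re.
Qed.

Lemma L1T_Im u : L1T u -> intTr (fun z => complex.Im (u z)).
Proof.
move=> [mu' h]; apply: (@intTr_le _ _ (fun z => normc (u z))) => //.
  by have /measT_ReIm[] := mu'.
by apply: aeTW => z _; exact: abs_Im.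
Qed.

Lemma L1T_le u g : measurableT_fun u -> aeT (fun z => normc (u z) <= g z) ->
  (forall z, 0 <= g z) -> (nint g < +oo)%E -> L1T u.
Proof. by move=> mu' h g0 gi; split => //; apply: le_lt_trans gi; exact: le_nint. Qed.

Lemma L2T_bound u g : measurableT_fun u -> aeT (fun z => normc (u z) ^+ 2 <= g z) ->
  (forall z, 0 <= g z) -> (nint g < +oo)%E -> L2T u.
Proof. by move=> mu' h g0 gi; split => //; apply: le_lt_trans gi; exact: le_nint. Qed.

Lemma L2T_eq u v : eqT u v -> L2T u -> L2T v.
Proof.
move=> uv [mu' h]; apply: (@L2T_bound v (fun z => normc (u z) ^+ 2)) => //.
  exact: measT_eq mu'.
by apply: (aeT1 uv) => z _ ->.
Qed.

Lemma L1TD u v : L1T u -> L1T v -> L1T (fun z => u z + v z).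
Proof.
move=> [mu' ui] [mv vi]; apply: (@L1T_le _ (fun z => normc (u z) + normc (v z))).
- exact: measTD.
- by apply: aeTW => z _; exact: le_normcD.
- by move=> z; rewrite addr_ge0.
- by rewrite nintD//; [rewrite lte_add_pinfty|exact: measTr_normc|exact: measTr_normc].
Qed.

Lemma L1TZ c u : L1T u -> L1T (fun z => c * u z).
Proof.
move=> [mu' ui]; apply: (@L1T_le _ (fun z => normc c * normc (u z))).
- by apply: measTM => //; exact: measT_cst.
- by apply: aeTW => z _; rewrite normcM.
- by move=> z; rewrite mulr_ge0.
- by rewrite nintZ ?lte_mul_pinfty ?lee_fin//; exact: measTr_normc.
Qed.

Lemma L2TD u v : L2T u -> L2T v -> L2T (fun z => u z + v z).
Proof.
move=> [mu' ui] [mv vi].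
apply: (@L2T_bound _ (fun z => 2 * normc (u z) ^+ 2 + 2 * normc (v z) ^+ 2)).
- exact: measTD.
- by apply: aeTW => z _; exact: sqr_normcD.
- by move=> z; rewrite addr_ge0// mulr_ge0.
- have mu2 := measTr_normc2 mu'; have mv2 := measTr_normc2 mv.
  have h2 w z : 0 <= 2 * normc (w z) ^+ 2 :> R by rewrite mulr_ge0.
  have m2 f : measTr f -> measTr (fun z => 2 * f z).
    by move=> mf; apply: measTrM => //; exact: measTr_cst.
  rewrite nintD; [|exact: h2|exact: h2|exact: m2|exact: m2].
  by rewrite !nintZ// lte_add_pinfty// lte_mul_pinfty// lee_fin.
Qed.

Lemma L2TM b u : Linfty b -> L2T u -> L2T (fun z => b z * u z).
Proof.
move=> [mb [M bM]] [mu' ui].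
apply: (@L2T_bound _ (fun z => M ^+ 2 * normc (u z) ^+ 2)).
- exact: measTM.
- apply: (aeT1 bM) => z _ h; rewrite normcM exprMn ler_wpM2r//.
  by rewrite ler_pXn2r// nnegrE// (le_trans _ h).
- by move=> z; rewrite mulr_ge0// sqr_ge0.
- by rewrite nintZ ?lte_mul_pinfty ?lee_fin ?sqr_ge0//; exact: measTr_normc2.
Qed.

Lemma L1TM b u : Linfty b -> L1T u -> L1T (fun z => b z * u z).
Proof.
move=> [mb [M bM]] [mu' ui].
apply: (@L1T_le _ (fun z => `|M| * normc (u z))).
- exact: measTM.
- apply: (aeT1 bM) => z _ h; rewrite normcM ler_wpM2r//.
  by rewrite (le_trans h)// ler_norm.
- by move=> z; rewrite mulr_ge0.
- by rewrite nintZ ?lte_mul_pinfty ?lee_fin//; exact: measTr_normc.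
Qed.

Lemma L2M_L1 u v : L2T u -> L2T v -> L1T (fun z => u z * v z).
Proof.
move=> [mu' ui] [mv vi].
have mu2 := measTr_normc2 mu'; have mv2 := measTr_normc2 mv.
apply: (@L1T_le _ (fun z => normc (u z) ^+ 2 + normc (v z) ^+ 2)).
- exact: measTM.
- apply: aeTW => z _; rewrite normcM.
  have := sqr_ge0 (normc (u z) - normc (v z)).
  by have := sqr_ge0 (normc (u z) + normc (v z)); nra.
- by move=> z; rewrite addr_ge0.
- by rewrite nintD// lte_add_pinfty.
Qed.

Lemma Linfty_cst c : Linfty (fun=> c : R[i]).
Proof. by split; [exact: measT_cst|exists (normc c); apply: aeTW]. Qed.

Lemma Linfty_L2 b : Linfty b -> L2T b.
Proof.
move=> bL; have h1 : L2T (fun=> 1).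
  by split; [exact: measT_cst|rewrite nint_cst ltry].
by have := L2TM bL h1; under eq_fun do rewrite mulr1.
Qed.

Lemma L2_L1 u : L2T u -> L1T u.
Proof.
move=> uL; have := L2M_L1 (Linfty_L2 (Linfty_cst 1)) uL.
by under eq_fun do rewrite mul1r.
Qed.

Lemma L2TZ c u : L2T u -> L2T (fun z => c * u z).
Proof. by apply: L2TM; exact: Linfty_cst. Qed.

Lemma L2TN u : L2T u -> L2T (fun z => - u z).
Proof. by move=> /(L2TZ (-1)); under eq_fun do rewrite mulN1r. Qed.

Lemma L2TB u v : L2T u -> L2T v -> L2T (fun z => u z - v z).
Proof. by move=> uL vL; apply: L2TD => //; exact: L2TN. Qed.

Lemma L1TN u : L1T u -> L1T (fun z => - u z).
Proof. by move=> /(L1TZ (-1)); under eq_fun do rewrite mulN1r. Qed.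

Lemma L1TB u v : L1T u -> L1T v -> L1T (fun z => u z - v z).
Proof. by move=> uL vL; apply: L1TD => //; exact: L1TN. Qed.

Lemma L2T_conj u : L2T u -> L2T (fun z => (u z)^*).
Proof.
move=> [mu' ui]; split; first exact: measT_conj.
by under eq_fun do rewrite normc_conj.
Qed.

Lemma LinftyM (b c : R[i] -> R[i]) : Linfty b -> Linfty c -> Linfty (fun z => b z * c z).
Proof.
move=> [mb [M bM]] [mc [K cK]]; split; first exact: measTM.
exists (M * K); apply: (aeT2 bM cK) => z _ h k; rewrite normcM.
by apply: ler_pM.
Qed.

Lemma LinftyD (b c : R[i] -> R[i]) : Linfty b -> Linfty c -> Linfty (fun z => b z + c z).
Proof.
move=> [mb [M bM]] [mc [K cK]]; split; first exact: measTD.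
exists (M + K); apply: (aeT2 bM cK) => z _ h k.
by rewrite (le_trans (le_normcD _ _))// lerD.
Qed.

Lemma Linfty_conj b : Linfty b -> Linfty (fun z => (b z)^*).
Proof.
move=> [mb [M bM]]; split; first exact: measT_conj.
by exists M; apply: (aeT1 bM) => z _; rewrite normc_conj.
Qed.

Lemma Linfty_eq (b c : R[i] -> R[i]) : eqT b c -> Linfty b -> Linfty c.
Proof.
move=> bc [mb [M bM]]; split; first exact: measT_eq mb.
by exists M; apply: (aeT2 bM bc) => z _ h <-.
Qed.

Lemma Linfty_id : Linfty (fun z : R[i] => z).
Proof. by split; [exact: measT_id|exists 1; apply: aeTW => z ->]. Qed.

Lemma LinftyX b n : Linfty b -> Linfty (fun z => b z ^+ n).
Proof.
move=> bL; elim: n => [|n IH].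
  by under eq_fun do rewrite expr0; exact: Linfty_cst.
by under eq_fun do rewrite exprS; exact: LinftyM.
Qed.

Lemma integralT_eq u v : eqT u v -> integralT u = integralT v.
Proof.
move=> uv; rewrite !integralTE; congr (_ * _ +i* (_ * _));
  by apply: rint_eq; apply: (aeT1 uv) => z _ ->.
Qed.

Lemma integralTD u v : L1T u -> L1T v ->
  integralT (fun z => u z + v z) = integralT u + integralT v.
Proof.
move=> uL vL; rewrite !integralTE.
under [X in rint X]eq_fun do rewrite raddfD.
under [X in _ +i* (_ * rint X)]eq_fun do rewrite raddfD.
rewrite !rintD; [|exact: L1T_Im|exact: L1T_Im|exact: L1T_Re|exact: L1T_Re].
by rewrite !mulrDr.
Qed.

Lemma integralTZ c u : L1T u -> integralT (fun z => c * u z) = c * integralT u.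
Proof.
move=> uL; have rL := L1T_Re uL; have iL := L1T_Im uL; rewrite !integralTE.
have -> : (fun z => complex.Re (c * u z)) = (fun z =>
  complex.Re c * complex.Re (u z) + - complex.Im c * complex.Im (u z)).
  by apply/funext => z; rewrite ReM mulNr.
have -> : (fun z => complex.Im (c * u z)) = (fun z =>
  complex.Re c * complex.Im (u z) + complex.Im c * complex.Re (u z)).
  by apply/funext => z; rewrite ImM.
rewrite !rintD ?rintZ//; try exact: intTrZ.
by case: c => a b /=; apply/eqP; rewrite eq_complex /=; apply/andP; split; apply/eqP; ring.
Qed.

Lemma integralT_conj u : L1T u -> integralT (fun z => (u z)^*) = (integralT u)^*.
Proof.
move=> uL; rewrite !integralTE /=.
under [X in rint X]eq_fun do rewrite ReJ.
under [X in _ +i* (_ * rint X)]eq_fun do rewrite ImJ -mulN1r.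
by rewrite rintZ ?mulN1r ?mulrN//; exact: L1T_Im.
Qed.

Lemma rint_cst (x : R) : rint (fun=> x) = x * (2 * pi).
Proof. by have := nint_cst x; rewrite /rint /Rintegral /nint => ->. Qed.

Lemma integralT_cst c : integralT (fun=> c : R[i]) = c.
Proof.
rewrite integralTE !rint_cst; have h := pi2_gt0 R; case: c => a b /=.
have aux (x : R) : (2 * pi)^-1 * (x * (2 * pi)) = x.
  by rewrite mulrCA mulVf ?mulr1// gt_eqF.
by rewrite !aux.
Qed.

Lemma integralT0 : integralT (fun=> 0 : R[i]) = 0. Proof. exact: integralT_cst. Qed.

Lemma integralTB u v : L1T u -> L1T v ->
  integralT (fun z => u z - v z) = integralT u - integralT v.
Proof.
move=> uL vL; under eq_fun do rewrite -mulN1r.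
by rewrite integralTD ?integralTZ ?mulN1r//; exact: L1TZ.
Qed.

(** The factor 2 comes from bounding real and imaginary parts separately; the estimates below absorb
    it. *)
Lemma normc_integralT u : L1T u -> normc (integralT u) <= 2 * norm1 u.
Proof.
move=> uL; rewrite (le_trans (normc_le_ReIm _))// integralTE /=.
have key f : intTr f -> aeT (fun z => `|f z| <= normc (u z)) ->
    `|(2 * pi)^-1 * rint f| <= norm1 u.
  move=> fi fu; rewrite normrM ger0_norm ?pi2V_ge0// ler_wpM2l ?pi2V_ge0//.
  rewrite -lee_fin (le_trans (abs_rint fi))//.
  by case: (uL) => _ ui; rewrite -nint_fine//; apply: le_nint.
rewrite [leRHS]mulr_natl mulr2n lerD//; apply: key.
- exact: L1T_Re.
- by apply: aeTW => z _; exact: abs_Re.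
- exact: L1T_Im.
- by apply: aeTW => z _; exact: abs_Im.
Qed.

Lemma le_norm1 u v : L1T u -> L1T v -> aeT (fun z => normc (u z) <= normc (v z)) ->
  norm1 u <= norm1 v.
Proof.
by move=> uL vL h; rewrite ler_wpM2l ?pi2V_ge0// le_rint//; exact: L1T_int.
Qed.

Lemma le_norm2sq u v : L2T u -> L2T v -> aeT (fun z => normc (u z) <= normc (v z)) ->
  norm2sq u <= norm2sq v.
Proof.
move=> uL vL h; rewrite ler_wpM2l ?pi2V_ge0// le_rint//; try exact: L2T_int.
by apply: (aeT1 h) => z _ ?; rewrite ler_pXn2r ?nnegrE.
Qed.

Lemma norm2sq_eq u v : aeT (fun z => normc (u z) = normc (v z)) ->
  norm2sq u = norm2sq v.
Proof. by move=> h; congr (_ * _); apply: rint_eq; apply: (aeT1 h) => z _ ->. Qed.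

Lemma integralT_mulconj u : L2T u ->
  integralT (fun z => u z * (u z)^*) = (norm2sq u)%:C.
Proof.
move=> uL; rewrite integralTE; under [X in rint X]eq_fun do rewrite mul_conjc /=.
under [X in _ +i* (_ * rint X)]eq_fun do rewrite mul_conjc /=.
by rewrite rint_cst mul0r mulr0.
Qed.

Lemma norm2sq_eq0 u : L2T u -> norm2sq u = 0 -> eqT u (fun=> 0).
Proof.
move=> uL u0; have := nint_norm2sq uL; rewrite u0 mulr0 => /nint_eq0 h.
have /aeT1 : aeT (fun z => normc (u z) ^+ 2 = 0).
  by apply: h => //; apply: measTr_normc2; case: uL.
by apply => z _ /eqP; rewrite sqrf_eq0 => /eqP/eq0_normc.
Qed.

Lemma norm2sqD u v : L2T u -> L2T v ->
  norm2sq (fun z => u z + v z) <= 2 * norm2sq u + 2 * norm2sq v.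
Proof.
move=> uL vL; rewrite /norm2sq [2 * (_ * _)]mulrCA [2 * (_ * rint _)]mulrCA -mulrDr.
rewrite ler_wpM2l ?pi2V_ge0// -!rintZ; try exact: L2T_int.
have [iu iv] := (L2T_int uL, L2T_int vL).
rewrite -rintD; [|exact: intTrZ|exact: intTrZ].
apply: le_rint; [by apply: L2T_int; exact: L2TD|by apply: intTrD; exact: intTrZ|].
by apply: aeTW => z _; exact: sqr_normcD.
Qed.

Lemma norm2sqZ c u : L2T u -> norm2sq (fun z => c * u z) = normc c ^+ 2 * norm2sq u.
Proof.
move=> uL; rewrite /norm2sq [RHS]mulrCA -(rintZ (normc c ^+ 2)); last exact: L2T_int.
by congr (_ * rint _); apply/funext => z; rewrite normcM exprMn.
Qed.

Lemma dotTDl u v w : L2T u -> L2T v -> L2T w ->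
  dotT (fun z => u z + v z) w = dotT u w + dotT v w.
Proof.
move=> uL vL wL; rewrite /dotT; under eq_fun do rewrite mulrDl.
by apply: integralTD; apply: L2M_L1 => //; exact: L2T_conj.
Qed.

Lemma dotTZl c u w : L2T u -> L2T w -> dotT (fun z => c * u z) w = c * dotT u w.
Proof.
move=> uL wL; rewrite /dotT; under eq_fun do rewrite -mulrA.
by apply: integralTZ; apply: L2M_L1 => //; exact: L2T_conj.
Qed.

Lemma dotTC u w : L2T u -> L2T w -> dotT w u = (dotT u w)^*.
Proof.
move=> uL wL; rewrite /dotT -integralT_conj; last first.
  by apply: L2M_L1 => //; exact: L2T_conj.
by congr integralT; apply/funext => z; rewrite rmorphM /= conjcK mulrC.
Qed.

Lemma dotTBl u v w : L2T u -> L2T v -> L2T w ->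
  dotT (fun z => u z - v z) w = dotT u w - dotT v w.
Proof.
move=> uL vL wL; under eq_fun do rewrite -mulN1r.
by rewrite dotTDl ?dotTZl ?mulN1r//; exact: L2TZ.
Qed.

Lemma norm2sq_addZ c u w : L2T u -> L2T w ->
  norm2sq (fun z => u z + c * w z) =
  norm2sq u + 2 * complex.Re (c * dotT w u) + normc c ^+ 2 * norm2sq w.
Proof.
move=> uL wL; have cwL := L2TZ c wL.
apply: (@complexI R); set s := fun z => u z + c * w z.
have sL : L2T s by exact: L2TD.
have dotTE v : L2T v -> dotT v v = (norm2sq v)%:C by exact: integralT_mulconj.
have sl v : L2T v -> dotT s v = dotT u v + c * dotT w v.
  by move=> vL; rewrite /s dotTDl// dotTZl.
rewrite -dotTE// (sl s sL) (dotTC sL uL) (dotTC sL wL) (sl u uL) (sl w wL).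
rewrite (dotTC wL uL) !dotTE//; case: (dotT w u) => a b; case: c {cwL s sL sl} => p q.
rewrite normc_sqr /=.
by apply/eqP; rewrite eq_complex /=; apply/andP; split; apply/eqP; ring.
Qed.

(** Nonnegativity of [norm2sq] of u + c w at the minimizing c = - <u, w> / |w|^2; when |w| = 0 the
    function w vanishes almost everywhere. *)
Lemma cauchy_schwarz u w : L2T u -> L2T w ->
  normc (dotT u w) ^+ 2 <= norm2sq u * norm2sq w.
Proof.
move=> uL wL; have [w0|w0] := eqVneq (norm2sq w) 0.
  rewrite /dotT (@integralT_eq _ (fun=> 0)) ?integralT0 ?w0 ?mulr0//.
    by rewrite -[0]/(0%:C) normcR normr0 expr0n.
  by apply: (aeT1 (norm2sq_eq0 wL w0)) => z _ ->; rewrite rmorph0 mulr0.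
have wp : 0 < norm2sq w by rewrite lt_def w0 norm2sq_ge0.
have := norm2sq_ge0 (fun z => u z + (- (dotT u w / (norm2sq w)%:C)) * w z).
rewrite norm2sq_addZ// (dotTC uL wL).
set x := dotT u w; set W := norm2sq w in w0 wp *.
have -> : - (x / W%:C) * x^* = (- (normc x ^+ 2 / W))%:C.
  by rewrite mulNr mulrAC mul_conjc -fmorphV -rmorphM -rmorphN.
rewrite -[complex.Re _%:C]/(- (normc x ^+ 2 / W)).
rewrite normcN normcM -fmorphV normcR exprMn real_normK ?num_real//.
rewrite -ler_pdivrMr//; set n := normc x ^+ 2.
have -> : n * W^-1 ^+ 2 * W = n / W by field.
by set q := n / W; lra.
Qed.

End CircleIntegral.

(** * Weak convergence and completeness in L^2 *)

Section Convergence.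
Variable R : realType.
Local Notation mu := (@lebesgue_measure R).
Local Notation pi := (@pi R).
Local Notation D := (`[(0 : R), 2 * pi]%classic).
Implicit Types (c : R[i]) (f g : R[i] -> R) (b u v w phi : R[i] -> R[i]).

(* Vitali by truncation: |u||phi| <= min(|u|, l|phi|)|phi| + |u|^2 / l. *)
Lemma weak_cvg0 (u_ : nat -> R[i] -> R[i]) phi (M : R) :
  (forall n, L2T (u_ n)) -> (forall n, norm2sq (u_ n) <= M) ->
  aeT (fun z => normc (u_ n z) @[n --> \oo] --> (0 : R)) -> L2T phi ->
  normc (integralT (fun z => u_ n z * phi z)) @[n --> \oo] --> (0 : R).
Proof.
move=> uL uM u0 pL.
have pi20 := pi2_gt0 R; have piV0 := pi2V_ge0 R.
have M0 : 0 <= M by apply: le_trans (uM 0%N); exact: norm2sq_ge0.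
apply/cvgrPdist_lt => e e0.
(* This makes M / l at most e / 4, and M + 1 keeps l positive when M = 0. With e / 4 for the
   truncated part and the factor 2 of [normc_integralT], the total stays below e. *)
pose l := 4 * (M + 1) / e.
have l0 : 0 < l by rewrite divr_gt0// mulr_gt0// ltr_wpDl.
pose B n z := Num.min (normc (u_ n z)) (l * normc (phi z)) * normc (phi z).
have mp : measTr (fun z => normc (phi z)) by apply: measTr_normc; case: pL.
have mB n : measTr (B n).
  apply: measTrM => //; apply: measTr_min; first by apply: measTr_normc; case: (uL n).
  by apply: measTrM => //; exact: measTr_cst.
have B0 n z : 0 <= B n z by rewrite mulr_ge0// le_min normc_ge0 mulr_ge0// ltW.
pose G z := l * normc (phi z) ^+ 2.
have mp2 : measTr (fun z => normc (phi z) ^+ 2) by apply: measTr_normc2; case: pL.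
have G0 z : 0 <= G z by rewrite mulr_ge0 ?sqr_ge0 ?ltW.
have mG : measTr G by apply: measTrM => //; exact: measTr_cst.
have Gfin : (nint G < +oo)%E.
  rewrite nintZ//; last exact: ltW.
  by rewrite lte_mul_pinfty ?lee_fin ?(ltW l0)//; case: pL.
have BG n : aeT (fun z => B n z <= G z).
  by apply: aeTW => z _; rewrite /B /G expr2 mulrA ler_wpM2r// ge_min lexx orbT.
have cB : aeT (fun z => B n z @[n --> \oo] --> (0 : R)).
  apply: (aeT1 u0) => z _ hz.
  apply: (@squeeze_cvgr _ _ _ _ (fun=> 0) (fun n => normc (u_ n z) * normc (phi z))).
  - by apply: nearW => n; rewrite B0 ler_wpM2r// ge_min lexx.
  - exact: cvg_cst.
  - by rewrite -[X in _ --> X](mul0r (normc (phi z))); apply: cvgMr_tmp.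
have Bi n : intTr (B n).
  by apply: (@intTr_le _ _ G) => //; apply: (aeT1 (BG n)) => z _; rewrite ger0_norm.
have hB : rint (B n) @[n --> \oo] --> (0 : R).
  by apply: fine_cvg; exact: (nint_dct mB B0 cB G0 mG Gfin BG).
have e4 : 0 < 2 * pi * (e / 4) by rewrite mulr_gt0// divr_gt0.
move/cvgrPdist_lt : hB => h; have {}h := h _ e4.
apply: filterS h => n; rewrite !sub0r !normrN (ger0_norm (rint_ge0 (B0 n))) => h.
rewrite ger0_norm//.
have u2 := L2T_int (uL n).
have iL : L1T (fun z => u_ n z * phi z) by exact: L2M_L1.
have key : rint (fun z => normc (u_ n z * phi z)) <=
   rint (B n) + l^-1 * rint (fun z => normc (u_ n z) ^+ 2).
  rewrite -rintZ// -rintD//; last exact: intTrZ.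
  apply: le_rint; [exact: L1T_int|by apply: intTrD => //; exact: intTrZ|].
  apply: aeTW => z _; rewrite normcM /B.
  have [h1|h1] := leP (normc (u_ n z)) (l * normc (phi z)).
    by rewrite lerDl mulr_ge0 ?sqr_ge0// invr_ge0 ltW.
  rewrite (le_trans (y := l^-1 * normc (u_ n z) ^+ 2))//; last first.
    by rewrite lerDr; apply: mulr_ge0 => //; apply: mulr_ge0 => //; exact: ltW.
  rewrite expr2 mulrCA ler_wpM2l// -ler_pdivrMl ?invr_gt0// invrK.
  exact: ltW.
have h2 : norm1 (fun z => u_ n z * phi z) <= (2 * pi)^-1 * rint (B n) + l^-1 * norm2sq (u_ n).
  by rewrite /norm1 /norm2sq [l^-1 * _]mulrCA -mulrDr ler_wpM2l.
have h3 : (2 * pi)^-1 * rint (B n) < e / 4 by rewrite mulrC ltr_pdivrMr// mulrC.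
have h4 : l^-1 * norm2sq (u_ n) <= e / 4 * (M / (M + 1)).
  rewrite (le_trans (y := l^-1 * M))//.
    by rewrite ler_wpM2l ?uM// invr_ge0 ltW.
  have en : e != 0 by rewrite gt_eqF.
  have Mn : M + 1 != 0 by rewrite gt_eqF// ltr_wpDl.
  rewrite /l le_eqVlt; apply/orP; left; apply/eqP; field.
  by rewrite ?en ?Mn.
have h5 : M / (M + 1) <= 1 by rewrite ler_pdivrMr ?ltr_wpDl// mul1r lerDl.
have h6 : e / 4 * (M / (M + 1)) <= e / 4 by rewrite ger_pMr// divr_gt0.
have := normc_integralT iL; lra.
Qed.

(** The full series has a finite integral by monotone convergence, hence a finite sum almost
    everywhere, and this sum bounds every partial sum. *)
Lemma aeT_series_bounded (f_ : nat -> R[i] -> R) (c_ : nat -> R) (K : R) :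
  (forall n, measTr (f_ n)) -> (forall n z, 0 <= f_ n z) ->
  (forall n, (nint (f_ n) <= (c_ n)%:E)%E) ->
  (forall n, \sum_(0 <= k < n) c_ k <= K) ->
  aeT (fun z => exists B, forall n, \sum_(0 <= k < n) f_ k z <= B).
Proof.
move=> mf f_0 fc cK.
have /choice[h hh] := fun n => measTr_ge0 (f_0 n) (mf n).
have /ae_foralln hn : forall n, {ae mu, forall t, D t -> f_ n (expi t) = h n t}.
  by move=> n; have [] := hh n.
have mh n : measurable_fun D (EFin \o h n).
  by apply/measurable_EFinP; apply: measurable_funTS; have [] := hh n.
have h0 n t : D t -> (0 <= (EFin \o h n) t)%E.
  by move=> _; rewrite lee_fin; have [] := hh n.
pose G t := (\sum_(0 <= n <oo) (EFin \o h n) t)%E.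
have G0 t : D t -> (0 <= G t)%E by move=> tD; apply: nneseries_ge0 => n _ _; exact: h0.
have mG : measurable_fun D G.
  by apply: ge0_emeasurable_sum => [k x Dx _|k _]; [exact: h0|exact: mh].
have iG : mu.-integrable D G.
  apply/integrableP; split => //.
  have -> : (\int[mu]_(t in D) `|G t| = \int[mu]_(t in D) G t)%E.
    by apply: eq_integral => t /set_mem tD; rewrite gee0_abs ?G0.
  rewrite /G integral_nneseries//.
  apply: (@le_lt_trans _ _ K%:E); last exact: ltry.
  apply: lime_le.
    by apply: is_cvg_nneseries => n _ _; apply: integral_ge0 => t; exact: h0.
  apply: nearW => n; rewrite (le_trans (y := (\sum_(0 <= k < n) (c_ k)%:E)%E))//.
    apply: lee_sum => k _; rewrite -(@nint_rep _ (f_ k)) ?fc//.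
    by have [] := hh k.
  by rewrite sumEFin lee_fin.
have hG := @integrable_ae _ _ _ mu D (@measurable_D R) G iG.
apply/aeT_itv; apply: ae_imp (ae_and hG hn) _ => t [h1 h2] tD.
exists (fine (G t)) => n; rewrite -lee_fin fineK ?h1//.
rewrite -sumEFin (le_trans _ (nneseries_lim_ge n _))//.
  by rewrite /=; apply: lee_sum => k _; rewrite h2.
by move=> k _ _; rewrite lee_fin; have [] := hh k.
Qed.

Lemma geometric_sum_le (x : R) n : 0 <= x < 1 -> \sum_(0 <= k < n) x ^+ k <= (1 - x)^-1.
Proof.
move=> /andP[x0 x1]; have x1' : 0 < 1 - x by rewrite subr_gt0.
rewrite -[leRHS]mul1r ler_pdivlMr// mulrC.
elim: n => [|n IH]; first by rewrite big_geq// mulr0.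
have e : (1 - x) * \sum_(0 <= k < n) x ^+ k = 1 - x ^+ n.
  elim: n {IH} => [|n IH]; first by rewrite big_geq// mulr0 expr0 subrr.
  by rewrite big_nat_recr//= mulrDr IH exprS; ring.
by rewrite big_nat_recr//= mulrDr e mulrBl mul1r -exprS addrA subrK gerDl oppr_le0 exprn_ge0.
Qed.

(** Riesz-Fischer for a fast Cauchy sequence: the increments decay geometrically at almost every
    point, which yields a pointwise limit, and Fatou's lemma carries the L^2 bounds over to it. *)
Lemma L2_complete (u_ : nat -> R[i] -> R[i]) : (forall n, L2T (u_ n)) ->
  (forall n, norm2sq (fun z => u_ n.+1 z - u_ n z) <= 8^-1 ^+ n) ->
  exists2 u, L2T u & forall n, norm2sq (fun z => u_ n z - u z) <= 4 * 8^-1 ^+ n.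
Proof.
move=> uL ud; pose d n z := u_ n.+1 z - u_ n z.
have dL n : L2T (d n) by exact: L2TB.
have pi20 := pi2_gt0 R.
(* The weight 4^k turns the rate 8^-k into 2^-k, still summable, and a bound B on the weighted sum
   gives |d_k| <= sqrt(B) 2^-k at the point. *)
have hser : aeT (fun z => exists B, forall n,
    \sum_(0 <= k < n) 4 ^+ k * normc (d k z) ^+ 2 <= B).
  apply: (@aeT_series_bounded _ (fun k => 2 * pi * 2^-1 ^+ k) (2 * pi * (1 - 2^-1)^-1)).
  - by move=> n; apply: measTrM; [exact: measTr_cst|apply: measTr_normc2; case: (dL n)].
  - by move=> n z; rewrite mulr_ge0 ?sqr_ge0 ?exprn_ge0.
  - move=> n; rewrite nintZ ?exprn_ge0//.
      rewrite nint_norm2sq// -EFinM lee_fin mulrCA ler_wpM2l ?(ltW pi20)//.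
      rewrite (le_trans (y := 4 ^+ n * 8^-1 ^+ n))// ?ler_wpM2l ?exprn_ge0 ?ud//.
      by rewrite -exprMn (_ : 4 * 8^-1 = 2^-1 :> R)//; lra.
    by apply: measTr_normc2; case: (dL n).
  - move=> n; rewrite -mulr_sumr ler_wpM2l ?(ltW pi20)// geometric_sum_le//.
    by apply/andP; split; lra.
have dcvg : aeT (fun z => exists w : R[i], normc (u_ n z - w) @[n --> \oo] --> (0 : R)).
  apply: (aeT1 hser) => z _ [B hB].
  have B0 : 0 <= B by rewrite (le_trans _ (hB 0%N))// big_geq.
  have hd k : normc (d k z) <= geometric (Num.sqrt B) 2^-1 k.
    rewrite /= -(@ler_pXn2r _ 2)// ?nnegrE ?mulr_ge0 ?sqrtr_ge0//.
    rewrite exprMn sqr_sqrtr// -exprM mulnC exprM (_ : 2^-1 ^+ 2 = 4^-1 :> R); last by field.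
    rewrite exprVn ler_pdivlMr ?exprn_gt0// mulrC.
    rewrite (le_trans _ (hB k.+1))// big_nat_recr//= lerDr.
    by apply: sumr_ge0 => j _; rewrite mulr_ge0 ?sqr_ge0 ?exprn_ge0.
  have gc : cvgn (series (geometric (Num.sqrt B) (2^-1 : R))).
    by apply: is_cvg_geometric_series; rewrite ger0_norm; lra.
  have comp (p : R[i] -> R) : {morph p : a b / a - b} ->
      (forall a, `|p a| <= normc a) ->
      exists x, p (u_ n z) @[n --> \oo] --> (x : R).
    move=> pB hp; have sc : cvgn (series (fun k => p (d k z))).
      apply: normed_cvg; apply: (series_le_cvg _ _ _ gc) => k //.
      - exact: normr_ge0.
      - by rewrite /= mulr_ge0 ?sqrtr_ge0 ?exprn_ge0.
      - exact: le_trans (hp _) (hd k).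
    exists (p (u_ 0%N z) + limn (series (fun k => p (d k z)))).
    have -> : (fun n => p (u_ n z)) = (fun n => p (u_ 0%N z) + series (fun k => p (d k z)) n).
      apply/funext => n; rewrite /series /= (eq_bigr (fun k => p (u_ k.+1 z) - p (u_ k z))).
        by rewrite telescope_sumr// addrC subrK.
      by move=> k _; rewrite pB.
    by apply: cvgD => //; exact: cvg_cst.
  have [x hx] := comp (@complex.Re R) (raddfB _) (@abs_Re R).
  have [y hy] := comp (@complex.Im R) (raddfB _) (@abs_Im R).
  exists (x +i* y).
  apply: (@squeeze_cvgr _ _ _ _ (fun=> 0) (fun n => `|complex.Re (u_ n z) - x| +
    `|complex.Im (u_ n z) - y|)).
  - apply: nearW => n; rewrite normc_ge0 /= (le_trans (normc_le_ReIm _))//.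
    by rewrite !raddfB.
  - exact: cvg_cst.
  - rewrite -[X in _ --> X](addr0 0); apply: cvgD; rewrite -(@normr0 _ R); apply: cvg_norm.
      by rewrite -(subrr x); apply: cvgB => //; exact: cvg_cst.
    by rewrite -(subrr y); apply: cvgB => //; exact: cvg_cst.
(* The limit where there is one, and 0 on the remaining null set. *)
pose u z := xget 0 [set w | normc (u_ n z - w) @[n --> \oo] --> (0 : R)].
have uc : aeT (fun z => normc (u_ n z - u z) @[n --> \oo] --> (0 : R)).
  by apply: (aeT1 dcvg) => z _ [w hw]; rewrite /u; case: xgetP => [? -> //|/(_ w)].
have mu' : measurableT_fun u by apply: (measT_lim _ uc) => n; case: (uL n).
(* The constant 4 is preserved by the induction: with x = 8^-n, the step gives 2 (4 x / 8) + 2 x = 3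
   x. *)
have tail j n : norm2sq (fun z => u_ (n + j)%N z - u_ n z) <= 4 * 8^-1 ^+ n.
  elim: j n => [|j IH] n.
    rewrite addn0 (_ : (fun z => _) = (fun z => 0 * u_ n z)).
      by rewrite norm2sqZ// normc0 expr0n mul0r mulr_ge0// exprn_ge0.
    by apply/funext => z; rewrite subrr mul0r.
  have -> : (fun z => u_ (n + j.+1)%N z - u_ n z) =
      (fun z => (u_ (n.+1 + j)%N z - u_ n.+1 z) + d n z).
    by apply/funext => z; rewrite /d addSnnS addrA subrK.
  rewrite (le_trans (norm2sqD _ (dL n)))//; first exact: L2TB.
  have := ud n; have := IH n.+1; rewrite exprS -/(d n).
  have := exprn_ge0 n (_ : 0 <= 8^-1 :> R); rewrite invr_ge0 => /(_ (ler0n _ _)).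
  by set q := 8^-1 ^+ n; lra.
have hlim n : L2T (fun z => u z - u_ n z) /\
    norm2sq (fun z => u z - u_ n z) <= 4 * 8^-1 ^+ n.
  apply: L2T_le; first by apply: measTB => //; case: (uL n).
  apply: (@nint_fatou _ (fun j z => normc (u_ (n + j)%N z - u_ n z) ^+ 2)).
  - by move=> j; apply: measTr_normc2; apply: measTB; [case: (uL (n + j)%N)|case: (uL n)].
  - by move=> j z; exact: sqr_ge0.
  - by move=> z; exact: sqr_ge0.
  - apply: (aeT1 uc) => z _ hz.
    have hz' : normc (u_ (n + j)%N z - u z) @[j --> \oo] --> (0 : R).
      have := hz; rewrite -(cvg_shiftn n); under eq_fun do rewrite addnC; by [].
    have hn : normc (u_ (n + j)%N z - u_ n z) @[j --> \oo] --> normc (u z - u_ n z).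
      apply/cvgrPdist_le => e e0; move/cvgrPdist_le : hz' => /(_ e e0).
      apply: filterS => j; rewrite sub0r normrN ger0_norm//; apply: le_trans.
      rewrite (le_trans (abs_lerB_normc _ _))//.
      by rewrite le_eqVlt; apply/orP; left; apply/eqP; congr normc; ring.
    by rewrite expr2; under eq_fun do rewrite expr2; exact: cvgM.
  - by move=> j; rewrite nint_norm2sq ?lee_fin ?ler_wpM2l ?(ltW pi20)//; exact: L2TB.
exists u.
  have [h _] := hlim 0%N; have := L2TD h (uL 0%N).
  by under eq_fun do rewrite subrK.
move=> n; have [_] := hlim n; apply: le_trans; rewrite le_eqVlt; apply/orP; left.
by apply/eqP; apply: norm2sq_eq; apply: aeTW => z _; rewrite normcB.
Qed.

End Convergence.

Lemma normC_normc (R : realType) (z : R[i]) : `|z| = (normc z)%:C.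
Proof. by []. Qed.

(** Convergence in [R[i]^o] quantifies over a complex epsilon; a positive complex number is real, so
    the two notions agree. *)
Lemma cvg_normcP (R : realType) (T : Type) (F : set_system T) {FF : Filter F}
    (f : T -> R[i]) (l : R[i]) :
  f x @[x --> F] --> (l : R[i]^o) <-> normc (f x - l) @[x --> F] --> (0 : R).
Proof.
split=> h.
  have {}h := iffLR (@cvgrPdist_lt R[i] R[i]^o T F FF f l) h.
  apply/cvgrPdist_lt => e e0; have e0' : (0 : R[i]) < e%:C by rewrite ltcR.
  apply: filterS (h _ e0') => x; rewrite normC_normc ltcR sub0r normrN ger0_norm ?normc_ge0//.
  by rewrite normcB.
have {}h := iffLR (@cvgrPdist_lt R R^o T F FF _ 0) h.
apply: (iffRL (@cvgrPdist_lt R[i] R[i]^o T F FF f l)) => e e0.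
have [e1 e2] : complex.Im e = 0 /\ 0 < complex.Re e.
  by move: e0; rewrite ltcE /= => /andP[/eqP].
apply: filterS (h _ e2) => x; rewrite sub0r normrN ger0_norm ?normc_ge0// => hx.
rewrite normC_normc; case: e e1 e2 hx {e0} => p q /= -> p0 hx.
by rewrite -[p +i* 0]/(p%:C) ltcR normcB.
Qed.

Lemma cvg_cst_eq (R : realType) (x y : R) :
  (fun=> x) @ \oo --> y -> x = y.
Proof. by move=> h; rewrite -(cvg_lim (@Rhausdorff R) h) lim_cst. Qed.

Lemma le0_of_le_geometric (R : realType) (x C rho : R) : 0 <= rho < 1 ->
  (forall n, x <= C * rho ^+ n) -> x <= 0.
Proof.
move=> /andP[r0 r1] h.
have c : C * rho ^+ n @[n --> \oo] --> (0 : R).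
  by apply: (cvg_geometric C); rewrite ger0_norm.
by apply: (ler_cvg_to (cvg_cst x) c); apply: nearW.
Qed.

(** * Power series evaluated along a function of modulus at most r < 1 *)

Section PowerSeries.
Variable R : realType.
Implicit Types (c : R[i]) (b u v w phi : R[i] -> R[i]) (F : R[i] -> R[i]).

Definition power_series_of (a : nat -> R[i]) F := forall z : R[i], normc z < 1 ->
  \sum_(0 <= j < n) a j * z ^+ j @[n --> \oo] --> (F z : R[i]^o).

Lemma geometric_partial (z : R[i]) n :
  (1 - z) * \sum_(0 <= j < n) z ^+ j = 1 - z ^+ n.
Proof.
elim: n => [|n IH]; first by rewrite big_geq// mulr0 expr0 subrr.
by rewrite big_nat_recr//= mulrDr IH exprS; ring.
Qed.

Lemma power_series_geometric : power_series_of (fun=> 1) (fun z => (1 - z)^-1).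
Proof.
move=> z z1; apply/cvg_normcP.
have z0 : 1 - z != 0.
  by apply: contraTneq z1 => /eqP; rewrite subr_eq0 => /eqP <-; rewrite normc1 ltxx.
have e n : \sum_(0 <= j < n) 1 * z ^+ j - (1 - z)^-1 = - (1 - z)^-1 * z ^+ n.
  under eq_bigr do rewrite mul1r.
  by apply: (mulfI z0); rewrite mulrBr geometric_partial divff// mulNr mulrN mulrA divff//; ring.
under eq_fun do rewrite e normcM normcX.
by apply: (cvg_geometric (normc (- (1 - z)^-1))); rewrite ger0_norm.
Qed.

Lemma power_series_at0 a F : power_series_of a F -> F 0 = a 0%N.
Proof.
move=> Fa; have z1 : normc (0 : R[i]) < 1 by rewrite normc0.
have /cvg_normcP := Fa 0 z1; rewrite -cvg_shiftS.
have -> : [sequence normc (\sum_(0 <= j < n.+1) a j * 0 ^+ j - F 0)]_n =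
   fun=> normc (a 0%N - F 0).
  apply/funext => n /=; rewrite big_nat_recl//= expr0 mulr1 big1 ?addr0// => j _.
  by rewrite exprS mul0r mulr0.
move=> /cvg_cst_eq/eq0_normc/eqP.
by rewrite subr_eq0 => /eqP ->.
Qed.

(** Convergence at the intermediate radius s = (1 + r) / 2 bounds the terms there: two consecutive
    partial sums within 1 of the limit differ by at most 2. The finitely many earlier terms are
    added to the constant, and rho = r / s. *)
Lemma power_series_majorant a F (r : R) : power_series_of a F -> 0 <= r < 1 ->
  exists B rho, [/\ 0 <= B, 0 <= rho < 1 & forall j, normc (a j) * r ^+ j <= B * rho ^+ j].
Proof.
move=> Fa /andP[r0 r1]; pose s := (1 + r) / 2.
have s0 : 0 < s by rewrite /s; lra.
have s1 : s < 1 by rewrite /s; lra.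
have sC : normc (s%:C) < 1 by rewrite normcR gtr0_norm.
have /cvg_normcP/cvgrPdist_lt/(_ 1 ltr01)[N _ hN] := Fa _ sC.
have hb n : (N <= n)%N -> normc (a n) * s ^+ n <= 2.
  move=> Nn; have h1 := hN n Nn; have h2 := hN n.+1 (leqW Nn).
  move: h1 h2; rewrite /= !sub0r !normrN !ger0_norm//.
  set x := \sum_(0 <= j < n) _; set y := \sum_(0 <= j < n.+1) _ => h1 h2.
  have e : a n * s%:C ^+ n = (y - F s%:C) + (F s%:C - x).
    by rewrite /y big_nat_recr//= -/x; ring.
  have : normc (a n * s%:C ^+ n) <= normc (y - F s%:C) + normc (F s%:C - x).
    by rewrite e le_normcD.
  rewrite normcM normcX normcR gtr0_norm// [normc (F _ - _)]normcB; lra.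
pose B := 2 + \sum_(0 <= j < N) normc (a j) * s ^+ j.
have t0 j : 0 <= normc (a j) * s ^+ j by rewrite mulr_ge0// exprn_ge0// ltW.
have S0 : 0 <= \sum_(0 <= j < N) normc (a j) * s ^+ j by apply: sumr_ge0.
exists B, (r / s); split; first by rewrite addr_ge0.
  rewrite divr_ge0 ?(ltW s0)//= ltr_pdivrMr// mul1r /s; lra.
move=> j; rewrite expr_div_n mulrA ler_pdivlMr ?exprn_gt0//.
rewrite mulrAC ler_wpM2r ?exprn_ge0//.
have [Nj|jN] := leqP N j; first by rewrite (le_trans (hb j Nj))// lerDl.
rewrite /B (bigD1_seq j) ?mem_index_iota ?iota_uniq//=.
by rewrite addrCA lerDl addr_ge0// sumr_ge0.
Qed.

(** Comparison with a geometric tail. The bound is uniform over the disc of radius r, which is what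
    later permits termwise integration. *)
Lemma power_series_tail a F (r B rho : R) : power_series_of a F -> 0 <= r < 1 ->
  0 <= B -> 0 <= rho < 1 -> (forall j, normc (a j) * r ^+ j <= B * rho ^+ j) ->
  forall z n, normc z <= r ->
  normc (F z - \sum_(0 <= j < n) a j * z ^+ j) <= B / (1 - rho) * rho ^+ n.
Proof.
move=> Fa /andP[r0 r1] B0 /andP[q0 q1] hB z n zr.
have q1' : 0 < 1 - rho by rewrite subr_gt0.
have z1 : normc z < 1 by apply: le_lt_trans r1.
have part m : normc (\sum_(n <= j < n + m) a j * z ^+ j) <= B / (1 - rho) * rho ^+ n.
  rewrite (le_trans (normc_sum _ _ _))//.
  apply: (@le_trans _ _ (\sum_(n <= j < n + m) B * rho ^+ j)).
    apply: ler_sum => j _; rewrite normcM normcX (le_trans _ (hB j))//.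
    by rewrite ler_wpM2l// lerXn2r ?nnegrE.
  rewrite -mulr_sumr -mulrA ler_wpM2l// -{1}[n]add0n big_addn addKn.
  under eq_bigr do rewrite exprD.
  by rewrite -mulr_suml ler_wpM2r ?exprn_ge0// geometric_sum_le ?q0.
apply/ler_addgt0Pr => e e0.
have /cvg_normcP/cvgrPdist_lt/(_ e e0)[N _ hN] := Fa _ z1.
have := hN (n + N)%N (leq_addl _ _); rewrite /= sub0r normrN ger0_norm// => h.
rewrite (@big_cat_nat _ _ _ n) ?leq_addr//= in h.
have -> : F z - \sum_(0 <= j < n) a j * z ^+ j = \sum_(n <= j < n + N) a j * z ^+ j +
  (F z - (\sum_(0 <= j < n) a j * z ^+ j + \sum_(n <= j < n + N) a j * z ^+ j)) by ring.
by rewrite (le_trans (le_normcD _ _))// lerD// normcB ltW.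
Qed.

Lemma power_series_Linfty a F w (r : R) : power_series_of a F -> 0 <= r < 1 ->
  measurableT_fun w -> aeT (fun z => normc (w z) <= r) -> Linfty (fun z => F (w z)).
Proof.
move=> Fa r01 mw wr; have [B [rho [B0 q01 hB]]] := power_series_majorant Fa r01.
have tail := power_series_tail Fa r01 B0 q01 hB.
split; last first.
  exists (B / (1 - rho)); apply: (aeT1 wr) => z _ h.
  by have := tail (w z) 0%N h; rewrite big_geq// subr0 expr0 mulr1.
apply: (@measT_lim _ (fun n z => \sum_(0 <= j < n) a j * w z ^+ j)).
  by move=> n; apply: measT_sum => j; apply: measTM; [exact: measT_cst|exact: measTX].
apply: (aeT1 wr) => z _ h; apply/cvg_normcP; apply: Fa.
by case/andP: r01 => _; apply: le_lt_trans.
Qed.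

Lemma integralT_sum n (c_ : nat -> R[i]) (f_ : nat -> R[i] -> R[i]) :
  (forall j, L1T (f_ j)) ->
  L1T (fun z => \sum_(0 <= j < n) c_ j * f_ j z) /\
  integralT (fun z => \sum_(0 <= j < n) c_ j * f_ j z) =
  \sum_(0 <= j < n) c_ j * integralT (f_ j).
Proof.
move=> fL; elim: n => [|n [IH1 IH2]].
  rewrite big_geq//; under eq_fun do rewrite big_geq//.
  by split; [apply: L2_L1; apply: Linfty_L2; exact: Linfty_cst|exact: integralT0].
rewrite big_nat_recr//=; under eq_fun do rewrite big_nat_recr//=.
split; first by apply: L1TD => //; exact: L1TZ.
by rewrite integralTD ?integralTZ ?IH2//; exact: L1TZ.
Qed.

Lemma power_series_integral a F w phi (r : R) : power_series_of a F -> 0 <= r < 1 ->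
  measurableT_fun w -> aeT (fun z => normc (w z) <= r) -> L1T phi ->
  \sum_(0 <= j < n) a j * integralT (fun z => w z ^+ j * phi z) @[n --> \oo] -->
  (integralT (fun z => F (w z) * phi z) : R[i]^o).
Proof.
move=> Fa r01 mw wr pL; have FL := power_series_Linfty Fa r01 mw wr.
have [B [rho [B0 q01 hB]]] := power_series_majorant Fa r01.
have tail := power_series_tail Fa r01 B0 q01 hB.
have wL : Linfty w by split=> //; exists r.
have fL j : L1T (fun z => w z ^+ j * phi z) by apply: L1TM => //; exact: LinftyX.
have FpL : L1T (fun z => F (w z) * phi z) by exact: L1TM.
apply/cvg_normcP.
pose K := B / (1 - rho); have K0 : 0 <= K.
  by case/andP: q01 => _ q1; rewrite divr_ge0// subr_ge0 ltW.
apply: (@squeeze_cvgr _ _ _ _ (fun=> 0) (fun n => 2 * K * norm1 phi * rho ^+ n)).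
- apply: nearW => n; rewrite normc_ge0 /=.
  have [sL sE] := integralT_sum n a fL.
  rewrite -sE -integralTB//; apply: (le_trans (normc_integralT (L1TB sL FpL))).
  rewrite (_ : 2 * K * norm1 phi * rho ^+ n = 2 * (K * rho ^+ n * norm1 phi)); last by ring.
  rewrite ler_wpM2l//.
  have Kr : 0 <= K * rho ^+ n by rewrite mulr_ge0// exprn_ge0//; case/andP: q01.
  have -> : K * rho ^+ n * norm1 phi = norm1 (fun z => (K * rho ^+ n)%:C * phi z).
    rewrite /norm1 mulrCA; congr (_ * _); rewrite -rintZ; last exact: L1T_int.
    by congr rint; apply/funext => z; rewrite normcM normcR ger0_norm.
  apply: le_norm1; [exact: L1TB|exact: L1TZ|].
  apply: (aeT1 wr) => z _ h; rewrite normcB normcM normcR ger0_norm//.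
  rewrite (_ : _ - _ = (F (w z) - \sum_(0 <= j < n) a j * w z ^+ j) * phi z).
    by rewrite normcM ler_wpM2r// tail.
  by rewrite mulrBl mulr_suml; congr (_ - _); apply: eq_bigr => j _; rewrite mulrA.
- exact: cvg_cst.
- by apply: (cvg_geometric (2 * K * norm1 phi)); rewrite ger0_norm; case/andP: q01.
Qed.

(** Termwise integration leaves only the constant term. This mean value property serves both for
    dilated H^2 functions and for the geometric series inside the Poisson kernel. *)
Lemma power_series_integral0 a F w phi (r : R) : power_series_of a F -> 0 <= r < 1 ->
  measurableT_fun w -> aeT (fun z => normc (w z) <= r) -> L1T phi ->
  (forall j, integralT (fun z => w z ^+ j.+1 * phi z) = 0) ->
  integralT (fun z => F (w z) * phi z) = F 0 * integralT phi.
Proof.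
move=> Fa r01 mw wr pL h0; have /cvg_normcP := power_series_integral Fa r01 mw wr pL.
rewrite (power_series_at0 Fa) -cvg_shiftS; set I := integralT _.
have -> : [sequence normc (\sum_(0 <= j < n.+1) a j *
    integralT (fun z => w z ^+ j * phi z) - I)]_n =
    fun=> normc (a 0%N * integralT phi - I).
  apply/funext => n /=; rewrite big_nat_recl//= big1 ?addr0; last first.
    by move=> j _; rewrite h0 mulr0.
  by congr (normc (_ * integralT _ - _)); apply/funext => z; rewrite expr0 mul1r.
move=> /cvg_cst_eq/eq0_normc/eqP.
by rewrite subr_eq0 => /eqP ->.
Qed.

Lemma geometric_integral0 w phi (r : R) : 0 <= r < 1 ->
  measurableT_fun w -> aeT (fun z => normc (w z) <= r) -> L1T phi ->
  (forall j, integralT (fun z => w z ^+ j.+1 * phi z) = 0) ->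
  integralT (fun z => (1 - w z)^-1 * phi z) = integralT phi.
Proof.
move=> r01 mw wr pL h0.
rewrite (power_series_integral0 power_series_geometric r01 mw wr pL h0).
by rewrite subr0 invr1 mul1r.
Qed.

End PowerSeries.

Lemma is_derive_sinM (R : realType) (a t : R) : a != 0 ->
  is_derive (t : R) (1 : R) (fun t => a^-1 * sin (a * t)) (cos (a * t)).
Proof.
move=> a0; have d1 := is_deriveZ a (is_derive_id (t : R) (1 : R)).
have d3 := is_deriveZ a^-1 (is_derive1_comp (is_derive_sin (a * t)) d1).
by apply: (is_derive_eq d3); rewrite /GRing.scale /= mulr1 mulrCA mulVf ?mulr1.
Qed.
Lemma is_derive_cosM (R : realType) (a t : R) : a != 0 ->
  is_derive (t : R) (1 : R) (fun t => - (a^-1 * cos (a * t))) (sin (a * t)).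
Proof.
move=> a0; have d1 := is_deriveZ a (is_derive_id (t : R) (1 : R)).
have d3 := is_deriveN (is_deriveZ a^-1 (is_derive1_comp (is_derive_cos (a * t)) d1)).
by apply: (is_derive_eq d3); rewrite /GRing.scale /= mulr1 mulrCA mulVf ?mulr1// opprK.
Qed.

(** * Radial limits and mean values of H^2 functions *)

Section HardySpace.
Variable R : realType.
Local Notation pi := (@pi R).
Implicit Types (c : R[i]) (b u v w phi psi s : R[i] -> R[i]) (F : R[i] -> R[i]).

(** The third clause makes composition with [psi] well defined on classes. The identity is an
    instance, so facts about H^2 itself are special cases of facts about compositions. *)
Definition circle_contraction psi := [/\ measurableT_fun psi,
  aeT (fun z => normc (psi z) = 1),
  (forall P : R[i] -> Prop, aeT P -> aeT (fun z => P (psi z))) &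
  (forall u, L2T u -> L2T (fun z => u (psi z)) /\
     norm2sq (fun z => u (psi z)) <= norm2sq u)].

Lemma circle_contraction_id : circle_contraction (fun z => z).
Proof. by split => //; [exact: measT_id|exact: aeTW]. Qed.

(** A sequence of radii increasing to 1, so that convergence theorems for sequences apply to radial
    limits. *)
Definition radius (n : nat) : R := 1 - n.+2%:R^-1.

Lemma radius_itv n : 0 <= radius n < 1.
Proof.
rewrite /radius; have h : 0 < n.+2%:R^-1 :> R by rewrite invr_gt0.
have : n.+2%:R^-1 <= 1 :> R by rewrite invf_le1// ler1n.
by move: h; set q := _^-1 => h h1; apply/andP; split; lra.
Qed.

Lemma cvg_radius : radius n @[n --> \oo] --> (1 : R).
Proof.
rewrite -[X in _ --> X]subr0; apply: cvgB; first exact: cvg_cst.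
by have := @cvg_harmonic R; rewrite -cvg_shiftS.
Qed.

Lemma cvg_radius_left : radius n @[n --> \oo] --> (1 : R)^'-.
Proof.
move=> A [e /= e0 he]; have /cvgrPdist_lt/(_ e e0) := cvg_radius.
by apply: filterS => n hn; apply: he => //; case/andP: (radius_itv n).
Qed.

Lemma normc_radius n (z : R[i]) : normc z = 1 -> normc ((radius n)%:C * z) = radius n.
Proof.
by move=> z1; rewrite normcM z1 mulr1 normcR ger0_norm//; case/andP: (radius_itv n).
Qed.

Lemma normc_radius_lt n (z : R[i]) : normc z = 1 -> normc ((radius n)%:C * z) < 1.
Proof. by move=> z1; rewrite normc_radius//; case/andP: (radius_itv n). Qed.

Lemma aeT_radius n psi : aeT (fun z => normc (psi z) = 1) ->
  aeT (fun z => normc ((radius n)%:C * psi z) <= radius n).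
Proof. by move=> h; apply: (aeT1 h) => z _ hz; rewrite normc_radius. Qed.

Lemma measT_radius n psi : measurableT_fun psi ->
  measurableT_fun (fun z => (radius n)%:C * psi z).
Proof. by move=> h; apply: measTM => //; exact: measT_cst. Qed.

Lemma hardy2_radius F : hardy2_disc F -> exists M : R, forall n,
  L2T (fun z => F ((radius n)%:C * z)) /\ norm2sq (fun z => F ((radius n)%:C * z)) <= M.
Proof.
move=> [[a Fa] [M hM]]; exists ((2 * pi)^-1 * M) => n.
have hid : aeT (fun z : R[i] => normc z = 1) by exact: aeTW.
have [mF _] := power_series_Linfty Fa (radius_itv n) (measT_radius n (measT_id R))
  (aeT_radius n hid).
apply: L2T_le => //; rewrite mulrA divff ?mul1r; last by rewrite gt_eqF ?pi2_gt0.
exact: hM (radius_itv n).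
Qed.

Lemma boundary_radius F u : boundary_function F u ->
  aeT (fun z => normc (F ((radius n)%:C * z) - u z) @[n --> \oo] --> (0 : R)).
Proof.
move=> h; apply: (aeT1 h) => z _ hz; apply/cvg_normcP.
exact: (@cvg_comp _ _ _ radius (fun r : R => F (r%:C * z)) _ _ _ cvg_radius_left hz).
Qed.

Lemma hardy2_boundary_L2 F u : hardy2_disc F -> boundary_function F u -> L2T u.
Proof.
move=> hF /boundary_radius hu; have [M hM] := hardy2_radius hF.
have mu' : measurableT_fun u by apply: (measT_lim _ hu) => n; case: (hM n) => [[]].
apply: (proj1 (@L2T_le _ u M mu' _)).
apply: (@nint_fatou _ (fun n z => normc (F ((radius n)%:C * z)) ^+ 2)).
- by move=> n; apply: measTr_normc2; case: (hM n) => [[]].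
- by move=> n z; exact: sqr_ge0.
- by move=> z; exact: sqr_ge0.
- apply: (aeT1 hu) => z _ hz.
  have hn : normc (F ((radius n)%:C * z)) @[n --> \oo] --> normc (u z).
    apply/cvgrPdist_le => e e0; move/cvgrPdist_le : hz => /(_ e e0).
    apply: filterS => n; rewrite sub0r normrN ger0_norm//; apply: le_trans.
    exact: abs_lerB_normc.
  by rewrite expr2; under eq_fun do rewrite expr2; exact: cvgM.
- move=> n; have [h1 h2] := hM n; rewrite nint_norm2sq// lee_fin ler_wpM2l//.
  by rewrite ltW ?pi2_gt0.
Qed.

Lemma H2_L2 u : H2 u -> L2T u.
Proof. by move=> [F hF /(hardy2_boundary_L2 hF)]. Qed.

(** For each dilate z |-> F(r psi(z)) the identity is exact by the mean value property. The dilates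
    are bounded in L^2 and converge almost everywhere to s o psi, so [weak_cvg0] applies. The
    resulting error does not depend on n, hence is 0. *)
Lemma hardy2_comp_integral F s psi phi : hardy2_disc F -> boundary_function F s ->
  circle_contraction psi -> L2T phi ->
  (forall j, integralT (fun z => psi z ^+ j.+1 * phi z) = 0) ->
  integralT (fun z => s (psi z) * phi z) = F 0 * integralT phi.
Proof.
move=> hF hs [mpsi psi1 null contr] pL h0.
have [M hM] := hardy2_radius hF.
have sL := hardy2_boundary_L2 hF hs.
have [spL spN] := contr _ sL.
have Fc n := contr _ (proj1 (hM n)).
pose U n z := F ((radius n)%:C * psi z) - s (psi z).
have UL n : L2T (U n) by apply: L2TB => //; exact: (proj1 (Fc n)).
have U0 : aeT (fun z => normc (U n z) @[n --> \oo] --> (0 : R)).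
  exact: (null _ (boundary_radius hs)).
have UM n : norm2sq (U n) <= 2 * M + 2 * norm2sq (fun z => s (psi z)).
  rewrite (le_trans (norm2sqD (proj1 (Fc n)) (L2TN spL)))//.
  apply: lerD; rewrite ler_wpM2l//.
    by rewrite (le_trans (proj2 (Fc n)))//; case: (hM n).
  by rewrite le_eqVlt; apply/orP; left; apply/eqP; apply: norm2sq_eq;
    apply: aeTW => z _; rewrite normcN.
have := weak_cvg0 UL UM U0 pL.
have [[a Fa] _] := hF.
have -> : (fun n => normc (integralT (fun z => U n z * phi z))) =
  fun=> normc (F 0 * integralT phi - integralT (fun z => s (psi z) * phi z)).
  apply/funext => n; congr normc.
  rewrite -(@power_series_integral0 _ _ _ (fun z => (radius n)%:C * psi z) phi _ Fa (radius_itv n)).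
  - rewrite -integralTB; first by congr integralT; apply/funext => z; rewrite mulrBl.
      by apply: L2M_L1 => //; exact: (proj1 (Fc n)).
    exact: L2M_L1.
  - exact: measT_radius.
  - exact: aeT_radius.
  - exact: L2_L1.
  - move=> j; under eq_fun do rewrite exprMn -mulrA; rewrite integralTZ ?h0 ?mulr0//.
    apply: L1TM; last exact: L2_L1.
    by apply: LinftyX; split => //; exists 1; apply: (aeT1 psi1) => z _ ->.
by move=> /cvg_cst_eq/eq0_normc/eqP; rewrite subr_eq0 => /eqP.
Qed.

Lemma H2_comp_integral0 s psi phi : H2 s -> circle_contraction psi -> L2T phi ->
  (forall j, integralT (fun z => psi z ^+ j * phi z) = 0) ->
  integralT (fun z => s (psi z) * phi z) = 0.
Proof.
move=> [F hF hs] hpsi pL h0; rewrite (hardy2_comp_integral hF hs hpsi pL) => [|j//].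
have := h0 0%N; under [X in integralT X]eq_fun do rewrite expr0 mul1r.
by move=> ->; rewrite mulr0.
Qed.

Lemma H2_integral0 s phi : H2 s -> L2T phi ->
  (forall j, integralT (fun z => z ^+ j * phi z) = 0) ->
  integralT (fun z => s z * phi z) = 0.
Proof. by move=> hs; apply: (H2_comp_integral0 hs circle_contraction_id). Qed.

Lemma expiX (t : R) n : expi t ^+ n = expi (t *+ n).
Proof.
elim: n => [|n IH]; first by rewrite expr0 mulr0n /expi cos0 sin0.
by rewrite exprSr IH -expiD mulrSr.
Qed.

Lemma integralT_exp n : integralT (fun z : R[i] => z ^+ n.+1) = 0.
Proof.
rewrite integralTE; pose a : R := n.+1%:R.
have a0 : a != 0 by rewrite pnatr_eq0.
have ftc (f G : R -> R) : (forall t : R, is_derive t (1 : R) G (f t)) -> continuous f ->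
    G (2 * pi) = G 0 -> \int[lebesgue_measure]_(t in `[0, 2 * pi]) f t = 0.
  move=> dG cf e; rewrite /Rintegral (@continuous_FTC2 _ _ G)//.
  - by rewrite e subee.
  - exact: pi2_gt0.
  - exact: continuous_subspaceT.
  - have cG : continuous G.
      by move=> t; apply: differentiable_continuous; apply/derivable1_diffP; have [] := dG t.
    split; first by move=> t _; have [] := dG t.
      by apply: cvg_at_right_filter; exact: cG.
    by apply: cvg_at_left_filter; exact: cG.
  - by move=> t _; rewrite derive1E; have [] := dG t.
have ca : continuous (fun t : R => a * t) by move=> t; apply: cvgM; [exact: cvg_cst|exact: cvg_id].
have aE (t : R) : t *+ n.+1 = a * t by rewrite -mulr_natl.
have p2 : a * (2 * pi) = 0 + pi *+ 2 *+ n.+1 by rewrite add0r -aE mulr_natl.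
have e1 : rint (fun z : R[i] => complex.Re (z ^+ n.+1)) = 0.
  rewrite /rint; under eq_Rintegral do rewrite expiX /= aE.
  apply: (@ftc _ (fun t => a^-1 * sin (a * t))).
  - by move=> t; exact: is_derive_sinM.
  - by move=> t; apply: continuous_comp; [exact: ca|exact: continuous_cos].
  - by rewrite p2 (periodicn (@sinD2pi R)) mulr0.
have e2 : rint (fun z : R[i] => complex.Im (z ^+ n.+1)) = 0.
  rewrite /rint; under eq_Rintegral do rewrite expiX /= aE.
  apply: (@ftc _ (fun t => - (a^-1 * cos (a * t)))).
  - by move=> t; exact: is_derive_cosM.
  - by move=> t; apply: continuous_comp; [exact: ca|exact: continuous_sin].
  - by rewrite p2 (periodicn (@cosD2pi R)) mulr0.
by rewrite e1 e2 !mulr0.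
Qed.

Lemma integralT_conj_exp n : integralT (fun z : R[i] => z^* ^+ n.+1) = 0.
Proof.
have zL : L1T (fun z : R[i] => z ^+ n.+1).
  by apply: L2_L1; apply: Linfty_L2; apply: LinftyX; exact: Linfty_id.
have := integralT_conj zL; rewrite integralT_exp rmorph0 => <-.
by congr integralT; apply/funext => z; rewrite rmorphXn.
Qed.

Lemma Linfty_exp n : Linfty (fun z : R[i] => z ^+ n).
Proof. by apply: LinftyX; exact: Linfty_id. Qed.

Lemma H2_coef0 s n : H2 s -> integralT (fun z => s z * z ^+ n.+1) = 0.
Proof.
move=> hs; apply: H2_integral0 => // [|j]; first by apply: Linfty_L2; exact: Linfty_exp.
by under eq_fun do rewrite -exprD addnS; exact: integralT_exp.
Qed.

End HardySpace.

(** * Poisson integrals and radial limits *)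

Section PoissonKernel.
Variable R : realType.
Local Notation mu := (@lebesgue_measure R).
Local Notation pi := (@pi R).
Local Notation D := (`[(0 : R), 2 * pi]%classic).
Implicit Types (phi h : R -> R) (t s x r e : R).

(** The Poisson kernel (1 - r^2) / (1 - 2 r cos x + r^2), its denominator split into two nonnegative
    terms: the first controls the kernel near 0, the second away from 0. *)
Definition pkern (r x : R) := (1 - r ^+ 2) / ((1 - r) ^+ 2 + 2 * r * (1 - cos x)).

(** The mean value theorem gives sin y >= cos(1/2) y on [0, 1/2]; inserting y = |x| / 2 in 1 - cos x
    = 2 sin(x / 2)^2 yields the constant cos(1/2)^2 / 2. *)
Lemma sqr_bound_cos : exists2 c : R, 0 < c & forall x, `|x| <= 1 -> c * x ^+ 2 <= 1 - cos x.
Proof.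
have pi2 := @pi_ge2 R.
have c1 : 0 < cos (2^-1 : R).
  by apply: cos_gt0_pihalf; apply/andP; split; lra.
exists (cos 2^-1 ^+ 2 / 2); first by rewrite divr_gt0// exprn_gt0.
have key (y : R) : 0 <= y <= 2^-1 -> cos 2^-1 * y <= sin y :> R.
  move=> /andP[y0 y1].
  have [|c cI e] := @MVT_segment R sin cos 0 y y0 (fun x _ => is_derive_sin x).
    by apply: continuous_subspaceT; exact: continuous_sin.
  move: e; rewrite sin0 !subr0 => ->; rewrite ler_wpM2r//.
  move: cI; rewrite in_itv /= => /andP[c0 cy].
  have : c <= 2^-1 by exact: le_trans y1.
  rewrite le_eqVlt => /orP[/eqP ->//|c2]; apply: ltW; rewrite ltr_cos// in_itv /=;
    by apply/andP; split; lra.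
have keyn (y : R) : `|y| <= 2^-1 -> cos 2^-1 ^+ 2 * y ^+ 2 <= sin y ^+ 2.
  move=> y1; have h : cos 2^-1 * `|y| <= sin `|y| by apply: key; rewrite normr_ge0.
  have -> : sin y ^+ 2 = sin `|y| ^+ 2.
    by have [y0|y0] := leP 0 y; rewrite ?(ger0_norm y0)// ltr0_norm// sinN sqrrN.
  rewrite -exprMn -(real_normK (num_real (cos 2^-1 * y))) normrM gtr0_norm//.
  by rewrite lerXn2r// nnegrE; [rewrite mulr_ge0// ltW|apply: le_trans h; rewrite mulr_ge0// ltW].
move=> x x2; have := keyn (x / 2).
have -> : cos x = 1 - 2 * sin (x / 2) ^+ 2.
  rewrite {1}(splitr x) cosD -!expr2 cos2sin2; ring.
have -> : `|x / 2| <= 2^-1 by rewrite normrM (ger0_norm (_ : 0 <= 2^-1)) ?invr_ge0// ger_pMl.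
move=> /(_ isT).
by rewrite expr_div_n; set a := cos 2^-1 ^+ 2; set b := sin _ ^+ 2; set y := x ^+ 2; lra.
Qed.

(* Off the dyadic scale eta the kernel is at most 4 eta / x^2 on the annulus
   x/2 <= |s - t| < x; summing the geometric series is done by the invariant
   9 - 4 eta / x. *)
Lemma approx_identity_near phi t eta e d : measurable_fun setT phi ->
  (forall s, 0 <= phi s) -> 0 < eta -> 0 <= e ->
  (forall x, 0 < x <= d -> (\int[mu]_(s in ball t x) (phi s)%:E <= (e * x)%:E)%E) ->
  0 < d -> (\int[mu]_(s in ball t d) (phi s * (eta / (eta ^+ 2 + (t - s) ^+ 2)))%:E
    <= (9 * e)%:E)%E.
Proof.
move=> mphi phi0 eta0 e0 hphi d0.
pose k s := eta / (eta ^+ 2 + (t - s) ^+ 2).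
have den0 s : 0 < eta ^+ 2 + (t - s) ^+ 2 by rewrite ltr_wpDr ?sqr_ge0 ?exprn_gt0.
have k0 s : 0 <= k s by rewrite divr_ge0// ltW.
have mk : measurable_fun setT k.
  apply: continuous_measurable_fun => s; apply: cvgM; first exact: cvg_cst.
  apply: cvgV; first by rewrite gt_eqF.
  apply: cvgD; first exact: cvg_cst.
  under eq_fun do rewrite expr2; rewrite expr2.
  by apply: cvgM; apply: cvgB; try exact: cvg_cst; exact: cvg_id.
have mb x : measurable (ball t x) by exact: measurable_ball.
have mpk (A : set R) : measurable_fun A (fun s => (phi s * k s)%:E).
  by apply/measurable_EFinP; apply: measurable_funTS; exact: measurable_funM.
have mcp (A : set R) c : measurable_fun A (fun s => (c * phi s)%:E).
  by apply/measurable_EFinP; apply: measurable_funTS; exact: measurable_funM.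
have mp (A : set R) : measurable_fun A (fun s => (phi s)%:E).
  by apply/measurable_EFinP; apply: measurable_funTS.
have scal c x : 0 <= c -> 0 < x <= d ->
    (\int[mu]_(s in ball t x) (c * phi s)%:E <= (c * (e * x))%:E)%E.
  move=> c0 xd; under eq_integral do rewrite EFinM.
  rewrite ge0_integralZl//; first by rewrite EFinM lee_wpmul2l ?lee_fin// hphi.
  - exact: mb.
  - exact: mp.
  - by move=> s _; rewrite lee_fin.
have small x : 0 < x <= d -> x <= eta ->
    (\int[mu]_(s in ball t x) (phi s * k s)%:E <= e%:E)%E.
  move=> xd xe; apply: (@le_trans _ _ (\int[mu]_(s in ball t x) (eta^-1 * phi s)%:E)%E).
    apply: ge0_le_integral; [exact: mb| |exact: mpk|exact: mcp|].
    - by move=> s _; rewrite lee_fin mulr_ge0.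
    - move=> s _; rewrite lee_fin mulrC ler_wpM2r// /k ler_pdivrMr//.
      by rewrite mulrDr expr2 mulrA mulVf ?mul1r ?gt_eqF// lerDl mulr_ge0 ?sqr_ge0 ?invr_ge0 ?ltW.
  apply: (le_trans (scal _ _ _ xd)); first by rewrite invr_ge0 ltW.
  rewrite lee_fin mulrCA -[leRHS]mulr1 ler_wpM2l// mulrC ler_pdivrMr// mul1r//.
(* The induction is on a bound [n] for the number of halvings that bring x down to the scale eta. *)
have claim n x : 0 < x <= d -> eta < x -> x <= 2 ^+ n * eta ->
    (\int[mu]_(s in ball t x) (phi s * k s)%:E <= (e * (9 - 4 * (eta / x)))%:E)%E.
  elim: n x => [|n IH] x /andP[x0 xd] ex xn.
    by move: xn; rewrite expr0 mul1r leNgt ex.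
  have x2 : 0 < x / 2 <= d by apply/andP; split; lra.
  have x2x : ball t (x / 2) `<=` ball t x by apply: le_ball; lra.
  have -> : ball t x = ball t (x / 2) `|` (ball t x `\` ball t (x / 2)).
    by rewrite setDUK.
  have mdiff : measurable (ball t x `\` ball t (x / 2)) by exact: measurableD.
  rewrite ge0_integral_setU; first last.
  - by apply/disj_setPS => s [h1 [_ h2]]; apply: h2.
  - by move=> s _; rewrite lee_fin mulr_ge0.
  - exact: mpk.
  - exact: mdiff.
  - exact: mb.
  have ann : (\int[mu]_(s in ball t x `\` ball t (x / 2)) (phi s * k s)%:E <=
      (4 * eta / x ^+ 2 * (e * x))%:E)%E.
    have c0 : 0 <= 4 * eta / x ^+ 2 by rewrite divr_ge0 ?sqr_ge0 ?mulr_ge0 ?ltW.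
    apply: (le_trans _ (scal _ x c0 _)); last by rewrite x0.
    apply: (@le_trans _ _ (\int[mu]_(s in ball t x `\` ball t (x / 2))
       (4 * eta / x ^+ 2 * phi s)%:E)%E).
      apply: ge0_le_integral; [exact: mdiff| |exact: mpk|exact: mcp|].
      - by move=> s _; rewrite lee_fin mulr_ge0.
      - move=> s [_ /negP]; rewrite -leNgt => hs.
        rewrite lee_fin mulrC ler_wpM2r// /k ler_pdivrMr//.
        have hs2 : (x / 2) ^+ 2 <= (t - s) ^+ 2.
          by rewrite -(real_normK (num_real (t - s))) lerXn2r// nnegrE; lra.
        have x20 : 0 < x ^+ 2 by rewrite exprn_gt0.
        have xn0 : x != 0 by rewrite gt_eqF.
        rewrite [leLHS](_ : eta = 4 * eta / x ^+ 2 * ((x / 2) ^+ 2)); last by field.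
        by rewrite ler_wpM2l// (le_trans hs2)// lerDr sqr_ge0.
    apply: ge0_subset_integral; [exact: mdiff|exact: mb|exact: mcp| |by move=> s []].
    by move=> s _; rewrite lee_fin mulr_ge0.
  have xn0 : x != 0 by rewrite gt_eqF.
  rewrite (_ : 4 * eta / x ^+ 2 * (e * x) = 4 * e * (eta / x)) in ann; last by field.
  have q1 : eta / x < 1 by rewrite ltr_pdivrMr// mul1r.
  (* Put q = eta / x. If the halving stops here, e + 4 e q <= e (9 - 4 q) because q < 1; otherwise
     the inductive bound e (9 - 8 q) plus the annulus 4 e q equals e (9 - 4 q). *)
  have [xe|xe] := leP (x / 2) eta.
    apply: (le_trans (leeD (small _ x2 xe) ann)); rewrite -EFinD lee_fin.
    by set q := eta / x in q1 *; nra.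
  have xn2 : x / 2 <= 2 ^+ n * eta by move: xn; rewrite exprS; lra.
  apply: (le_trans (leeD (IH _ x2 xe xn2) ann)); rewrite -EFinD lee_fin.
  by rewrite (_ : eta / (x / 2) = 2 * (eta / x)); [lra|field].
have [de|ed] := leP d eta.
  by apply: (le_trans (small d _ de)); rewrite ?d0 ?lexx// lee_fin; lra.
have [n hn] : exists n, d <= 2 ^+ n * eta.
  exists (Num.bound (d / eta)); rewrite -ler_pdivrMr//.
  have de0 : 0 <= d / eta by rewrite divr_ge0// ltW.
  rewrite (le_trans (ltW (archi_boundP de0)))//.
  by rewrite -natrX ler_nat ltnW// ltn_expl.
apply: (le_trans (claim n d _ ed hn)); first by rewrite d0 lexx.
rewrite lee_fin mulrC ler_wpM2r//.
have : 0 <= eta / d by apply: divr_ge0; exact: ltW.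
by set q := eta / d; lra.
Qed.

End PoissonKernel.

Section PoissonVanish.
Variable R : realType.
Local Notation mu := (@lebesgue_measure R).
Local Notation pi := (@pi R).
Local Notation D := (`[(0 : R), 2 * pi]%classic).
Implicit Types (phi h : R -> R) (t s x r e d : R).

Lemma pkern_den_gt0 r x : 0 <= r < 1 -> 0 < (1 - r) ^+ 2 + 2 * r * (1 - cos x).
Proof.
move=> /andP[r0 r1]; rewrite ltr_wpDr//.
  by rewrite mulr_ge0 ?mulr_ge0// subr_ge0 cos_le1.
by rewrite exprn_gt0// subr_gt0.
Qed.

Lemma pkern_ge0 r x : 0 <= r < 1 -> 0 <= pkern r x.
Proof.
move=> r01; have h := pkern_den_gt0 x r01; case/andP: r01 => r0 r1.
by rewrite divr_ge0 ?(ltW h)// subr_ge0 expr_le1// ltW.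
Qed.

(** For r >= 1/2 the factor 2 r is at least 1, so [sqr_bound_cos] bounds the denominator below by m
    ((1 - r)^2 + x^2); the 2 in K bounds 1 + r. *)
Lemma pkern_near : exists2 K, 0 < K & forall r x, 2^-1 <= r < 1 -> `|x| <= 1 ->
  pkern r x <= K * ((1 - r) / ((1 - r) ^+ 2 + x ^+ 2)).
Proof.
have [c c0 hc] := sqr_bound_cos R; pose m := Num.min c 1.
have m0 : 0 < m by rewrite lt_min c0 ltr01.
exists (2 / m); first by rewrite divr_gt0.
move=> r x /andP[r2 r1] x1.
have r01 : 0 <= r < 1 by apply/andP; split; lra.
have eta0 : 0 < 1 - r by rewrite subr_gt0.
have den := pkern_den_gt0 x r01.
have q0 : 0 < (1 - r) ^+ 2 + x ^+ 2 by rewrite ltr_wpDr ?sqr_ge0 ?exprn_gt0.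
have mden : m * ((1 - r) ^+ 2 + x ^+ 2) <= (1 - r) ^+ 2 + 2 * r * (1 - cos x).
  have mc : m <= c by rewrite ge_min lexx.
  have m1 : m <= 1 by rewrite ge_min lexx orbT.
  have h1 := hc x x1; have h2 : 0 <= x ^+ 2 by exact: sqr_ge0.
  have h3 : 0 <= (1 - r) ^+ 2 by exact: sqr_ge0.
  have h4 : m * x ^+ 2 <= c * x ^+ 2 by rewrite ler_wpM2r.
  have h5 : m * (1 - r) ^+ 2 <= (1 - r) ^+ 2 by rewrite ger_pMl// exprn_gt0.
  have h6 : 0 <= (2 * r - 1) * (1 - cos x).
    by rewrite mulr_ge0// ?subr_ge0 ?cos_le1//; lra.
  by move: h6; set w := cos x in h1 *; lra.
rewrite /pkern ler_pdivrMr// (_ : 1 - r ^+ 2 = (1 + r) * (1 - r)); last by ring.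
apply: (@le_trans _ _ (2 / m * ((1 - r) / ((1 - r) ^+ 2 + x ^+ 2)) *
   (m * ((1 - r) ^+ 2 + x ^+ 2)))); last first.
  by rewrite ler_wpM2l// mulr_ge0// divr_ge0// ltW.
have -> : 2 / m * ((1 - r) / ((1 - r) ^+ 2 + x ^+ 2)) * (m * ((1 - r) ^+ 2 + x ^+ 2)) =
  2 * (1 - r).
  by field; rewrite (gt_eqF q0) (gt_eqF m0).
by rewrite ler_wpM2r ?(ltW eta0)//; lra.
Qed.

Lemma pkern_far r x kappa : 2^-1 <= r < 1 -> 0 < kappa -> kappa <= 1 - cos x ->
  pkern r x <= 2 / kappa * (1 - r).
Proof.
move=> /andP[r2 r1] k0 kx.
have r01 : 0 <= r < 1 by apply/andP; split; lra.
have eta0 : 0 < 1 - r by rewrite subr_gt0.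
have den := pkern_den_gt0 x r01.
have kden : kappa <= (1 - r) ^+ 2 + 2 * r * (1 - cos x).
  have h3 : 0 <= (1 - r) ^+ 2 by exact: sqr_ge0.
  have h6 : 0 <= (2 * r - 1) * (1 - cos x).
    by rewrite mulr_ge0// ?subr_ge0 ?cos_le1//; lra.
  by move: h6; set w := cos x in kx *; lra.
rewrite /pkern ler_pdivrMr// (_ : 1 - r ^+ 2 = (1 + r) * (1 - r)); last by ring.
apply: (@le_trans _ _ (2 / kappa * (1 - r) * kappa)); last first.
  by rewrite ler_wpM2l// mulr_ge0 ?divr_ge0// ltW.
have -> : 2 / kappa * (1 - r) * kappa = 2 * (1 - r) by field; rewrite gt_eqF.
by rewrite ler_wpM2r ?(ltW eta0)//; lra.
Qed.

Lemma cos_lt1 d : 0 < d <= pi -> cos d < 1.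
Proof.
move=> /andP[d0 d1]; rewrite -cos0 ltr_cos// in_itv /= ?lexx ?pi_ge0//.
by rewrite (ltW d0).
Qed.

Lemma cos_away0 d x : 0 < d <= pi -> d <= `|x| <= 2 * pi - d -> cos x <= cos d.
Proof.
move=> /andP[d0 d1] /andP[x1 x2].
have h y : d <= y <= pi -> cos y <= cos d.
  move=> /andP[]; rewrite le_eqVlt => /orP[/eqP ->//|dy] yp.
  by apply: ltW; rewrite ltr_cos// in_itv /=; apply/andP; split; lra.
have -> : cos x = cos `|x|.
  by have [x0|x0] := leP 0 x; rewrite ?(ger0_norm x0)// ltr0_norm// cosN.
have [xp|xp] := leP `|x| pi; first by apply: h; rewrite x1.
rewrite -cosN -cosD2pi -mulr_natl; apply: h; apply/andP; split; lra.
Qed.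

Lemma measurable_pkern r t : 0 <= r < 1 -> measurable_fun setT (fun s => pkern r (t - s)).
Proof.
move=> r01; apply: continuous_measurable_fun => s; rewrite /pkern.
apply: cvgM; first exact: cvg_cst.
apply: cvgV; first by rewrite gt_eqF// pkern_den_gt0.
apply: cvgD; first exact: cvg_cst.
apply: cvgM; first exact: cvg_cst.
apply: cvgB; first exact: cvg_cst.
apply: (@continuous_comp _ _ _ (fun s => t - s) cos); last exact: continuous_cos.
by apply: cvgB; [exact: cvg_cst|exact: cvg_id].
Qed.

(** Small averages of phi around t control the part close to t through [approx_identity_near];
    elsewhere the kernel is uniformly of order 1 - r. *)
Lemma poisson_vanish phi t : measurable_fun setT phi -> (forall s, 0 <= phi s) ->
  (\int[mu]_(s in D) (phi s)%:E < +oo)%E -> 0 < t < 2 * pi ->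
  (forall e, 0 < e -> exists2 d, 0 < d & forall x, 0 < x <= d ->
     (\int[mu]_(s in ball t x) (phi s)%:E <= (e * x)%:E)%E) ->
  forall e, 0 < e -> exists2 r0, r0 < 1 & forall r, r0 < r < 1 -> 0 <= r ->
    (\int[mu]_(s in D) (pkern r (t - s) * phi s)%:E <= e%:E)%E.
Proof.
move=> mphi phi0 phifin /andP[t0 t2] hphi e e0.
have [K K0 hK] := pkern_near.
(* The close part costs K times 9 times this value, that is e / 2. *)
have [d1 d10 hd1] := hphi (e / (18 * K)) (divr_gt0 e0 (mulr_gt0 (ltr0n _ 18) K0)).
have pi2 := @pi_ge2 R.
(* The bound 1 is for [pkern_near]. The other two keep the ball inside the interval and |t - s| at
   most 2 pi - d, so that periodicity brings no second peak. *)
pose d := Num.min (Num.min d1 1) (Num.min (t / 2) ((2 * pi - t) / 2)).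
have d0 : 0 < d.
  by rewrite !lt_min d10 ltr01 divr_gt0//= divr_gt0// subr_gt0.
have dd1 : d <= d1 by rewrite /d !ge_min lexx.
have dd2 : d <= 1 by rewrite /d !ge_min lexx orbT.
have dd3 : d <= t / 2 by rewrite /d !ge_min lexx !orbT.
have dd4 : d <= (2 * pi - t) / 2 by rewrite /d !ge_min lexx !orbT.
pose kappa := 1 - cos d.
have dpi : 0 < d <= pi by rewrite d0 /=; lra.
have k0 : 0 < kappa by rewrite subr_gt0 cos_lt1.
pose I := fine (\int[mu]_(s in D) (phi s)%:E)%E.
have IE : (\int[mu]_(s in D) (phi s)%:E)%E = I%:E.
  by rewrite fineK// ge0_fin_numE// integral_ge0// => s _; rewrite lee_fin.
have I0 : 0 <= I by rewrite fine_ge0// integral_ge0// => s _; rewrite lee_fin.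
pose L := 2 / kappa * I.
have L0 : 0 <= L by rewrite mulr_ge0// divr_ge0// ltW.
(* This gives L (1 - r) <= e / 2 for the part away from t; L + 1 avoids a division by 0. *)
exists (Num.max 2^-1 (1 - e / (2 * (L + 1)))).
  rewrite gt_max; apply/andP; split; first lra.
  by rewrite ltrBlDr ltrDl divr_gt0// mulr_gt0// ltr_wpDl.
move=> r /andP[]; rewrite gt_max => /andP[r2 rL] r1 r0.
have r01 : 0 <= r < 1 by rewrite r0.
have r21 : 2^-1 <= r < 1 by rewrite ltW.
have eta0 : 0 < 1 - r by rewrite subr_gt0.
have mb : measurable (ball t d : set (measurableTypeR R)) by exact: measurable_ball.
have mdiff : measurable (D `\` ball t d : set (measurableTypeR R)).
  by apply: measurableD => //; exact: measurable_itv.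
have mD : measurable (D : set (measurableTypeR R)) by exact: measurable_itv.
have mpk (A : set (measurableTypeR R)) : measurable_fun A (fun s => (pkern r (t - s) * phi s)%:E).
  apply/measurable_EFinP; apply: measurable_funTS; apply: measurable_funM => //.
  exact: measurable_pkern.
have mcp (A : set (measurableTypeR R)) c : measurable_fun A (fun s => (c * phi s)%:E).
  by apply/measurable_EFinP; apply: measurable_funTS; exact: measurable_funM.
have mp (A : set (measurableTypeR R)) : measurable_fun A (fun s => (phi s)%:E).
  by apply/measurable_EFinP; apply: measurable_funTS.
have p0 s : 0 <= pkern r (t - s) * phi s by rewrite mulr_ge0// pkern_ge0.
have sub : ball t d `<=` D.
  by move=> s; rewrite ball_itv /= !in_itv /= => /andP[h1 h2]; apply/andP; split; lra.
have -> : D = ball t d `|` (D `\` ball t d) by rewrite setDUK.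
rewrite ge0_integral_setU; first last.
- by apply/disj_setPS => s [h1 [_ h2]]; apply: h2.
- by move=> s _; rewrite lee_fin.
- exact: mpk.
- exact: mdiff.
- exact: mb.
have near : (\int[mu]_(s in ball t d) (pkern r (t - s) * phi s)%:E <= (e / 2)%:E)%E.
  pose k s := (1 - r) / ((1 - r) ^+ 2 + (t - s) ^+ 2).
  have mk : measurable_fun setT k.
    apply: continuous_measurable_fun => s; apply: cvgM; first exact: cvg_cst.
    apply: cvgV; first by rewrite gt_eqF// ltr_wpDr ?sqr_ge0 ?exprn_gt0.
    apply: cvgD; first exact: cvg_cst.
    under eq_fun do rewrite expr2; rewrite expr2.
    by apply: cvgM; apply: cvgB; try exact: cvg_cst; exact: cvg_id.
  have kk0 s : 0 <= k s by rewrite divr_ge0 ?(ltW eta0)// addr_ge0// sqr_ge0.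
  have mkp (A : set (measurableTypeR R)) : measurable_fun A (fun s => (phi s * k s)%:E).
    by apply/measurable_EFinP; apply: measurable_funTS; exact: measurable_funM.
  apply: (@le_trans _ _ (\int[mu]_(s in ball t d) (K%:E * (phi s * k s)%:E))%E).
    apply: ge0_le_integral; [exact: mb| |exact: mpk| |].
    - by move=> s _; rewrite lee_fin.
    - by apply: measurable_funeM; exact: mkp.
    - move=> s; rewrite ball_itv /= in_itv /= => /andP[s1 s2].
      rewrite -EFinM lee_fin mulrCA mulrC ler_wpM2l// hK//.
      by rewrite ler_norml; apply/andP; split; lra.
  rewrite ge0_integralZl; [|exact: mb|exact: mkp| |by rewrite lee_fin ltW]; last first.
    by move=> s _; rewrite lee_fin mulr_ge0.
  have hd1' x : 0 < x <= d -> (\int[mu]_(s in ball t x) (phi s)%:E <= (e / (18 * K) * x)%:E)%E.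
    by move=> /andP[x0 xd]; apply: hd1; rewrite x0 (le_trans xd).
  have e18 : 0 <= e / (18 * K) by rewrite divr_ge0 ?mulr_ge0// ltW.
  have := approx_identity_near mphi phi0 eta0 e18 hd1' d0 => /(lee_wpmul2l (_ : 0 <= K%:E)%E).
  rewrite lee_fin => /(_ (ltW K0)) /le_trans; apply.
  by rewrite -EFinM lee_fin le_eqVlt; apply/orP; left; apply/eqP; field; rewrite gt_eqF.
have far : (\int[mu]_(s in D `\` ball t d) (pkern r (t - s) * phi s)%:E <= (e / 2)%:E)%E.
  have c0 : 0 <= 2 / kappa * (1 - r) by rewrite mulr_ge0 ?divr_ge0// ltW.
  apply: (@le_trans _ _ (\int[mu]_(s in D `\` ball t d) ((2 / kappa * (1 - r))%:E * (phi s)%:E))%E).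
    apply: ge0_le_integral; [exact: mdiff| |exact: mpk| |].
    - by move=> s _; rewrite lee_fin.
    - by apply: measurable_funeM; exact: mp.
    - move=> s [sD]; rewrite ball_itv => sb.
      rewrite -EFinM lee_fin ler_wpM2r// pkern_far// lerB// cos_away0//.
      move: sD; rewrite /= in_itv /= => /andP[s0 s2].
      apply/andP; split; last by rewrite ler_norml; apply/andP; split; lra.
      rewrite leNgt; apply/negP; rewrite ltr_norml => /andP[h1 h2]; apply: sb.
      by rewrite /= in_itv /=; apply/andP; split; lra.
  rewrite ge0_integralZl; [|exact: mdiff|exact: mp| |by rewrite lee_fin]; last first.
    by move=> s _; rewrite lee_fin.
  apply: (@le_trans _ _ ((2 / kappa * (1 - r))%:E * I%:E)%E).
    rewrite lee_wpmul2l ?lee_fin// -IE.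
    apply: ge0_subset_integral; [exact: mdiff|exact: mD|exact: mp| |by move=> s []].
    by move=> s _; rewrite lee_fin.
  rewrite -EFinM lee_fin (_ : _ * I = L * (1 - r)); last by rewrite /L; ring.
  have L1 : 0 < L + 1 by rewrite ltr_wpDl.
  have h : (1 - r) * (2 * (L + 1)) < e.
    by rewrite -ltr_pdivlMr ?mulr_gt0//; move: rL; set q := e / _; lra.
  have : 0 <= L * (1 - r) by rewrite mulr_ge0 // ltW.
  by move: h; nra.
by apply: (le_trans (leeD near far)); rewrite -EFinD lee_fin -splitr.
Qed.

End PoissonVanish.

Section PoissonCircle.
Variable R : realType.
Local Notation mu := (@lebesgue_measure R).
Local Notation pi := (@pi R).
Local Notation D := (`[(0 : R), 2 * pi]%classic).
Implicit Types (c q : R[i]) (u v w phi psi s : R[i] -> R[i]) (t x r e : R).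

(** At q = r e^(ix) this is [pkern r x]. As a function of a point of the disc it can also be
    evaluated along an inner function. *)
Definition poisson q : R := (1 - normc q ^+ 2) / normc (1 - q) ^+ 2.

Lemma subr1_neq0 q : normc q < 1 -> 1 - q != 0.
Proof.
by apply: contraTneq => /eqP; rewrite subr_eq0 => /eqP <-; rewrite normc1 ltxx.
Qed.

(** An analytic half plus an antianalytic half without constant term, so that each half can be
    integrated by its geometric series. *)
Lemma poissonE q : normc q < 1 -> (poisson q)%:C = (1 - q)^-1 + (1 - q^*)^-1 * q^*.
Proof.
move=> q1; have n0 := subr1_neq0 q1.
have n0' : 1 - q^* != 0 by apply: subr1_neq0; rewrite normc_conj.
have -> : (poisson q)%:C = (1 - q * q^*) / ((1 - q) * (1 - q)^*).
  by rewrite !mul_conjc rmorphM fmorphV rmorphB.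
rewrite rmorphB rmorph1 /=; field.
by rewrite n0 n0'.
Qed.

Lemma poisson_ge0 q : normc q < 1 -> 0 <= poisson q.
Proof.
by move=> q1; rewrite divr_ge0 ?sqr_ge0// subr_ge0 expr_le1// ltW.
Qed.

Lemma poisson_pkern r x : 0 <= r -> poisson (r%:C * expi x) = pkern r x.
Proof.
move=> r0; rewrite /poisson /pkern normcM normc_expi mulr1 normcR ger0_norm//.
congr (_ / _); rewrite normc_sqr /=.
have -> : (1 - r) ^+ 2 + 2 * r * (1 - cos x) =
  (1 - r * cos x) ^+ 2 + r ^+ 2 * (1 - cos x ^+ 2) by ring.
by rewrite -sin2cos2; ring.
Qed.

Lemma poisson_Linfty w r : 0 <= r < 1 -> measurableT_fun w ->
  aeT (fun z => normc (w z) <= r) -> Linfty (fun z => (poisson (w z))%:C).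
Proof.
move=> r01 mw wr; have r1 : r < 1 by case/andP: r01.
have geom := @power_series_geometric R.
have h1 := power_series_Linfty geom r01 mw wr.
have wr' : aeT (fun z => normc ((w z)^*) <= r).
  by apply: (aeT1 wr) => z _; rewrite normc_conj.
have h2 := power_series_Linfty geom r01 (measT_conj mw) wr'.
have h3 : Linfty (fun z => (w z)^*) by split; [exact: measT_conj|exists r].
apply: (Linfty_eq _ (LinftyD h1 (LinftyM h2 h3))).
by apply: (aeT1 wr) => z _ hz; rewrite poissonE// (le_lt_trans hz).
Qed.

(* Only the analytic half of the Poisson kernel sees a function annihilated by
   all the positive powers of the conjugate of w. *)
Lemma integralT_poisson w phi r : 0 <= r < 1 -> measurableT_fun w ->
  aeT (fun z => normc (w z) <= r) -> L1T phi ->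
  (forall j, integralT (fun z => (w z)^* ^+ j.+1 * phi z) = 0) ->
  integralT (fun z => (poisson (w z))%:C * phi z) =
  integralT (fun z => (1 - w z)^-1 * phi z).
Proof.
move=> r01 mw wr pL h0; have r1 : r < 1 by case/andP: r01.
have geom := @power_series_geometric R.
have wr' : aeT (fun z => normc ((w z)^*) <= r).
  by apply: (aeT1 wr) => z _; rewrite normc_conj.
have mw' := measT_conj mw.
have wL : Linfty (fun z => (w z)^*) by split => //; exists r.
have wpL : L1T (fun z => (w z)^* * phi z) by exact: L1TM.
rewrite (@integralT_eq _ _ (fun z => (1 - w z)^-1 * phi z +
  (1 - (w z)^*)^-1 * ((w z)^* * phi z))); last first.
  apply: (aeT1 wr) => z _ hz; rewrite poissonE ?(le_lt_trans hz)//.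
  by rewrite mulrDl mulrA.
rewrite integralTD; first last.
- by apply: L1TM => //; exact: power_series_Linfty geom r01 mw' wr'.
- by apply: L1TM => //; exact: power_series_Linfty geom r01 mw wr.
rewrite (geometric_integral0 r01 mw' wr' wpL).
  by have := h0 0%N; under eq_fun do rewrite expr1; move=> ->; rewrite addr0.
by move=> j; under eq_fun do rewrite mulrA -exprSr.
Qed.

Lemma poisson_mean w r : 0 <= r < 1 -> measurableT_fun w ->
  aeT (fun z => normc (w z) <= r) -> (forall j, integralT (fun z => w z ^+ j.+1) = 0) ->
  integralT (fun z => (poisson (w z))%:C) = 1.
Proof.
move=> r01 mw wr h0.
have L1 : L1T (fun=> 1 : R[i]) by apply: L2_L1; apply: Linfty_L2; exact: Linfty_cst.
have wL : Linfty w by split => //; exists r.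
have := @integralT_poisson w (fun=> 1) r r01 mw wr L1.
under eq_fun do rewrite mulr1; move=> ->.
  rewrite (geometric_integral0 r01 mw wr L1); first exact: integralT_cst.
  by move=> j; under eq_fun do rewrite mulr1.
move=> j; under eq_fun do rewrite mulr1 -rmorphXn.
rewrite integralT_conj ?h0 ?rmorph0//.
by apply: L2_L1; apply: Linfty_L2; exact: LinftyX.
Qed.

Lemma mulJ_circle (z : R[i]) : normc z = 1 -> z^* * z = 1.
Proof. by move=> z1; rewrite mulrC mul_conjc z1 expr1n. Qed.

Lemma expr_mulJ (z : R[i]) j : normc z = 1 -> z^* ^+ j * z ^+ j = 1.
Proof. by move=> z1; rewrite -exprMn mulJ_circle// expr1n. Qed.

Lemma exp_L2 n : L2T (fun z : R[i] => z ^+ n).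
Proof. by apply: Linfty_L2; exact: Linfty_exp. Qed.

Lemma dotT_exp j n : (j < n)%N ->
  dotT (fun z : R[i] => z ^+ j) (fun z => z ^+ n) = 0.
Proof.
move=> jn; have [k ->] : exists k, n = (j + k.+1)%N.
  by exists (n - j).-1; rewrite prednK ?subn_gt0// subnKC// ltnW.
rewrite -(@integralT_conj_exp R k); apply: integralT_eq; apply: aeTW => z z1.
by rewrite rmorphXn /= exprD mulrA [z ^+ j * _]mulrC expr_mulJ// mul1r.
Qed.

Lemma norm2sq_exp n : norm2sq (fun z : R[i] => z ^+ n) = 1.
Proof.
have h : (norm2sq (fun z : R[i] => z ^+ n))%:C = 1%:C.
  rewrite -integralT_mulconj; last exact: exp_L2.
  rewrite -(@integralT_cst R 1%:C); apply: integralT_eq; apply: aeTW => z z1.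
  by rewrite rmorphXn /= mulrC expr_mulJ.
exact: complexI h.
Qed.

Lemma trig_L2 (a : nat -> R[i]) n : L2T (fun z => \sum_(0 <= j < n) a j * z ^+ j).
Proof.
elim: n => [|n IH].
  by under eq_fun do rewrite big_geq//; apply: Linfty_L2; exact: Linfty_cst.
under eq_fun do rewrite big_nat_recr//=.
by apply: L2TD => //; apply: L2TZ; exact: exp_L2.
Qed.

Lemma dotT_trig (a : nat -> R[i]) n v : L2T v ->
  dotT (fun z => \sum_(0 <= j < n) a j * z ^+ j) v =
  \sum_(0 <= j < n) a j * dotT (fun z => z ^+ j) v.
Proof.
move=> vL; elim: n => [|n IH].
  rewrite big_geq// /dotT; under eq_fun do rewrite big_geq// mul0r.
  exact: integralT0.
rewrite big_nat_recr//= -IH; under eq_fun do rewrite big_nat_recr//=.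
rewrite dotTDl ?dotTZl//; [exact: exp_L2|exact: trig_L2|].
by apply: L2TZ; exact: exp_L2.
Qed.

Lemma norm2sq_trig (a : nat -> R[i]) n :
  norm2sq (fun z => \sum_(0 <= j < n) a j * z ^+ j) = \sum_(0 <= j < n) normc (a j) ^+ 2.
Proof.
elim: n => [|n IH].
  rewrite big_geq//; under eq_fun do rewrite big_geq//.
  rewrite /norm2sq (_ : (fun=> _) = fun=> 0); first by rewrite rint_cst mul0r mulr0.
  by apply/funext => z; rewrite normc0 expr0n.
rewrite big_nat_recr//= -IH; under eq_fun do rewrite big_nat_recr//=.
rewrite norm2sq_addZ; [|exact: trig_L2|exact: exp_L2].
rewrite norm2sq_exp mulr1 dotTC; [|exact: trig_L2|exact: exp_L2].
rewrite dotT_trig; last exact: exp_L2.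
rewrite big_nat big1 ?rmorph0 ?mulr0 ?addr0//.
by move=> j /andP[_ jn]; rewrite dotT_exp// mulr0.
Qed.

(** The squared distance from u to its partial Fourier sum is nonnegative; expanding it gives the
    inequality. *)
Lemma bessel u n : L2T u ->
  \sum_(0 <= j < n) normc (dotT u (fun z => z ^+ j)) ^+ 2 <= norm2sq u.
Proof.
move=> uL; set a := fun j => dotT u (fun z => z ^+ j).
have pL := trig_L2 a n; set p := fun z => _ in pL.
have := norm2sq_ge0 (fun z => u z + -1 * p z).
rewrite norm2sq_addZ// normcN normc1 expr1n mul1r.
have -> : dotT p u = (norm2sq p)%:C.
  rewrite dotT_trig// norm2sq_trig rmorph_sum; apply: eq_bigr => j _.
  by rewrite (dotTC uL (exp_L2 j)) mul_conjc.
rewrite mulN1r raddfN /= /p norm2sq_trig.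
by set S := \sum_(0 <= j < n) _; lra.
Qed.

End PoissonCircle.

(** * Fatou's theorem on radial limits *)

Section Fatou.
Variable R : realType.
Local Notation mu := (@lebesgue_measure R).
Local Notation pi := (@pi R).
Local Notation D := (`[(0 : R), 2 * pi]%classic).
Implicit Types (c q : R[i]) (u v : R[i] -> R[i]) (h f : R -> R) (t x r e : R).

Lemma lebesgue_pt_ball f t e : lebesgue_pt f t -> 0 < e -> exists2 d, 0 < d &
  forall x, 0 < x <= d -> (\int[mu]_(s in ball t x) `|f s - f t|%:E <= (e * x)%:E)%E.
Proof.
(* The ball of radius x has length 2 x, so a mean of at most e / 2 amounts to an integral of at most
   e x. *)
move=> /fine_cvgP[[d1 /= d10 h1]] /cvgrPdist_lt/(_ (e / 2)) h2 e0.
have [d2 /= d20 {}h2] := h2 (divr_gt0 e0 (ltr0n _ 2)).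
exists (Num.min (d1 / 2) (d2 / 2)); first by rewrite lt_min !divr_gt0.
move=> x /andP[x0]; rewrite le_min => /andP[xd1 xd2].
have b1 : ball_ Num.norm 0 d1 x by rewrite /ball_ /= sub0r normrN gtr0_norm//; lra.
have b2 : ball_ Num.norm 0 d2 x by rewrite /ball_ /= sub0r normrN gtr0_norm//; lra.
have {b1}h1 := h1 x b1 x0.
have := h2 x b2 x0; rewrite sub0r normrN ger0_norm ?fine_ge0 ?davg_ge0//.
rewrite -lte_fin fineK// /davg /iavg (lebesgue_measure_ball _ (ltW x0)).
have x2 : x *+ 2 != 0 by rewrite mulrn_eq0 /= gt_eqF.
rewrite inver (negbTE x2) => h.
have -> : e * x = (x *+ 2) * (e / 2) by rewrite -mulr_natl; field.
rewrite EFinM -lee_pdivrMl; last by rewrite mulrn_wgt0.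
by apply: ltW.
Qed.

(** Differentiation is applied to [h] cut off outside the interval. At an interior point the balls
    are shrunk until they stay inside, where the cut-off changes nothing. *)
Lemma lebesgue_ae h : measurable_fun setT h -> (\int[mu]_(t in D) `|h t|%:E < +oo)%E ->
  {ae mu, forall t, 0 < t < 2 * pi -> forall e, 0 < e -> exists2 d, 0 < d &
    forall x, 0 < x <= d -> (\int[mu]_(s in ball t x) `|h s - h t|%:E <= (e * x)%:E)%E}.
Proof.
move=> mh hfin; pose f := h \_ D.
have mf : measurable_fun setT f.
  by apply/(measurable_restrictT _ (@measurable_D R)); exact: measurable_funTS.
have fi : mu.-integrable setT (EFin \o f).
  apply/integrableP; split; first exact/measurable_EFinP.
  rewrite (_ : (\int[mu]_x `|(EFin \o f) x|)%E = (\int[mu]_(t in D) `|h t|%:E)%E)//.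
  rewrite [RHS]integral_mkcond; apply: eq_integral => t _.
  by rewrite /f /= !patchE; case: ifPn => // _; rewrite normr0.
have := lebesgue_differentiation (open_integrable_locally openT fi).
move=> hae; apply: ae_imp hae _ => t ht /andP[t0 t2] e e0.
have [d d0 hd] := lebesgue_pt_ball ht e0.
pose d' := Num.min d (Num.min (t / 2) ((2 * pi - t) / 2)).
have hd1 : d' <= d by rewrite /d' !ge_min lexx.
have hd2 : d' <= t / 2 by rewrite /d' !ge_min lexx !orbT.
have hd3 : d' <= (2 * pi - t) / 2 by rewrite /d' !ge_min lexx !orbT.
exists d'; first by rewrite !lt_min d0 divr_gt0//= divr_gt0// subr_gt0.
move=> x /andP[x0 xd].
have := hd x; rewrite x0 (le_trans xd hd1) => /(_ isT); apply: le_trans.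
rewrite le_eqVlt; apply/orP; left; apply/eqP; apply: eq_integral => s.
rewrite inE /= ball_itv /= in_itv /= => /andP[s1 s2].
rewrite /f !patchE !mem_set//= in_itv /=; apply/andP; split; lra.
Qed.

(** The kernel has mean 1, so the difference is the Poisson integral of u(w) - u(z). At a common
    Lebesgue point of the real and imaginary parts this integrand has vanishing averages, and
    [poisson_vanish] applies. *)
Lemma fatou_poisson u : L1T u -> aeT (fun z => forall e, 0 < e ->
  exists2 r0, r0 < 1 & forall r, r0 < r < 1 -> 0 <= r ->
   normc (integralT (fun w => (poisson (r%:C * (z * w^*)))%:C * u w) - u z) <= e).
Proof.
move=> uL; have [mu' ui] := uL; have pi20 := pi2_gt0 R.
have /measT_ReIm[[h mh hu] [k mk ku]] := mu'.
have fin (p : R[i] -> R) (g : R -> R) : (forall z, `|p z| <= normc z) ->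
    {ae mu, forall t, D t -> p (u (expi t)) = g t} ->
    (\int[mu]_(t in D) `|g t|%:E < +oo)%E.
  move=> hp pg; apply: le_lt_trans ui.
  rewrite -(@nint_rep _ (fun z => `|p (u z)|)).
    by apply: le_nint => //; apply: aeTW => z _; exact: hp.
  by apply: ae_imp pg _ => t ht tD; rewrite ht.
have hfin := fin _ _ (@abs_Re R) hu; have kfin := fin _ _ (@abs_Im R) ku.
have ends : {ae mu, forall t : R, t != 0 /\ t != 2 * pi}.
  exists ([set 0] `|` [set 2 * pi]); split.
  - exact: measurableU.
  - by rewrite measureU0//; exact: lebesgue_measure_set1.
  - move=> t /= ht; apply: contrapT => hn; apply: ht.
    by split; apply/eqP => h0; apply: hn; [left|right].
apply/aeT_itv.
apply: ae_imp (ae_and (ae_and (lebesgue_ae mh hfin) (lebesgue_ae mk kfin))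
  (ae_and (ae_and hu ku) ends)) _ => t [[lh lk] [[ht kt] [tn0 tn2]]] tD e e0.
have t02 : 0 < t < 2 * pi.
  by move: tD; rewrite /= in_itv /= !lt_neqAle tn2 eq_sym tn0.
pose phi s := `|h s - h t| + `|k s - k t|.
have mab (g : R -> R) (y : R) : measurable_fun setT g -> measurable_fun setT (fun s => `|g s - y|).
  by move=> mg; apply: measurableT_comp => //; apply: measurable_funB.
have mphi : measurable_fun setT phi by apply: measurable_funD; exact: mab.
have phi0 s : 0 <= phi s by rewrite addr_ge0.
have mE (A : set (measurableTypeR R)) (g : R -> R) : measurable_fun setT g ->
    measurable_fun A (fun s => (g s)%:E).
  by move=> mg; apply/measurable_EFinP; exact: measurable_funTS.
have phifin : (\int[mu]_(s in D) (phi s)%:E < +oo)%E.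
  apply: (@le_lt_trans _ _ (\int[mu]_(s in D) ((`|h s|%:E + `|k s|%:E) +
      (`|h t| + `|k t|)%:E))%E).
    apply: ge0_le_integral; [exact: measurable_D| |exact: mE| |].
    - by move=> s _; rewrite lee_fin.
    - apply: emeasurable_funD => //; apply: emeasurable_funD;
        by apply: mE; apply: measurableT_comp.
    - move=> s _; rewrite -!EFinD lee_fin /phi.
      by have := ler_normB (h s) (h t); have := ler_normB (k s) (k t); lra.
  rewrite ge0_integralD//; first last.
  - by apply: emeasurable_funD; apply: mE; apply: measurableT_comp.
  - by move=> s _; rewrite -EFinD lee_fin addr_ge0.
  rewrite ge0_integralD//; first last.
  - by apply: mE; apply: measurableT_comp.
  - by apply: mE; apply: measurableT_comp.
  apply: lte_add_pinfty; first exact: lte_add_pinfty.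
  apply: (@le_lt_trans _ _ (nint (fun=> `|h t| + `|k t|))); first by rewrite /nint.
  by rewrite nint_cst ltry.
have hphi e' : 0 < e' -> exists2 d, 0 < d & forall x, 0 < x <= d ->
    (\int[mu]_(s in ball t x) (phi s)%:E <= (e' * x)%:E)%E.
  move=> e'0; have [d1 d10 h1] := lh t02 _ (divr_gt0 e'0 (ltr0n _ 2)).
  have [d2 d20 h2] := lk t02 _ (divr_gt0 e'0 (ltr0n _ 2)).
  exists (Num.min d1 d2); first by rewrite lt_min d10.
  move=> x /andP[x0]; rewrite le_min => /andP[xd1 xd2].
  rewrite /phi; under eq_integral do rewrite EFinD.
  rewrite ge0_integralD//; first last.
  - by apply: mE; exact: mab.
  - by apply: mE; exact: mab.
  - exact: measurable_ball.
  have -> : e' * x = e' / 2 * x + e' / 2 * x by field.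
  by rewrite EFinD leeD// ?h1 ?h2// x0.
(* Normalizing by (2 pi)^-1 leaves e / 2, and the factor 2 of [normc_integralT] restores e. *)
have e2 : 0 < pi * e by rewrite mulr_gt0// pi_gt0.
have [r0 r01 hr0] := poisson_vanish mphi phi0 phifin t02 hphi e2.
exists r0 => // r rr0 rge0.
have r1 : r < 1 by case/andP: rr0.
have r01' : 0 <= r < 1 by rewrite rge0.
set z := expi t.
pose q w : R[i] := r%:C * (z * w^*).
have mq : measurableT_fun q.
  apply: measTM; first exact: measT_cst.
  by apply: measTM; [exact: measT_cst|apply: measT_conj; exact: measT_id].
have qr : aeT (fun w => normc (q w) <= r).
  by apply: aeTW => w w1; rewrite /q !normcM normc_expi normc_conj w1 !mulr1 normcR ger0_norm.
have PL := poisson_Linfty r01' mq qr.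
have P1 : integralT (fun w => (poisson (q w))%:C) = 1.
  apply: (poisson_mean r01' mq qr) => j.
  have -> : (fun w => q w ^+ j.+1) = fun w => (r%:C * z) ^+ j.+1 * (w^* ^+ j.+1).
    by apply/funext => w; rewrite /q mulrA exprMn.
  rewrite integralTZ ?integralT_conj_exp ?mulr0//.
  apply: L2_L1; apply: Linfty_L2; apply: LinftyX.
  by apply: Linfty_conj; exact: Linfty_id.
have PuL : L1T (fun w => (poisson (q w))%:C * u w) by exact: L1TM.
have PcL : L1T (fun w => u z * (poisson (q w))%:C).
  by apply: L1TZ; apply: L2_L1; exact: Linfty_L2.
have -> : integralT (fun w => (poisson (q w))%:C * u w) - u z =
    integralT (fun w => (poisson (q w))%:C * (u w - u z)).
  rewrite -[X in _ - X]mulr1 -P1 -integralTZ; last by apply: L2_L1; exact: Linfty_L2.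
  rewrite -integralTB//; congr integralT; apply/funext => w.
  by rewrite mulrBr [u z * _]mulrC.
have PdL : L1T (fun w => (poisson (q w))%:C * (u w - u z)).
  by apply: L1TM => //; apply: L1TB => //; apply: L2_L1; apply: Linfty_L2; exact: Linfty_cst.
rewrite (le_trans (normc_integralT PdL))//.
suff : norm1 (fun w => (poisson (q w))%:C * (u w - u z)) <= (2 * pi)^-1 * (pi * e).
  rewrite (_ : _ * (pi * e) = e / 2); first by lra.
  have pn : pi != 0 by rewrite gt_eqF ?pi_gt0.
  by rewrite invfM -mulrA mulKf// mulrC.
rewrite /norm1 ler_wpM2l ?pi2V_ge0// -lee_fin -nint_fine//; last by case: PdL.
apply: (le_trans _ (hr0 r rr0 rge0)).
apply: ge0_ae_le_integral_gen.
- by move=> s; rewrite lee_fin.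
- by move=> s; rewrite lee_fin mulr_ge0// pkern_ge0.
apply: ae_imp (ae_and hu ku) _ => s [hs ks] sD.
rewrite lee_fin normcM normcR.
have qe : q (expi s) = r%:C * expi (t - s).
  by rewrite expiD -conj_expi.
rewrite qe poisson_pkern// ger0_norm ?pkern_ge0// ler_wpM2l ?pkern_ge0//.
rewrite (le_trans (normc_le_ReIm _))// /phi !raddfB /= hs// ks// -(ht tD) -(kt tD).
by [].
Qed.

(** With all nonzero Fourier coefficients equal to 0, every Poisson integral of u equals the mean of
    u; by Fatou's theorem these integrals tend to u almost everywhere. *)
Lemma eq_cst_of_coef0 u : L1T u -> (forall n, integralT (fun z => z ^+ n.+1 * u z) = 0) ->
  (forall n, integralT (fun z => z^* ^+ n.+1 * u z) = 0) -> eqT u (fun=> integralT u).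
Proof.
move=> uL h1 h2; apply: (aeT1 (fatou_poisson uL)) => z z1 hz.
apply/eqP; rewrite -subr_eq0 -normc_eq0 eq_le normc_ge0 andbT.
apply/ler_addgt0Pr => e e0; rewrite add0r.
have [r0 r01 hr] := hz e e0; pose r := (Num.max r0 0 + 1) / 2.
have m0 : Num.max r0 0 < 1 by rewrite gt_max r01 ltr01.
have m1 : r0 <= Num.max r0 0 by rewrite le_max lexx.
have m2 : 0 <= Num.max r0 0 by rewrite le_max lexx orbT.
have rI : r0 < r < 1 by rewrite /r; apply/andP; split; lra.
have rp : 0 <= r by rewrite /r; lra.
have r01' : 0 <= r < 1 by rewrite rp; case/andP: rI.
have := hr r rI rp; rewrite normcB.
pose q w : R[i] := r%:C * (z * w^*).
have mq : measurableT_fun q.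
  apply: measTM; first exact: measT_cst.
  by apply: measTM; [exact: measT_cst|apply: measT_conj; exact: measT_id].
have qr : aeT (fun w => normc (q w) <= r).
  by apply: aeTW => w w1; rewrite /q !normcM z1 normc_conj w1 !mulr1 normcR ger0_norm.
have zuL n : L1T (fun w => w ^+ n * u w) by apply: L1TM => //; exact: Linfty_exp.
have zuL' n : L1T (fun w => w^* ^+ n * u w).
  by apply: L1TM => //; apply: LinftyX; apply: Linfty_conj; exact: Linfty_id.
rewrite -/(q _) (integralT_poisson r01' mq qr uL); last first.
  have qJ w : (q w)^* = r%:C * z^* * w.
    by rewrite /q !conjcM conjcK conjc_real mulrA.
  move=> j; under eq_fun do rewrite qJ exprMn -mulrA.
  by rewrite integralTZ ?h1 ?mulr0.
rewrite (geometric_integral0 r01' mq qr uL); first by [].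
move=> j; under eq_fun do rewrite /q mulrA exprMn -mulrA.
by rewrite integralTZ ?h2 ?mulr0.
Qed.

End Fatou.

(** * Fourier characterization of H^2 *)

Section HardyCharacterization.
Variable R : realType.
Local Notation pi := (@pi R).
Implicit Types (c q : R[i]) (b u v s phi psi : R[i] -> R[i]) (t x r e : R).

Definition cauchyT u (z : R[i]) := integralT (fun w => (1 - z * w^*)^-1 * u w).

Lemma measT_mulJ (z : R[i]) : measurableT_fun (fun w => z * w^*).
Proof. by apply: measTM; [exact: measT_cst|apply: measT_conj; exact: measT_id]. Qed.

Lemma normc_mulJ (z : R[i]) : aeT (fun w => normc (z * w^*) <= normc z).
Proof. by apply: aeTW => w w1; rewrite normcM normc_conj w1 mulr1. Qed.

Lemma conjX_L1 n u : L1T u -> L1T (fun w => w^* ^+ n * u w).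
Proof. by apply: L1TM; apply: LinftyX; apply: Linfty_conj; exact: Linfty_id. Qed.

Lemma X_L1 n u : L1T u -> L1T (fun w => w ^+ n * u w).
Proof. by apply: L1TM; exact: Linfty_exp. Qed.

Lemma cauchyT_power_series u : L1T u ->
  power_series_of (fun j => integralT (fun w => w^* ^+ j * u w)) (cauchyT u).
Proof.
move=> uL z z1; have r01 : 0 <= normc z < 1 by rewrite normc_ge0.
have := power_series_integral (@power_series_geometric R) r01 (measT_mulJ z) (normc_mulJ z) uL.
rewrite (_ : (fun n => _) = (fun n => \sum_(0 <= j < n) integralT (fun w => w^* ^+ j * u w) * z ^+ j))//.
apply/funext => n; apply: eq_bigr => j _; rewrite mul1r.
under eq_fun do rewrite exprMn -mulrA.
by rewrite integralTZ; [rewrite mulrC|exact: conjX_L1].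
Qed.

(** Without negative Fourier coefficients the antianalytic half of the Poisson kernel contributes
    nothing. So the Cauchy integral, which is analytic, inherits the radial limits of the Poisson
    integral. *)
Lemma cauchyT_poisson u r (z : R[i]) : L1T u -> 0 <= r < 1 -> normc z = 1 ->
  (forall n, integralT (fun w => w ^+ n.+1 * u w) = 0) ->
  cauchyT u (r%:C * z) = integralT (fun w => (poisson (r%:C * (z * w^*)))%:C * u w).
Proof.
move=> uL r01 z1 h0; rewrite (integralT_poisson r01 _ _ uL).
- by congr integralT; apply/funext => w; rewrite mulrA.
- by apply: measTM; [exact: measT_cst|exact: measT_mulJ].
- apply: aeTW => w w1; rewrite !normcM normc_conj z1 w1 !mulr1 normcR ger0_norm//.
  by case/andP: r01.
- move=> j; have qJ w : (r%:C * (z * w^*))^* = r%:C * z^* * w.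
    by rewrite !conjcM conjcK conjc_real mulrA.
  under eq_fun do rewrite qJ exprMn -mulrA.
  by rewrite integralTZ ?h0 ?mulr0//; exact: X_L1.
Qed.

(** On the circle of radius r the partial sums have norm at most that of u, by orthonormality and
    Bessel's inequality; Fatou's lemma extends the bound to the whole series. *)
Lemma cauchyT_hardy2 u : L2T u -> hardy2_disc (cauchyT u).
Proof.
move=> uL; have uL1 := L2_L1 uL; have ps := cauchyT_power_series uL1.
split; first by eexists; exact: ps.
exists (2 * pi * norm2sq u) => r r01; have [r0 r1] := andP r01.
pose a j := integralT (fun w => w^* ^+ j * u w) * r%:C ^+ j.
have fin : forall n, norm2sq (fun z => \sum_(0 <= j < n) a j * z ^+ j) <= norm2sq u.
  move=> n; rewrite norm2sq_trig (le_trans _ (bessel n uL))//.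
  apply: ler_sum => j _; rewrite ler_pXn2r ?nnegrE// /a normcM normcX normcR ger0_norm//.
  rewrite (_ : dotT _ _ = integralT (fun w => w^* ^+ j * u w)); last first.
    by congr integralT; apply/funext => w; rewrite mulrC; congr (_ * _); exact: conjcX.
  by apply: ler_piMr; [exact: normc_ge0|rewrite exprn_ile1 ?(ltW r1)].
apply: (@nint_fatou R (fun n z => normc (\sum_(0 <= j < n) a j * z ^+ j) ^+ 2)
   (fun z => normc (cauchyT u (r%:C * z)) ^+ 2)).
- by move=> n; apply: measTr_normc2; case: (trig_L2 a n).
- by move=> n z; exact: sqr_ge0.
- by move=> z; exact: sqr_ge0.
- apply: aeTW => z z1; have zr : normc (r%:C * z) < 1.
    by rewrite normcM z1 mulr1 normcR ger0_norm.
  have /cvg_normcP hz := ps _ zr.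
  have hn : normc (\sum_(0 <= j < n) a j * z ^+ j) @[n --> \oo] --> normc (cauchyT u (r%:C * z)).
    apply/cvgrPdist_le => e e0; move/cvgrPdist_le : hz => /(_ e e0).
    apply: filterS => n; rewrite sub0r normrN ger0_norm//; apply: le_trans.
    rewrite (le_trans (abs_lerB_normc _ _))// le_eqVlt; apply/orP; left; apply/eqP.
    by congr normc; congr (_ - _); apply: eq_bigr => j _; rewrite /a exprMn mulrA.
  by rewrite expr2; under eq_fun do rewrite expr2; exact: cvgM.
- move=> n; rewrite nint_norm2sq; last exact: trig_L2.
  by rewrite lee_fin ler_wpM2l// ltW ?pi2_gt0.
Qed.

Lemma H2_of_coef0 u : L2T u -> (forall n, integralT (fun z => z ^+ n.+1 * u z) = 0) -> H2 u.
Proof.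
move=> uL h0; have uL1 := L2_L1 uL.
exists (cauchyT u); first exact: cauchyT_hardy2.
apply: (aeT1 (fatou_poisson uL1)) => z z1 hz.
apply/cvg_normcP/cvgrPdist_le => e e0; have [r0 r01 hr] := hz e e0.
have m : Num.max r0 0 < 1 by rewrite gt_max r01 ltr01.
near=> r.
have r1 : r < 1 by near: r; exact: nbhs_left_lt.
have rm : Num.max r0 0 < r by near: r; exact: nbhs_left_gt.
move: rm; rewrite gt_max => /andP[rr0 r0'].
rewrite sub0r normrN ger0_norm// cauchyT_poisson ?(ltW r0')//.
by apply: hr; rewrite ?rr0 ?ltW.
Unshelve. all: by end_near. Qed.

(** The working description of H^2: the integral against z^(n+1) is the Fourier coefficient of index
    -(n+1). Stability under sums, products and L^2 limits is read off from it. *)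
Lemma H2P u : H2 u <-> L2T u /\ forall n, integralT (fun z => z ^+ n.+1 * u z) = 0.
Proof.
split=> [hu|[]]; last exact: H2_of_coef0.
split; first exact: H2_L2.
by move=> n; under eq_fun do rewrite mulrC; exact: H2_coef0.
Qed.

Lemma H2_eq u v : eqT u v -> H2 u -> H2 v.
Proof.
move=> uv /H2P[uL h]; apply/H2P; split; first exact: L2T_eq uL.
move=> n; rewrite -[RHS](h n); apply: integralT_eq.
by apply: (aeT1 uv) => z _ ->.
Qed.

Lemma H2D u v : H2 u -> H2 v -> H2 (fun z => u z + v z).
Proof.
move=> /H2P[uL hu] /H2P[vL hv]; apply/H2P; split; first exact: L2TD.
move=> n; under eq_fun do rewrite mulrDr.
by rewrite integralTD ?hu ?hv ?addr0//; apply: X_L1; exact: L2_L1.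
Qed.

Lemma H2Z c u : H2 u -> H2 (fun z => c * u z).
Proof.
move=> /H2P[uL hu]; apply/H2P; split; first exact: L2TZ.
move=> n; under eq_fun do rewrite mulrCA.
by rewrite integralTZ ?hu ?mulr0//; apply: X_L1; exact: L2_L1.
Qed.

Lemma H2_exp n : H2 (fun z : R[i] => z ^+ n).
Proof.
apply/H2P; split; first exact: exp_L2.
by move=> k; under eq_fun do rewrite -exprD addSn; exact: integralT_exp.
Qed.

Lemma H2_cst c : H2 (fun=> c).
Proof. by have := H2Z c (H2_exp 0); under eq_fun do rewrite expr0 mulr1. Qed.

(** A substitute for the statement that u v is analytic: the product is only integrable, but z u v
    still has mean 0. *)
Lemma integralT_H2M u v : H2 u -> H2 v -> integralT (fun z => z * (u z * v z)) = 0.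
Proof.
move=> hu /H2P[vL hv].
under eq_fun do rewrite mulrCA; apply: (H2_integral0 hu).
  by apply: L2TM => //; exact: Linfty_id.
by move=> j; under eq_fun do rewrite mulrA -exprSr; exact: hv.
Qed.

(* The bounded functions of H2, i.e. the boundary functions of H^oo. *)
Definition bddH2 b := H2 b /\ Linfty b.

(** The integral of z^(n+1) b u is the mean of z times the product of the H^2 functions b and z^n
    u. *)
Lemma H2M b u : bddH2 b -> H2 u -> H2 (fun z => b z * u z).
Proof.
move=> [hb bL] hu; have [uL _] := (proj1 (H2P u)) hu.
apply/H2P; split; first exact: L2TM.
move=> n; under eq_fun do rewrite mulrCA.
have hzu : H2 (fun z => z ^+ n * u z).
  apply/H2P; split; first by apply: L2TM => //; exact: Linfty_exp.
  move=> j; under eq_fun do rewrite mulrA -exprD addSn.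
  by case/H2P: hu.
rewrite -[RHS](integralT_H2M hb hzu); congr integralT; apply/funext => z.
by rewrite exprS; ring.
Qed.

Lemma bddH2M b v : bddH2 b -> bddH2 v -> bddH2 (fun z => b z * v z).
Proof. by move=> hb [hv vL]; split; [exact: H2M|apply: LinftyM => //; case: hb]. Qed.

Lemma bddH2D b v : bddH2 b -> bddH2 v -> bddH2 (fun z => b z + v z).
Proof. by move=> [hb bL] [hv vL]; split; [exact: H2D|exact: LinftyD]. Qed.

Lemma bddH2_cst c : bddH2 (fun=> c).
Proof. by split; [exact: H2_cst|exact: Linfty_cst]. Qed.

Lemma bddH2_exp n : bddH2 (fun z => z ^+ n).
Proof. by split; [exact: H2_exp|exact: Linfty_exp]. Qed.

Lemma bddH2X b n : bddH2 b -> bddH2 (fun z => b z ^+ n).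
Proof.
move=> hb; elim: n => [|n IH].
  by under eq_fun do rewrite expr0; exact: bddH2_cst.
by under eq_fun do rewrite exprS; exact: bddH2M.
Qed.

Lemma bounded_hardy2 (F : R[i] -> R[i]) : bounded_analytic_disc F -> hardy2_disc F.
Proof.
move=> [Fa [M hM]]; split => //; exists (M ^+ 2 * (2 * pi)) => r /andP[r0 r1].
have le : aeT (fun z => normc (F (r%:C * z)) ^+ 2 <= M ^+ 2).
  apply: aeTW => z z1; have h : normc (F (r%:C * z)) <= M.
    by apply: hM; rewrite normcM z1 mulr1 normcR ger0_norm.
  by rewrite ler_pXn2r// nnegrE// (le_trans _ h).
apply: (@le_trans _ _ (nint (fun=> M ^+ 2))); last by rewrite nint_cst.
by apply: (le_nint _ _ le) => z; exact: sqr_ge0.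
Qed.

Lemma Hinfty_bddH2 u : Hinfty u -> bddH2 u.
Proof.
move=> [F hF hu]; have hF2 := bounded_hardy2 hF.
have hu2 : H2 u by exists F.
split=> //; split; first by case: (H2_L2 hu2).
have [_ [M hM]] := hF; exists M; apply: (aeT1 (boundary_radius hu)) => z z1 hz.
apply/ler_addgt0Pr => e e0.
have [N _ hN] := (iffLR (@cvgrPdist_lt R R^o nat _ _ _ _) hz) e e0.
have := hN N (leqnn N); rewrite /= sub0r normrN ger0_norm// => h.
have h2 := hM _ (normc_radius_lt N z1).
rewrite -[u z](subrK (F ((radius R N)%:C * z))) addrC.
by rewrite (le_trans (le_normcD _ _))// lerD// normcB ltW.
Qed.

(** The integrals of psi^j z^(n+1) vanish because the powers of psi lie in H^2, and the mean value
    property passes this on to (u o psi) z^(n+1). *)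
Lemma H2_comp u psi : H2 u -> circle_contraction psi ->
  bddH2 psi -> H2 (fun z => u (psi z)).
Proof.
move=> hu hpsi hb; have [mpsi psi1 null contr] := hpsi.
have [uL _] := (proj1 (H2P u)) hu; have [cL _] := contr u uL.
apply/H2P; split => // n; under eq_fun do rewrite mulrC.
apply: (H2_comp_integral0 hu hpsi); first exact: exp_L2.
move=> j; have [hj _] := bddH2X j hb.
by under eq_fun do rewrite mulrC; case/H2P: hj.
Qed.

Lemma bddH2_comp u psi : bddH2 u -> circle_contraction psi ->
  bddH2 psi -> bddH2 (fun z => u (psi z)).
Proof.
move=> [hu uL] hpsi hb; split; first exact: H2_comp.
have [mpsi psi1 null contr] := hpsi.
split; first by case: (contr u (Linfty_L2 uL)) => [[]].
by have [_ [M hM]] := uL; exists M; exact: (null _ hM).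
Qed.

End HardyCharacterization.

(** * Composition with inner functions vanishing at 0 *)

Section GeneralIntegral.
Local Open Scope ereal_scope.
Import HBNNSimple.
Context d (T : measurableType d) (R : realType).
Variable mu : {measure set T -> \bar R}.

Lemma ge0_integral_mrestr (D : set T) (mD : measurable D) (f : T -> \bar R) :
  measurable_fun setT f -> (forall x, 0 <= f x) ->
  \int[mrestr mu mD]_x f x = \int[mu]_(x in D) f x.
Proof.
move=> mf f0; rewrite (@ge0_negligible_integral _ _ _ (mrestr mu mD) setT (~` D))//; first last.
- by rewrite /= /mrestr setICl measure0.
- exact: measurableC.
rewrite setTD setCK; apply: eq_measure_integral => A mA AD.
by rewrite /mrestr; congr (mu _); exact/setIidPl.
Qed.

(** The left side is the integral of [f] against the pushforward measure, which is dominated on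
    every measurable set; comparing simple functions finishes. *)
Lemma ge0_le_integral_comp (D : set T) (phi : T -> T) (f : T -> \bar R) :
  measurable D -> measurable_fun setT phi -> measurable_fun setT f ->
  (forall x, 0 <= f x) ->
  (forall B, measurable B -> mu (phi @^-1` B `&` D) <= mu (B `&` D)) ->
  \int[mu]_(x in D) f (phi x) <= \int[mu]_(x in D) f x.
Proof.
move=> mD mphi mf f0 hB.
have mfp : measurable_fun setT (fun x => f (phi x)) by exact: measurableT_comp.
rewrite -!(ge0_integral_mrestr mD)//.
have := @ge0_integral_pushforward _ _ _ _ _ _ mphi (mrestr mu mD) setT f measurableT mf
   (fun y _ => f0 y).
rewrite preimage_setT => <-.
rewrite !ge0_integralTE//; apply: ge_ereal_sup => _ [h /= hf <-].
apply: (@le_trans _ _ (sintegral (mrestr mu mD) h)).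
  exact: (@le_measure_sintegral _ _ _ (measure_function_pushforward__canonical__measure_function_Measure (mrestr mu mD) mphi)).
by apply: ereal_sup_ubound; exists h.
Qed.
End GeneralIntegral.

Section Tonelli.
Local Open Scope ereal_scope.
Context d1 d2 (T1 : measurableType d1) (T2 : measurableType d2) (R : realType).
Variable m1 : {sigma_finite_measure set T1 -> \bar R}.
Variable m2 : {sigma_finite_measure set T2 -> \bar R}.

Lemma tonelli_on (D1 : set T1) (D2 : set T2) (f : T1 * T2 -> \bar R) :
  measurable D1 -> measurable D2 -> measurable_fun setT f -> (forall p, 0 <= f p) ->
  \int[m1]_(x in D1) \int[m2]_(y in D2) f (x, y) =
  \int[m2]_(y in D2) \int[m1]_(x in D1) f (x, y).
Proof.
move=> mD1 mD2 mf f0; pose g := f \_ (D1 `*` D2).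
have mg : measurable_fun setT g.
  by apply/(measurable_restrictT _ (measurableX mD1 mD2)); exact: measurable_funTS.
have g0 p : 0 <= g p by rewrite /g patchE; case: ifPn.
have e1 : \int[m1]_(x in D1) \int[m2]_(y in D2) f (x, y) =
    \int[m1]_x \int[m2]_y g (x, y).
  rewrite integral_mkcond; apply: eq_integral => x _.
  rewrite patchE; case: ifPn => [xD|xD].
    rewrite integral_mkcond; apply: eq_integral => y _.
    by rewrite /g !patchE in_setX /= xD.
  rewrite integral0_eq// => y _; rewrite /g patchE in_setX /=.
  by rewrite (negbTE xD).
have e2 : \int[m2]_(y in D2) \int[m1]_(x in D1) f (x, y) =
    \int[m2]_y \int[m1]_x g (x, y).
  rewrite integral_mkcond; apply: eq_integral => y _.
  rewrite patchE; case: ifPn => [yD|yD].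
    rewrite integral_mkcond; apply: eq_integral => x _.
    by rewrite /g !patchE in_setX /= yD andbT.
  rewrite integral0_eq// => x _; rewrite /g patchE in_setX /=.
  by rewrite (negbTE yD) andbF.
by rewrite e1 e2; exact: fubini_tonelli.
Qed.

End Tonelli.

(** * Lebesgue measure under the argument of an inner function *)

Section ArgumentMeasure.
Variable R : realType.
Local Notation mu := (@lebesgue_measure R).
Local Notation pi := (@pi R).
Local Notation T := (measurableTypeR R).
Local Notation D := (`[(0 : R), 2 * pi]%classic).
Implicit Types (t x s r e : R) (U B : set T).

Lemma nint_poisson_mean w r : 0 <= r < 1 -> measurableT_fun w ->
  aeT (fun z => normc (w z) <= r) -> (forall j, integralT (fun z : R[i] => w z ^+ j.+1) = 0) ->
  (\int[mu]_(t in D) `|poisson (w (expi t))|%:E)%E = (2 * pi)%:E.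
Proof.
move=> r01 mw wr h0; have PL := poisson_Linfty r01 mw wr.
have r1 : r < 1 by case/andP: r01.
have PL1 := L2_L1 (Linfty_L2 PL).
have := poisson_mean r01 mw wr h0; rewrite integralTE => -[+ _] => h.
have : nint (fun z => normc (poisson (w z))%:C) = (2 * pi)%:E.
  rewrite nint_fine; [|by move=> z; exact: normc_ge0|by case: PL1].
  rewrite (@rint_eq _ _ (fun z => complex.Re (poisson (w z))%:C)); last first.
    apply: (aeT1 wr) => z _ hz; rewrite normcR ger0_norm//.
    by apply: poisson_ge0; exact: le_lt_trans r1.
  by rewrite -[rint _](mulKf (lt0r_neq0 (pi2_gt0 R))) mulrCA h mulr1.
by move=> <-; apply: eq_integral => t _; rewrite normcR.
Qed.

Lemma measurable_pkern0 r : 0 <= r < 1 -> measurable_fun setT (@pkern R r).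
Proof.
move=> r01; have := measurable_pkern 0 r01 => h.
have := measurableT_comp h (@oppr_measurable R setT).
by apply: eq_measurable_fun => x _ /=; rewrite sub0r opprK.
Qed.

Lemma pkern_total x r : 0 <= r < 1 ->
  (\int[mu]_(s in D) (pkern r (x - s))%:E)%E = (2 * pi)%:E.
Proof.
move=> r01; have [r0 r1] := andP r01.
pose w (z : R[i]) : R[i] := r%:C * expi x * z^*.
rewrite -(@nint_poisson_mean w r r01).
- apply: eq_integral => s _; have -> : w (expi s) = r%:C * expi (x - s).
    by rewrite /w -mulrA conj_expi -expiD.
  by rewrite poisson_pkern// ger0_norm// pkern_ge0.
- exact: measT_mulJ.
- apply: aeTW => z z1; rewrite /w !normcM normc_expi normc_conj z1 !mulr1.
  by rewrite normcR ger0_norm.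
- move=> j; under eq_fun do rewrite /w exprMn.
  rewrite integralTZ ?integralT_conj_exp ?mulr0//.
  by apply: L2_L1; apply: Linfty_L2; apply: LinftyX; apply: Linfty_conj; exact: Linfty_id.
Qed.

Variable A : R -> R.
Hypothesis mA : measurable_fun setT (A : T -> T).
Hypothesis A_itv : forall t, 0 <= A t <= 2 * pi.
(** The pushforward under [A] has the same Poisson integrals as Lebesgue measure; this determines it
    closely enough to be dominated by Lebesgue measure. *)
Hypothesis A_pkern : forall r s, 0 <= r < 1 ->
  (\int[mu]_(t in D) (pkern r (A t - s))%:E)%E = (2 * pi)%:E.

Local Notation I := (`]0, 2 * pi[%classic : set T).

Let mD : measurable (D : set T). Proof. exact: measurable_itv. Qed.

Lemma measurable_pkern_arg r : 0 <= r < 1 ->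
  measurable_fun setT (fun p : T * T => (pkern r (A p.1 - p.2))%:E).
Proof.
move=> r01; apply/measurable_EFinP.
apply: (measurableT_comp (measurable_pkern0 r01)).
apply: measurable_funB.
  exact: (measurableT_comp mA measurable_fst).
exact: measurable_snd.
Qed.

Definition poisson_indic U r x : \bar R :=
  (\int[mu]_(s in D) (\1_U s * pkern r (x - s))%:E)%E.

Lemma measurable_indic_pkern U r x : measurable U -> 0 <= r < 1 ->
  measurable_fun setT (fun s : T => (\1_U s * pkern r (x - s))%:E).
Proof.
move=> mU r01; apply/measurable_EFinP; apply: measurable_funM.
  exact: measurable_indic.
exact: measurable_pkern.
Qed.

Lemma indic_pkern_ge0 U r (x s : R) : 0 <= r < 1 -> 0 <= \1_U s * pkern r (x - s).
Proof. by move=> r01; rewrite mulr_ge0 ?pkern_ge0. Qed.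

Lemma poisson_indic_ge0 U r x : 0 <= r < 1 -> (0 <= poisson_indic U r x)%E.
Proof.
by move=> r01; apply: integral_ge0 => s _; rewrite lee_fin indic_pkern_ge0.
Qed.

Lemma poisson_indicC U r x : measurable U -> 0 <= r < 1 ->
  (poisson_indic U r x + poisson_indic (~` U) r x = (2 * pi)%:E)%E.
Proof.
move=> mU r01; rewrite -(pkern_total x r01) -ge0_integralD//.
- apply: eq_integral => s _; rewrite -EFinD -mulrDl !indicE in_setC.
  by case: (s \in U); rewrite ?addr0 ?add0r mul1r.
- by move=> s _; rewrite lee_fin indic_pkern_ge0.
- by apply: measurable_funTS; exact: measurable_indic_pkern.
- by move=> s _; rewrite lee_fin indic_pkern_ge0.
- by apply: measurable_funTS; apply: measurable_indic_pkern => //; exact: measurableC.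
Qed.

Lemma poisson_indic_fin U r x : measurable U -> 0 <= r < 1 ->
  poisson_indic U r x \is a fin_num.
Proof.
move=> mU r01; rewrite ge0_fin_numE ?poisson_indic_ge0//.
apply: (@le_lt_trans _ _ (2 * pi)%:E); last exact: ltry.
by rewrite -(poisson_indicC x mU r01) leeDl// poisson_indic_ge0.
Qed.

Lemma integral_poisson_indic U r : measurable U -> 0 <= r < 1 ->
  (\int[mu]_(t in D) poisson_indic U r (A t) = (2 * pi)%:E * mu (D `&` U))%E.
Proof.
move=> mU r01; have pi20 := pi2_gt0 R.
have := @tonelli_on _ _ _ _ R mu mu D D
  (fun p : T * T => (\1_U p.2 * pkern r (A p.1 - p.2))%:E) mD mD.
rewrite /poisson_indic /= => ->.
- transitivity (\int[mu]_(s in D) ((2 * pi)%:E * (\1_U s)%:E))%E.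
    apply: eq_integral => s _; under eq_integral do rewrite EFinM.
    rewrite ge0_integralZl//.
    + by rewrite A_pkern// muleC.
    + apply/measurable_EFinP; apply: measurable_funTS.
      apply: (measurableT_comp (measurable_pkern0 r01)).
      by apply: measurable_funB.
    + by move=> t _; rewrite lee_fin pkern_ge0.
  rewrite ge0_integralZl//.
  + by rewrite integral_indic// setIC.
  + by apply/measurable_EFinP; apply: measurable_funTS; exact: measurable_indic.
  + by rewrite lee_fin ltW.
- under eq_fun do rewrite EFinM.
  apply: emeasurable_funM; last exact: measurable_pkern_arg.
  apply/measurable_EFinP; apply: measurableT_comp; last exact: measurable_snd.
  exact: measurable_indic.
- by move=> p; rewrite lee_fin indic_pkern_ge0.
Qed.

(** The indicator of the complement vanishes near x because U is open, so its Poisson integral tends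
    to 0 by [poisson_vanish]; the two integrals add up to 2 pi. *)
Lemma poisson_indic_cvg U x : open U -> U x -> 0 < x < 2 * pi ->
  poisson_indic U (radius R n) x @[n --> \oo] --> (2 * pi)%:E.
Proof.
move=> oU Ux x02; have mU : measurable U by exact: open_measurable.
have mUc : measurable (~` U) by exact: measurableC.
apply/fine_cvgP; split.
  by apply: nearW => n; apply: poisson_indic_fin => //; exact: radius_itv.
apply/cvgrPdist_le => e e0.
have [//|//|||r0 r01 hr] := @poisson_vanish R (\1_(~` U)) x _ _ _ x02 _ e e0.
- rewrite integral_indic//; apply: (@le_lt_trans _ _ (mu D)).
    by apply: le_measure; rewrite ?inE//; exact: measurableI.
  by rewrite lebesgue_measure_itv /=; case: ifP => _; rewrite ltry.
- move=> e' e'0; move: (oU) => /(_ x Ux) /nbhs_ballP[d /= d0 hd].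
  exists (d / 2); first by rewrite divr_gt0.
  move=> y /andP[y0 yd]; rewrite integral0_eq ?lee_fin ?mulr_ge0 ?ltW//.
  move=> s; rewrite ball_itv /= in_itv /= => /andP[s1 s2].
  rewrite indicE memNset//= => /(_ (hd _ _)) h; apply: h.
  by rewrite ball_itv /= in_itv /=; apply/andP; split; lra.
have hn : \forall n \near \oo, r0 < radius R n := @cvg_radius_left R _ (nbhs_left_gt r01).
near=> n; have rn : r0 < radius R n by near: n.
have r01' := radius_itv R n; have [rn0 rn1] := andP r01'.
have := hr (radius R n); rewrite rn rn1 => /(_ isT rn0).
rewrite (_ : (\int[mu]_(s in D) _)%E = poisson_indic (~` U) (radius R n) x); last first.
  by apply: eq_integral => s _; rewrite mulrC.
have := poisson_indicC x mU r01'.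
rewrite -(fineK (poisson_indic_fin x mU r01')) -(fineK (poisson_indic_fin x mUc r01')).
rewrite -EFinD => -[<-]; rewrite lee_fin addrAC subrr add0r => h.
by rewrite ger0_norm// fine_ge0// poisson_indic_ge0.
Unshelve. all: by end_near.
Qed.

Lemma measurable_poisson_indic_arg U r : measurable U -> 0 <= r < 1 ->
  measurable_fun setT (fun t : T => poisson_indic U r (A t)).
Proof.
move=> mU r01; rewrite /poisson_indic.
pose g (p : T * T) := ((fun p : T * T => (\1_U p.2 * pkern r (A p.1 - p.2))%:E) \_ (setT `*` D)) p.
have mg : measurable_fun setT g.
  apply/(measurable_restrictT _ (measurableX measurableT mD)).
  apply: measurable_funTS; under eq_fun do rewrite EFinM.
  apply: emeasurable_funM; last exact: measurable_pkern_arg.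
  apply/measurable_EFinP; apply: measurableT_comp; last exact: measurable_snd.
  exact: measurable_indic.
have g0 p : (0 <= g p)%E.
  by rewrite /g patchE; case: ifPn => // _; rewrite lee_fin indic_pkern_ge0.
have := @measurable_fun_fubini_tonelli_F _ _ _ _ _ mu g mg g0.
apply: eq_measurable_fun => t _; rewrite /fubini_F [RHS]integral_mkcond.
apply: eq_integral => s _; rewrite /g !patchE in_setX /=.
by rewrite in_setT.
Qed.

(** The normalized Poisson integral of the indicator of U tends to 1 on U, away from the end points.
    Fatou's lemma bounds the measure by the integrals of these functions along A, which
    [integral_poisson_indic] evaluates by Tonelli. *)
Lemma arg_measure_open U : open U ->
  (mu (A @^-1` (U `&` I) `&` D) <= mu (D `&` U))%E.
Proof.
move=> oU; have mU : measurable U by exact: open_measurable.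
pose V := U `&` I.
have mV : measurable (V : set T) by apply: measurableI => //; exact: measurable_itv.
have mAV : measurable (A @^-1` V : set T) by rewrite -[X in measurable X]setTI; exact: mA.
have pi20 := pi2_gt0 R; have piV0 := pi2V_ge0 R.
have mi : measurable_fun D (fun t : T => (\1_V (A t))%:E : \bar R).
  apply/measurable_EFinP; apply: measurable_funTS.
  by apply: measurableT_comp => //; exact: measurable_indic.
rewrite -[X in (X <= _)%E]integral_indic//.
(* The indicator factor forces convergence at every t: off V the sequence is constantly 0. *)
pose f_ n (t : T) := ((\1_V (A t))%:E * ((2 * pi)^-1%:E * poisson_indic U (radius R n) (A t)))%E.
apply: (@fatou_le _ T R mu D f_ (fun t => (\1_(A @^-1` V) t)%:E)) => //.
- move=> n; apply: emeasurable_funM => //; apply: measurable_funeM.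
  by apply: measurable_funTS; apply: measurable_poisson_indic_arg => //; exact: radius_itv.
- move=> n t _; rewrite mule_ge0 ?lee_fin// mule_ge0 ?lee_fin//.
  by apply: poisson_indic_ge0; exact: radius_itv.
- apply: aeW => t tD; rewrite /f_ (_ : \1_(A @^-1` V) t = \1_V (A t))//.
  rewrite !indicE; case: (boolP (A t \in V)) => [/set_mem[AU AI]|_]; last first.
    by under eq_fun do rewrite mul0e; exact: cvg_cst.
  under eq_fun do rewrite mul1e.
  rewrite (_ : 1%:E = ((2 * pi)^-1%:E * (2 * pi)%:E)%E); last first.
    by rewrite -EFinM mulVf// gt_eqF.
  by apply: cvgeZl => //; apply: poisson_indic_cvg.
- move=> n; have rn := radius_itv R n.
  apply: (@le_trans _ _ (\int[mu]_(t in D) ((2 * pi)^-1%:E * poisson_indic U (radius R n) (A t)))%E).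
    apply: ge0_le_integral => //.
    + move=> t _; rewrite mule_ge0 ?lee_fin// mule_ge0 ?lee_fin//.
      exact: poisson_indic_ge0.
    + apply: emeasurable_funM => //; apply: measurable_funeM.
      by apply: measurable_funTS; exact: measurable_poisson_indic_arg.
    + apply: measurable_funeM.
      by apply: measurable_funTS; exact: measurable_poisson_indic_arg.
    + move=> t _; rewrite /f_ indicE; case: (_ \in _); rewrite ?mul1e// mul0e.
      by rewrite mule_ge0 ?lee_fin// poisson_indic_ge0.
  rewrite ge0_integralZl//.
  + by rewrite integral_poisson_indic// muleA -EFinM mulVf ?mul1e// gt_eqF.
  + by apply: measurable_funTS; exact: measurable_poisson_indic_arg.
  + by move=> t _; exact: poisson_indic_ge0.
Qed.

(** Mass at the angle 0 would be weighted by (1 + r) / (1 - r), the peak of the kernel, while the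
    total stays 2 pi; letting r tend to 1 leaves no mass. *)
Lemma arg_measure_ends : mu (A @^-1` [set 0; 2 * pi] `&` D) = 0%E.
Proof.
pose E := A @^-1` [set 0; 2 * pi] `&` D.
have mS : measurable ([set 0; 2 * pi] : set T) by exact: measurableU.
have mE : measurable (E : set T).
  by apply: measurableI => //; rewrite -[X in measurable X]setTI; exact: mA.
have pi20 := pi2_gt0 R.
have Efin : mu E \is a fin_num.
  rewrite ge0_fin_numE//; apply: (@le_lt_trans _ _ (mu D)).
    by apply: le_measure; rewrite ?inE// => t [].
  by rewrite lebesgue_measure_itv /=; case: ifP => _; rewrite ltry.
have h n : fine (mu E) <= 2 * pi * (1 - radius R n).
  have rn := radius_itv R n; have [r0 r1] := andP rn.
  have e0 : 0 < 1 - radius R n by rewrite subr_gt0.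
  have hk t : E t -> pkern (radius R n) (A t - 0) = (1 + radius R n) / (1 - radius R n).
    move=> [At _]; have c1 : cos (A t - 0) = 1.
      rewrite subr0; case: At => ->; first exact: cos0.
      by rewrite mulr_natl -[_ *+ 2]add0r cosD2pi cos0.
    by rewrite /pkern c1 subrr mulr0 addr0; field; rewrite gt_eqF.
  have : (((1 + radius R n) / (1 - radius R n))%:E * mu E <= (2 * pi)%:E)%E.
    rewrite -(A_pkern 0 rn) -integral_cst//.
    apply: (@le_trans _ _ (\int[mu]_(t in E) (pkern (radius R n) (A t - 0))%:E)%E).
      by rewrite le_eqVlt; apply/orP; left; apply/eqP; apply: eq_integral => t /set_mem tE; rewrite hk.
    apply: ge0_subset_integral => //.
    + apply/measurable_EFinP; apply: measurable_funTS.
      by apply: (measurableT_comp (measurable_pkern0 rn)); exact: measurable_funB.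
    + by move=> t _; rewrite lee_fin pkern_ge0.
    + by move=> t [].
  rewrite -(fineK Efin) -EFinM lee_fin mulrAC ler_pdivrMr//; apply: le_trans.
  apply: ler_peMl; first exact: fine_ge0 (measure_ge0 _ _).
  by rewrite lerDl.
have m0 : fine (mu E) <= 0.
  have c : (fun n => 2 * pi * (1 - radius R n)) @ \oo --> (0 : R).
    rewrite -(mulr0 (2 * pi)); apply: cvgM; first exact: cvg_cst.
    by rewrite -(subrr (1 : R)); apply: cvgB; [exact: cvg_cst|exact: cvg_radius].
  by apply: (ler_cvg_to (cvg_cst (fine (mu E))) c); apply: nearW.
by rewrite -/E -(fineK Efin); congr EFin; apply/eqP; rewrite eq_le m0 fine_ge0.
Qed.

(** Outer regularity reduces Borel sets of the open interval to open sets; the two end points are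
    covered by [arg_measure_ends]. *)
Lemma arg_measure_le B : measurable (B : set T) -> (mu (A @^-1` B `&` D) <= mu (B `&` D))%E.
Proof.
move=> mB; have pi20 := pi2_gt0 R.
pose B' := B `&` I.
have mB' : measurable (B' : set T) by apply: measurableI => //; exact: measurable_itv.
have B'D : B' `<=` B `&` D.
  by move=> t [tB]; rewrite /= !in_itv /= => /andP[t0 t2]; split => //; rewrite !ltW.
have mBD : measurable (B `&` D : set T) by exact: measurableI.
have B'fin : (mu B' < +oo)%E.
  apply: (@le_lt_trans _ _ (mu D)).
    by apply: le_measure; rewrite ?inE// => t /B'D[].
  by rewrite lebesgue_measure_itv /=; case: ifP => _; rewrite ltry.
apply/lee_addgt0Pr => e e0.
have [U [oU B'U Ue]] := lebesgue_regularity_outer mB' B'fin e0.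
have mU : measurable U by exact: open_measurable.
have mS : measurable ([set 0; 2 * pi] : set T) by exact: measurableU.
have mpre (C : set T) : measurable C -> measurable (A @^-1` C : set T).
  by move=> mC; rewrite -[X in measurable X]setTI; exact: mA.
have mI : measurable I by exact: measurable_itv.
have sub : A @^-1` B `&` D `<=` (A @^-1` (U `&` I) `&` D) `|`
    (A @^-1` [set 0; 2 * pi] `&` D).
  move=> t [tB tD]; have /andP[a0 a2] := A_itv t.
  have [h0|h0] := eqVneq (A t) 0; first by right; split => //; left.
  have [h2|h2] := eqVneq (A t) (2 * pi); first by right; split => //; right.
  have AI : I (A t).
    by rewrite /= in_itv /= !lt_neqAle a0 a2 h2 eq_sym h0.
  by left; split => //; split => //; apply: B'U; split.
have mE0 : measurable (A @^-1` [set 0; 2 * pi] `&` D : set T).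
  by apply: measurableI => //; exact: mpre.
have mE1 : measurable (A @^-1` (U `&` I) `&` D : set T).
  by apply: measurableI => //; apply: mpre; exact: measurableI.
have mE2 : measurable (A @^-1` B `&` D : set T) by apply: measurableI => //; exact: mpre.
apply: (@le_trans _ _ (mu ((A @^-1` (U `&` I) `&` D) `|` (A @^-1` [set 0; 2 * pi] `&` D)))).
  by apply: le_measure => //; rewrite inE//; exact: measurableU.
apply: (le_trans (measureU2 _ mE1 mE0)).
rewrite -/(mu _) [X in (_ + X)%E]arg_measure_ends adde0.
apply: (le_trans (arg_measure_open oU)).
apply: (@le_trans _ _ (mu U)); first by apply: le_measure; rewrite ?inE//; exact: measurableI.
rewrite -(setDUK B'U) measureU//; first last.
- by rewrite setDE setIA setIAC setICr set0I.
- exact: measurableD.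
by apply: leeD; [apply: le_measure; rewrite ?inE|exact: ltW].
Qed.

End ArgumentMeasure.

Section InnerFunctions.
Variable R : realType.
Local Notation mu := (@lebesgue_measure R).
Local Notation pi := (@pi R).
Local Notation T := (measurableTypeR R).
Local Notation D := (`[(0 : R), 2 * pi]%classic).
Implicit Types (t x s r : R) (c : R[i]) (u v w phi psi Psi : R[i] -> R[i]).

(** On the circle conj z is 1 / z. Division by z shifts the coefficients by one, and the single new
    condition is that the mean vanishes. *)
Lemma bddH2_divX psi : bddH2 psi -> integralT psi = 0 -> bddH2 (fun z => psi z * z^*).
Proof.
move=> [hpsi pL] p0; have [_ hc] := (proj1 (H2P psi)) hpsi.
have qL : Linfty (fun z => psi z * z^*).
  by apply: LinftyM => //; apply: Linfty_conj; exact: Linfty_id.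
split; last exact: qL.
apply: H2_of_coef0; first exact: Linfty_L2.
move=> n; rewrite (@integralT_eq _ _ (fun z => z ^+ n * psi z)); last first.
  by apply: aeTW => z z1; rewrite exprSr -mulrA [psi z * _]mulrC (mulrA z) mul_conjc z1 expr1n mul1r.
by case: n => [|n]; [under eq_fun do rewrite expr0 mul1r|exact: hc].
Qed.

(** Write psi^(j+1) as z times the product of psi / z and psi^j, both in H^2. *)
Lemma inner_power_mean psi j : bddH2 psi -> integralT psi = 0 ->
  integralT (fun z => psi z ^+ j.+1) = 0.
Proof.
move=> hpsi p0; have [hq _] := bddH2_divX hpsi p0.
rewrite -[RHS](integralT_H2M hq (proj1 (bddH2X j hpsi))); apply: integralT_eq.
by apply: aeTW => z z1; rewrite exprS !mulrA [z * psi z]mulrC -(mulrA (psi z)) mul_conjc z1 expr1n mulr1.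
Qed.

Lemma inner_argument psi : measurableT_fun psi -> aeT (fun z => normc (psi z) = 1) ->
  exists A : R -> R, [/\ measurable_fun setT (A : T -> T), forall t, 0 <= A t <= 2 * pi &
    {ae mu, forall t, D t -> psi (expi t) = expi (A t)}].
Proof.
move=> /measT_ReIm[[h mh hp] [k mk kp]] /aeT_itv p1.
exists (fun t => Arg (h t +i* k t)); split.
- exact: measurable_Arg.
- by move=> t; exact: Arg_itv.
- apply: ae_imp (ae_and (ae_and hp kp) p1) _ => t [[h1 h2] h3] tD.
  have E : h t +i* k t = psi (expi t) by rewrite -h1// -h2//; case: (psi _).
  by rewrite E ArgK// h3.
Qed.

Lemma inner_arg_pkern psi (A : R -> R) r s : bddH2 psi -> integralT psi = 0 ->
  aeT (fun z => normc (psi z) = 1) ->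
  {ae mu, forall t, D t -> psi (expi t) = expi (A t)} -> 0 <= r < 1 ->
  (\int[mu]_(t in D) (pkern r (A t - s))%:E)%E = (2 * pi)%:E.
Proof.
move=> hpsi p0 p1 hA r01; have [r0 r1] := andP r01.
pose w z := r%:C * expi (- s) * psi z.
rewrite -(@nint_poisson_mean R w r r01).
- apply: ge0_ae_eq_integral_gen => [t|t|]; rewrite ?lee_fin ?pkern_ge0//.
  apply: ae_imp hA _ => t hA tD; rewrite /w hA// -mulrA -expiD addrC.
  by rewrite poisson_pkern// ger0_norm// pkern_ge0.
- by apply: measTM; [exact: measT_cst|case: hpsi => _ []].
- apply: (aeT1 p1) => z _ pz; rewrite /w !normcM normc_expi pz !mulr1.
  by rewrite normcR ger0_norm.
- move=> j; under eq_fun do rewrite /w exprMn.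
  rewrite integralTZ ?inner_power_mean ?mulr0//.
  by apply: L2_L1; apply: Linfty_L2; apply: LinftyX; case: hpsi.
Qed.

Lemma ae_comp_arg (A : R -> R) (Q : R -> Prop) : measurable_fun setT (A : T -> T) ->
  (forall t, 0 <= A t <= 2 * pi) ->
  (forall B, measurable (B : set T) -> (mu (A @^-1` B `&` D) <= mu (B `&` D))%E) ->
  {ae mu, forall t, D t -> Q t} -> {ae mu, forall t, D t -> Q (A t)}.
Proof.
move=> mA A_itv hB [N [mN N0 hN]].
have mAN : measurable (A @^-1` N `&` D : set T).
  apply: measurableI; last exact: measurable_itv.
  by rewrite -[X in measurable X]setTI; exact: mA.
exists (A @^-1` N `&` D); split => //.
  apply/eqP; rewrite eq_le measure_ge0 andbT (le_trans (hB _ mN))//.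
  by rewrite -N0; apply: le_measure; rewrite ?inE//; apply: measurableI => //; exact: measurable_itv.
move=> t /= /not_implyP[tD nQ]; split => //; apply: hN => /= h; apply: nQ; apply: h.
by rewrite /= in_itv /=; exact: A_itv.
Qed.

(* The pushforward of the circle's measure under psi has the same Poisson integrals as
   the measure itself, by the mean value property of [poisson (w psi)]. *)
Lemma inner_contraction psi : bddH2 psi -> integralT psi = 0 ->
  aeT (fun z => normc (psi z) = 1) -> circle_contraction psi.
Proof.
move=> hpsi p0 p1; have mpsi : measurableT_fun psi by case: hpsi => _ [].
have [A [mA A_itv hA]] := inner_argument mpsi p1.
have A_pkern r s := inner_arg_pkern s hpsi p0 p1 hA (r := r).
have hB := arg_measure_le mA A_itv A_pkern.
have aeA (Q : R -> Prop) := @ae_comp_arg A Q mA A_itv hB.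
split=> // [P /aeT_itv/aeA h|u uL].
  by apply/aeT_itv; apply: ae_imp (ae_and h hA) _ => t [h1 h2] tD; rewrite h2//; exact: h1.
have [mu' _] := uL; have /measT_ReIm[[h mh /[dup] hu /aeA hu'] [k mk /[dup] ku /aeA ku']] := mu'.
have hp : {ae mu, forall t, D t -> complex.Re (u (psi (expi t))) = h (A t)}.
  by apply: ae_imp (ae_and hu' hA) _ => t [h1 h2] tD; rewrite h2//; exact: h1.
have kp : {ae mu, forall t, D t -> complex.Im (u (psi (expi t))) = k (A t)}.
  by apply: ae_imp (ae_and ku' hA) _ => t [h1 h2] tD; rewrite h2//; exact: h1.
apply: L2T_le.
  apply/measT_ReIm; split; [exists (h \o A)|exists (k \o A)] => //;
    exact: measurableT_comp.
have n2 z : normc z ^+ 2 = complex.Re z ^+ 2 + complex.Im z ^+ 2 :> R by exact: normc_sqr.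
rewrite -(nint_norm2sq uL) (nint_rep (h := fun t => h (A t) ^+ 2 + k (A t) ^+ 2)); last first.
  by apply: ae_imp (ae_and hp kp) _ => t [h1 h2] tD; rewrite n2 h1// h2.
rewrite (nint_rep (h := fun t => h t ^+ 2 + k t ^+ 2)); last first.
  by apply: ae_imp (ae_and hu ku) _ => t [h1 h2] tD; rewrite n2 h1// h2.
apply: (@ge0_le_integral_comp _ T R mu D A (fun x : T => (h x ^+ 2 + k x ^+ 2)%:E)) => //.
- by apply/measurable_EFinP; apply: measurable_funD; apply: measurable_funX.
- by move=> x; rewrite lee_fin addr_ge0 ?sqr_ge0.
Qed.

Lemma inner_mean0 Psi psi : inner_function Psi psi -> Psi 0 = 0 -> integralT psi = 0.
Proof.
move=> [hPsi hb _] P0; have h := hardy2_comp_integral (bounded_hardy2 hPsi) hb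
  (circle_contraction_id R) (Linfty_L2 (Linfty_cst (1 : R[i]))).
have := h _; under eq_fun do rewrite mulr1; rewrite P0 mul0r; apply=> j.
by under eq_fun do rewrite mulr1; exact: integralT_exp.
Qed.

Lemma inner_bddH2 Psi psi : inner_function Psi psi -> bddH2 psi.
Proof. by move=> [hPsi hb _]; apply: Hinfty_bddH2; exists Psi. Qed.

Lemma Linfty_comp u psi : Linfty u -> circle_contraction psi -> Linfty (fun z => u (psi z)).
Proof.
move=> uL [mpsi _ null contr]; have [[mu' _] _] := contr u (Linfty_L2 uL); split => //.
by have [_ [M hM]] := uL; exists M; exact: (null (fun z => normc (u z) <= M) hM).
Qed.
End InnerFunctions.

(** * Beurling's theorem *)

Section Projection.
Variable R : realType.
Local Notation pi := (@pi R).
Implicit Types (e r : R) (c : R[i]) (a b u v w p d phi psi theta : R[i] -> R[i])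
  (V W : set (R[i] -> R[i])).

(** Closure in L^2 for a bare set of representatives; [e] bounds the squared distance. *)
Definition L2_adherent V u := L2T u /\ forall e, 0 < e ->
  exists v, [/\ L2T v, V v & norm2sq (fun z => v z - u z) <= e].

Lemma adherent_integral0 V u w : L2_adherent V u -> L2T w ->
  (forall v, L2T v -> V v -> integralT (fun z => v z * w z) = 0) ->
  integralT (fun z => u z * w z) = 0.
Proof.
move=> [uL hu] wL h; apply/eqP; rewrite -normc_eq0 -sqrf_eq0 eq_le sqr_ge0 andbT.
have wJ := L2T_conj wL.
have dE v : integralT (fun z => v z * w z) = dotT v (fun z => (w z)^*).
  by congr integralT; apply/funext => z; rewrite [Num.conj _]conjcK.
apply/ler_addgt0Pl => e e0; rewrite addr0.
have n0 : 0 < norm2sq (fun z => (w z)^*) + 1 by rewrite ltr_wpDl ?norm2sq_ge0.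
have [v [vL Vv hv]] := hu _ (divr_gt0 e0 n0).
have -> : normc (integralT (fun z => u z * w z)) ^+ 2 =
    normc (dotT (fun z => v z - u z) (fun z => (w z)^*)) ^+ 2.
  by rewrite dotTBl// -!dE (h v)// sub0r normcN.
rewrite (le_trans (cauchy_schwarz (L2TB vL uL) wJ))//.
rewrite (le_trans (ler_wpM2r (norm2sq_ge0 _) hv))// mulrAC ler_pdivrMr//.
by rewrite ler_wpM2l ?(ltW e0)// lerDl.
Qed.

Lemma adherentM b V W u : Linfty b -> L2_adherent V u ->
  (forall v, L2T v -> V v -> W (fun z => b z * v z)) -> L2_adherent W (fun z => b z * u z).
Proof.
move=> bL [uL hu] VW; split; first exact: L2TM.
have [_ [M hM]] := bL.
have n0 : 0 < M ^+ 2 + 1 by rewrite ltr_wpDl ?sqr_ge0.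
move=> e e0; have [v [vL Vv hv]] := hu _ (divr_gt0 e0 n0).
exists (fun z => b z * v z); split; [exact: L2TM|exact: VW|].
have -> : (fun z => b z * v z - b z * u z) = (fun z => b z * (v z - u z)).
  by apply/funext => z; rewrite mulrBr.
have dL := L2TB vL uL.
apply: (@le_trans _ _ (M ^+ 2 * norm2sq (fun z => v z - u z))).
  have -> : M ^+ 2 = normc (M%:C) ^+ 2 by rewrite normcR real_normK ?num_real.
  rewrite -norm2sqZ//; apply: le_norm2sq => //; [exact: L2TM|exact: L2TZ|].
  apply: (aeT1 hM) => z _ h; rewrite !normcM ler_wpM2r// normcR.
  exact: le_trans h (ler_norm _).
rewrite (le_trans (ler_wpM2l (sqr_ge0 _) hv))// mulrA ler_pdivrMr// mulrC.
by rewrite ler_wpM2l ?(ltW e0)// lerDl.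
Qed.

Lemma adherentS V W u : L2_adherent V u -> (forall v, L2T v -> V v -> W v) ->
  L2_adherent W u.
Proof.
move=> [uL hu] VW; split=> // e /hu[v [vL Vv hv]].
by exists v; split => //; exact: VW.
Qed.

Lemma adherent_H2 u : L2_adherent (@H2 R) u -> H2 u.
Proof.
move=> hu; apply/H2P; split; first by case: hu.
move=> n; under eq_fun do rewrite mulrC.
apply: (adherent_integral0 hu); first by apply: Linfty_L2; exact: Linfty_exp.
by move=> v _ hv; exact: H2_coef0.
Qed.

Lemma parallelogram u v : L2T u -> L2T v ->
  norm2sq (fun z => u z + v z) + norm2sq (fun z => u z - v z) =
  2 * norm2sq u + 2 * norm2sq v.
Proof.
move=> uL vL; have := norm2sq_addZ 1 uL vL; have := norm2sq_addZ (-1) uL vL.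
under [X in norm2sq X]eq_fun do rewrite mulN1r; move=> ->.
under [X in norm2sq X]eq_fun do rewrite mul1r; move=> ->.
rewrite mul1r mulN1r normcN; have -> : normc (1 : R[i]) = 1.
  by rewrite -[1]/(1%:C) normcR normr1.
by case: (dotT v u) => x y /=; lra.
Qed.

(** Projection onto the closure of V without forming it: d is the L^2 limit of p - v_n along a
    minimizing sequence, and its orthogonality to V is inherited from the approximate orthogonality
    of the p - v_n. *)
Lemma projection V p : V (fun=> 0) ->
  (forall v w, V v -> V w -> V (fun z => v z + w z)) ->
  (forall c v, V v -> V (fun z => c * v z)) -> (forall v, V v -> L2T v) -> L2T p ->
  exists d, L2_adherent [set u | exists2 v, V v & u = fun z => p z - v z] d /\
    forall v, V v -> dotT d v = 0.
Proof.
move=> V0 VD VZ VL pL.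
pose S := [set norm2sq (fun z => p z - v z) | v in V].
have Slb : has_inf S.
  by split; [exists (norm2sq (fun z => p z - 0)); exists (fun=> 0)|
    exists 0 => _ [v _ <-]; exact: norm2sq_ge0].
pose m := inf S.
have hm v : V v -> m <= norm2sq (fun z => p z - v z).
  by move=> Vv; apply: ge_inf; [case: Slb|exists v].
(* With x = 8^-n, the parallelogram law gives increments of squared norm at most 2 (x / 32) + 2 (x /
   4) = 9 x / 16, within the rate x that [L2_complete] asks for. *)
have dn0 n : 0 < 8^-1 ^+ n / 4 :> R by rewrite divr_gt0// exprn_gt0// invr_gt0.
have /choice[v_ hv_] : forall n, exists v, V v /\ norm2sq (fun z => p z - v z) < m + 8^-1 ^+ n / 4.
  by move=> n; have [_ [v Vv <-] hv] := inf_adherent (dn0 n) Slb; exists v.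
pose u_ n z := p z - v_ n z.
have uL n : L2T (u_ n) by apply: L2TB => //; apply: VL; case: (hv_ n).
have hun n : norm2sq (u_ n) < m + 8^-1 ^+ n / 4 by case: (hv_ n).
have [|d dL hd] := L2_complete uL.
  move=> n; have := parallelogram (uL n.+1) (uL n).
  have : 4 * m <= norm2sq (fun z => u_ n.+1 z + u_ n z).
    pose h z := 2^-1 * (v_ n.+1 z + v_ n z).
    have Vh : V h by apply: VZ; apply: VD; [case: (hv_ n.+1)|case: (hv_ n)].
    have -> : (fun z => u_ n.+1 z + u_ n z) = (fun z => 2%:R%:C * (p z - h z)).
      apply/funext => z; rewrite /u_ /h rmorph_nat mulrBr mulrA mulfV ?pnatr_eq0// mul1r.
      by rewrite mulr_natl mulr2n; ring.
    rewrite norm2sqZ; last by apply: L2TB => //; exact: VL.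
    rewrite normcR real_normK ?num_real// -natrX.
    by apply: ler_wpM2l => //; exact: hm.
  have := hun n; have := hun n.+1; rewrite exprS.
  set x := 8^-1 ^+ n => h1 h2 h3 h4; have x0 : 0 <= x by rewrite exprn_ge0// invr_ge0.
  set A := norm2sq (fun z => _ + _) in h3 h4; set B := norm2sq _ in h4 *; lra.
exists d; split.
  split=> // e e0.
  have c : (4 * 8^-1 ^+ n : R) @[n --> \oo] --> (0 : R).
    rewrite -(mulr0 4); apply: cvgM; first exact: cvg_cst.
    apply: cvg_expr; rewrite ger0_norm ?invr_ge0// invf_lt1//.
    by rewrite ltr1n.
  have /cvgrPdist_le/(_ e e0)[n _ /(_ n (leqnn n)) /=] := c.
  rewrite sub0r normrN => /(le_trans (ler_norm _)) hn.
  exists (u_ n); split => //; first by exists (v_ n) => //; case: (hv_ n).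
  exact: le_trans (hd n) hn.
move=> v Vv; have vL := VL v Vv.
apply/eqP; rewrite -normc_eq0 -sqrf_eq0 eq_le sqr_ge0 andbT.
(* Moving u_n along v to the optimal point lowers the squared norm by |<u_n, v>|^2 / |v|^2, and it
   cannot fall below m. *)
have key n : normc (dotT (u_ n) v) ^+ 2 <= 8^-1 ^+ n / 4 * norm2sq v.
  have [v0|v0] := eqVneq (norm2sq v) 0.
    by rewrite v0 mulr0 (le_trans (cauchy_schwarz (uL n) vL))// v0 mulr0.
  have vp : 0 < norm2sq v by rewrite lt_def v0 norm2sq_ge0.
  pose c := - (dotT (u_ n) v / (norm2sq v)%:C).
  have : m <= norm2sq (fun z => u_ n z + c * v z).
    have -> : (fun z => u_ n z + c * v z) = (fun z => p z - (v_ n z + - c * v z)).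
      by apply/funext => z; rewrite /u_ mulNr opprD opprK addrA.
    by apply: hm; apply: VD; [case: (hv_ n)|exact: VZ].
  rewrite norm2sq_addZ// (dotTC (uL n) vL); have := hun n.
  rewrite /c; set x := dotT (u_ n) v; set N := norm2sq v in v0 vp *.
  have -> : - (x / N%:C) * x^* = (- (normc x ^+ 2 / N))%:C.
    by rewrite mulNr mulrAC mul_conjc -fmorphV -rmorphM -rmorphN.
  rewrite -[complex.Re _%:C]/(- (normc x ^+ 2 / N)).
  rewrite normcN normcM -fmorphV normcR exprMn real_normK ?num_real//.
  rewrite -ler_pdivrMr//; set y := normc x ^+ 2.
  have -> : y * N^-1 ^+ 2 * N = y / N by field.
  by set q := y / N; set E := _ / 4; lra.
(* The constant 9 covers 2 (4) + 2 (1 / 4), from the distance of d to u_n and from [key]. *)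
apply: (@le0_of_le_geometric _ _ (9 * norm2sq v) 8^-1).
  by rewrite invr_ge0 invf_lt1 ?ltr1n// ler0n.
move=> n; have := key n.
have := cauchy_schwarz (L2TB dL (uL n)) vL; rewrite dotTBl//.
have : norm2sq (fun z => d z - u_ n z) <= 4 * 8^-1 ^+ n.
  rewrite (le_trans _ (hd n))// le_eqVlt; apply/orP; left; apply/eqP.
  by apply: norm2sq_eq; apply: aeTW => z _; rewrite -normcN opprB.
have := sqr_normcD (dotT d v - dotT (u_ n) v) (dotT (u_ n) v); rewrite subrK.
set x := 8^-1 ^+ n => h1 h2 h3 h4; have x0 : 0 <= x by rewrite exprn_ge0// invr_ge0.
have v0 := norm2sq_ge0 v; have := ler_wpM2r v0 h2.
have := mulr_ge0 x0 v0.
set A := norm2sq (fun z => d z - _) in h3 *; set N := norm2sq v in h3 h4 *.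
move: h1 h3 h4; set X := normc (dotT d v) ^+ 2; set Y := normc (_ - _) ^+ 2.
set Z := normc _ ^+ 2; rewrite [x / 4 * N]mulrAC [9 * N * x]mulrAC -[9 * x * N]mulrA -[4 * x * N]mulrA.
set XN := x * N; set AN := A * N.
lra.
Qed.
End Projection.

Section Beurling.
Variable R : realType.
Implicit Types (e r : R) (c : R[i]) (a b k u v w p d phi psi theta : R[i] -> R[i])
  (V W : set (R[i] -> R[i])).

(** Division by z^j, possible when the first j Taylor coefficients vanish; each single division is a
    shift of coefficients. *)
Lemma H2_mulJX p j : H2 p -> (forall i, (i < j)%N -> integralT (fun z => z^* ^+ i * p z) = 0) ->
  H2 (fun z => z^* ^+ j * p z).
Proof.
elim: j => [|j IH] hp h; first by under eq_fun do rewrite expr0 mul1r.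
have /H2P[qL hq] := IH hp (fun i ij => h i (ltnW ij)).
apply/H2P; split.
  under eq_fun do rewrite exprS -mulrA.
  by apply: L2TM qL; apply: Linfty_conj; exact: Linfty_id.
move=> n; rewrite (@integralT_eq _ _ (fun z => z ^+ n * (z^* ^+ j * p z))); last first.
  apply: aeTW => z z1; rewrite [z ^+ n.+1]exprSr [z^* ^+ _]exprS.
  by rewrite mulrA -[_ * z * _]mulrA [z * _]mulrA mul_conjc z1 expr1n mul1r mulrA.
case: n => [|n]; last exact: hq.
by under eq_fun do rewrite expr0 mul1r; exact: h.
Qed.

Lemma H2_eq0 p : H2 p -> (forall j, integralT (fun z => z^* ^+ j * p z) = 0) -> eqT p (fun=> 0).
Proof.
move=> /H2P[pL hp] h; have := eq_cst_of_coef0 (L2_L1 pL) hp (fun n => h n.+1).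
by have := h 0%N; under eq_fun do rewrite expr0 mul1r; move=> ->.
Qed.

Definition bdd_mul p := [set u | exists2 a, bddH2 a & u = (fun z => p z * a z)].

Lemma integralT_conj_eq0 u : L1T u -> integralT (fun z => (u z)^*) = 0 -> integralT u = 0.
Proof. by move=> uL; rewrite integralT_conj// => /(congr1 (@conjc R)); rewrite conjcK rmorph0. Qed.

(** The function theta is the normalized d = p minus its projection onto the closure of z p H^oo.
    Orthogonality of d to every z^(n+1) d makes |d|^2 constant, and orthogonality to every z^(n+1) p
    puts conj(d) p in H^2. *)
Lemma beurling p : H2 p -> ~ eqT p (fun=> 0) -> exists theta,
  [/\ Linfty theta, aeT (fun z => normc (theta z) = 1), H2 (fun z => (theta z)^* * p z) &
    L2_adherent (bdd_mul p) theta].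
Proof.
move=> hp p0; have [pL _] := (proj1 (H2P p)) hp.
have H2pM a : bddH2 a -> H2 (fun z => p z * a z).
  by move=> ha; under eq_fun do rewrite mulrC; exact: H2M.
have bX := bddH2_exp R 1.
pose V := [set u | exists2 a, bddH2 a & u = (fun z => p z * (z * a z))].
have VL v : V v -> L2T v.
  move=> [a ha ->]; apply: H2_L2; apply: H2pM.
  by have := bddH2M bX ha; under eq_fun do rewrite expr1.
have [| | |//|//|d [hd dV]] := @projection R V p.
- by exists (fun=> 0); [exact: bddH2_cst|apply/funext => z; rewrite !mulr0].
- move=> _ _ [a ha ->] [b hb ->]; exists (fun z => a z + b z); first exact: bddH2D.
  by apply/funext => z; rewrite !mulrDr.
- move=> c _ [a ha ->]; exists (fun z => c * a z); first exact: bddH2M (bddH2_cst c) ha.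
  by apply/funext => z; ring.
have [dL _] := hd.
have dp : L2_adherent (bdd_mul p) d.
  apply: (adherentS hd) => _ _ [_ [a ha ->] ->].
  exists (fun z => 1 + - 1 * (z ^+ 1 * a z)).
    exact: bddH2D (bddH2_cst 1) (bddH2M (bddH2_cst (- 1)) (bddH2M bX ha)).
  by apply/funext => z; ring.
have dH2 : H2 d by apply: adherent_H2; apply: (adherentS dp) => _ _ [a ha ->]; exact: H2pM.
(* If d were 0, then p would be a limit of elements p z a. Once the coefficients of p below j
   vanish, p / z^j is in H^2 and each p z a has j-th coefficient 0; hence so has p, and by induction
   p = 0. *)
have d0 : ~ eqT d (fun=> 0).
  move=> d0; apply: p0; apply: H2_eq0 => // j.
  elim/ltn_ind: j => j IH; have hq := H2_mulJX hp IH.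
  suff h : integralT (fun z => (p z - d z) * z^* ^+ j) = 0.
    by rewrite -[RHS]h; apply: integralT_eq; apply: (aeT1 d0) => z _ ->; rewrite subr0 mulrC.
  have jL : Linfty (fun z : R[i] => z^* ^+ j) by apply: LinftyX; apply: Linfty_conj; exact: Linfty_id.
  apply: (@adherent_integral0 _ V); [|exact: Linfty_L2|].
  - split; first exact: L2TB.
    move=> e /(proj2 hd)[_ [_ [v Vv ->] hv]]; exists v; split; [exact: VL|by []|].
    rewrite (le_trans _ hv)// le_eqVlt; apply/orP; left; apply/eqP.
    apply: norm2sq_eq; apply: aeTW => z _; rewrite -normcN; congr normc; ring.
  - move=> _ _ [a [ha _] ->]; rewrite -[RHS](integralT_H2M hq ha).
    by congr integralT; apply/funext => z; ring.
(* Since d is a limit of elements p a, and every z^(n+1) p a lies in V, d is orthogonal to z^(n+1)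
   d. *)
have dd n : integralT (fun z => z^* ^+ n.+1 * (d z * (d z)^*)) = 0.
  have L : L2T (fun z => z^* ^+ n.+1 * d z).
    by apply: L2TM dL; apply: LinftyX; apply: Linfty_conj; exact: Linfty_id.
  apply: integralT_conj_eq0.
    under eq_fun do rewrite mulrA; apply: L2M_L1 => //; exact: L2T_conj.
  rewrite -[RHS](@adherent_integral0 _ (bdd_mul p) d (fun z => z ^+ n.+1 * (d z)^*) dp).
  - congr integralT; apply/funext => z; rewrite !rmorphM rmorphXn /= !conjcK.
    by rewrite [_^* * d z]mulrC mulrCA.
  - by apply: L2TM; [exact: Linfty_exp|exact: L2T_conj].
  move=> v vL [a ha vE]; rewrite vE.
  have Va : V (fun z => z ^+ n.+1 * (p z * a z)).
    exists (fun z => z ^+ n * a z); first exact: bddH2M (bddH2_exp R n) ha.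
    by apply/funext => z; rewrite exprS; ring.
  have := dV _ Va; rewrite (dotTC (VL _ Va) dL) => /(congr1 (@conjc R)).
  rewrite conjcK rmorph0 => h; rewrite -[RHS]h.
  by congr integralT; apply/funext => z; rewrite mulrCA mulrA.
have ddL : L1T (fun z => d z * (d z)^*) by apply: L2M_L1 => //; exact: L2T_conj.
have ddc := @eq_cst_of_coef0 _ _ ddL _ dd.
have {}ddc : aeT (fun z => normc (d z) ^+ 2 = norm2sq d).
  have : eqT (fun z => d z * (d z)^*) (fun=> integralT (fun z => d z * (d z)^*)).
    apply: ddc => n; apply: integralT_conj_eq0; first exact: X_L1.
    rewrite -[RHS](dd n); congr integralT; apply/funext => z.
    by rewrite !rmorphM rmorphXn /= conjcK [d z * _]mulrC.
  rewrite integralT_mulconj// => h; apply: (aeT1 h) => z _.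
  by rewrite mul_conjc => -[].
have n0 : norm2sq d != 0 by apply/eqP => /(norm2sq_eq0 dL).
pose s := Num.sqrt (norm2sq d).
(* The constant value of |d|^2 is its mean, so dividing by the norm s makes d unimodular. *)
have s2 : s ^+ 2 = norm2sq d by rewrite sqr_sqrtr ?norm2sq_ge0.
have s0 : 0 < s by rewrite sqrtr_gt0 lt_def n0 norm2sq_ge0.
have mth : measurableT_fun (fun z => (s^-1)%:C * d z).
  by apply: measTM; [exact: measT_cst|case: dL].
have th1 : aeT (fun z => normc ((s^-1)%:C * d z) = 1).
  apply: (aeT1 ddc) => z _ h; have {}h : normc (d z) = s.
    by apply/eqP; rewrite -(eqrXn2 (n := 2))// ?h ?s2// ltW.
  by rewrite normcM normcR ger0_norm ?invr_ge0 ?ltW// h mulVf// gt_eqF.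
exists (fun z => (s^-1)%:C * d z); split; [|exact: th1| |].
- by split; [exact: mth|]; exists 1; apply: (aeT1 th1) => z _ ->.
- apply: (@H2_eq _ (fun z => (s^-1)%:C * ((d z)^* * p z))).
    by apply: aeTW => z _; rewrite conjcM conjc_real mulrA.
  apply: H2Z; have dJ : aeT (fun z => normc (d z) <= s).
    apply: (aeT1 ddc) => z _ h; rewrite -(@ler_pXn2r _ 2) ?nnegrE ?h ?s2// ltW//.
  have dJL : Linfty (fun z => (d z)^*).
    by apply: Linfty_conj; split; [case: dL|exists s].
  apply/H2P; split; first exact: L2TM.
  move=> n; have Vn : V (fun z => z ^+ n.+1 * p z).
    exists (fun z => z ^+ n); first exact: bddH2_exp.
    by apply/funext => z; rewrite exprS; ring.
  have := dV _ Vn; rewrite (dotTC (VL _ Vn) dL) => /(congr1 (@conjc R)).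
  rewrite conjcK rmorph0 => h; rewrite -[RHS]h.
  by congr integralT; apply/funext => z; rewrite mulrCA mulrC.
- apply: (adherentM (Linfty_cst _) dp) => _ _ [a ha ->].
  exists (fun z => (s^-1)%:C * a z); first exact: bddH2M (bddH2_cst _) ha.
  by apply/funext => z; ring.
Qed.

(** The unimodular theta given by Beurling's theorem is approximated by multiples of k, which vanish
    wherever k does; so the zero set of k has measure below every e. *)
Lemma H2_neq0 k : H2 k -> ~ eqT k (fun=> 0) -> aeT (fun z => k z <> 0).
Proof.
move=> hk k0; have [theta [_ th1 _ [thL hth]]] := beurling hk k0.
have [[mk _] _] := (proj1 (H2P k)) hk.
pose i (z : R[i]) : R[i] := (\1_[set (0 : R)] (normc (k z)))%:C.
have iL : Linfty i.
  split.
    apply/measT_ReIm; split; last exact: measTr_cst.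
    apply: (@measTr_op _ (\1_[set (0 : R)])); last exact: measTr_normc.
    exact: measurable_indic.
  exists 1; apply: aeTW => z _; rewrite /i normcR indicE; case: (_ \in _); rewrite ?normr0 ?normr1//.
have iL2 := Linfty_L2 iL.
have : eqT i (fun=> 0).
  apply: norm2sq_eq0 => //; apply/eqP; rewrite eq_le norm2sq_ge0 andbT.
  apply/ler_addgt0Pl => e e0; rewrite addr0.
  have [v [vL [a ha vE] hv]] := hth e e0; rewrite vE in vL hv.
  apply: (le_trans _ hv); apply: le_norm2sq => //.
    exact: L2TB.
  apply: (aeT1 th1) => z _ t1; rewrite /i normcR indicE.
  case: (boolP (_ \in _)) => [/set_mem /= /eqP|_]; last by rewrite normr0.
  by rewrite normc_eq0 => /eqP ->; rewrite mul0r sub0r normcN t1 normr1.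
move=> h; apply: (aeT1 h) => z _; rewrite /i indicE => -[h0] kz.
move: h0; rewrite mem_set /=; first by move/eqP; rewrite oner_eq0.
by apply/eqP; rewrite normc_eq0 kz.
Qed.
End Beurling.

(** * Toeplitz kernels *)

Section ToeplitzKernels.
Variable R : realType.
Implicit Types (e r : R) (c : R[i]) (a b f g h k u v w p d psi theta : R[i] -> R[i])
  (V W : set (R[i] -> R[i])).

(** Testing T_g f = 0 against z^n gives the coefficients of q = conj(z g f). Conversely the inner
    product of g f with b in H^2 is the conjugate of the mean of z q b, which is 0. *)
Lemma ker_toeplitzP g f : Linfty g ->
  ker_toeplitz g f <-> H2 f /\ H2 (fun z => (z * (g z * f z))^*).
Proof.
move=> gL; split=> [[hf [_ hg]]|[hf hq]]; (split; first exact: hf).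
  have fL := H2_L2 hf; have gfL := L2TM gL fL.
  have qL : L2T (fun z => (z * (g z * f z))^*).
    by apply: L2T_conj; exact: (L2TM (Linfty_id R) gfL).
  apply/H2P; split; first exact: qL.
  move=> n.
  rewrite (@integralT_eq _ _ (fun z => z ^+ n * (g z * f z)^*)); last first.
    apply: aeTW => z z1; rewrite conjcM exprSr -mulrA; congr (_ * _).
    by rewrite mulrA mul_conjc z1 expr1n mul1r.
  apply: integralT_conj_eq0.
    by apply: X_L1; apply: L2_L1; exact: L2T_conj.
  have := hg _ (H2_exp R n); rewrite /dotT => h; rewrite -[RHS]h.
  by congr integralT; apply/funext => z; rewrite [LHS]conjcM conjcK subr0 mulrC.
split; first exact: H2_cst.
move=> b hb; have fL := H2_L2 hf; have gfL := L2TM gL fL; have bL := H2_L2 hb.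
rewrite /dotT; under eq_fun do rewrite subr0.
apply: integralT_conj_eq0; first exact: L2M_L1 gfL (L2T_conj bL).
rewrite -[RHS](integralT_H2M hq hb); apply: integralT_eq; apply: aeTW => z z1.
rewrite [LHS]conjcM conjcK [in RHS]conjcM !mulrA mul_conjc z1 expr1n mul1r.
by rewrite conjcM.
Qed.

(** The mean is evaluation at the origin, hence multiplicative: b minus its mean is divisible by
    z. *)
Lemma integralT_bddH2M b u : bddH2 b -> H2 u ->
  integralT (fun z => b z * u z) = integralT b * integralT u.
Proof.
move=> hb hu; have bL1 := L2_L1 (H2_L2 (proj1 hb)); have uL := L2_L1 (H2_L2 hu).
pose c := integralT b.
have hbc : bddH2 (fun z => b z + - c) by exact: bddH2D hb (bddH2_cst (- c)).
have bc0 : integralT (fun z => b z + - c) = 0.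
  by rewrite integralTB ?integralT_cst ?subrr//; apply: L2_L1; apply: H2_L2; exact: H2_cst.
have [hq _] := bddH2_divX hbc bc0.
have h : integralT (fun z => (b z + - c) * u z) = 0.
  rewrite -[RHS](integralT_H2M hq hu); apply: integralT_eq; apply: aeTW => z z1.
  by rewrite -(mulrA _ z^* (u z)) [RHS]mulrCA [z * (_ * _)]mulrA mul_conjc z1 expr1n mul1r.
rewrite -[LHS]subr0 -[X in _ - X]h -integralTB.
- rewrite -(integralTZ c uL); congr integralT; apply/funext => z.
  by rewrite mulrDl opprD addrA subrr sub0r mulNr opprK.
- by apply: L1TM uL; case: hb.
- by apply: L1TM uL; case: hbc.
Qed.

Lemma adherent_eq V u w : eqT u w -> L2_adherent V u -> L2_adherent V w.
Proof.
move=> uw [uL hu]; split; first exact: L2T_eq uL.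
move=> e /hu[v [vL Vv hv]]; exists v; split=> //.
rewrite (le_trans _ hv)// le_eqVlt; apply/orP; left; apply/eqP.
by apply: norm2sq_eq; apply: (aeT1 uw) => z _ ->.
Qed.

Definition cyclic p := L2_adherent (bdd_mul p) (fun=> 1).

Lemma normc_integralT_sqr u : L2T u -> normc (integralT u) ^+ 2 <= norm2sq u.
Proof.
move=> uL; have L1 := Linfty_L2 (Linfty_cst (1 : R[i])).
have := cauchy_schwarz uL L1.
have -> : norm2sq (fun=> 1 : R[i]) = 1.
  apply: (@complexI R); rewrite -integralT_mulconj// -[RHS](integralT_cst (1%:C : R[i])).
  by congr integralT; apply/funext => z; rewrite mul1r rmorph1.
rewrite mulr1 (_ : dotT u _ = integralT u)//.
by congr integralT; apply/funext => z; rewrite rmorph1 mulr1.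
Qed.

Lemma norm2sq_unimod u : L2T u -> aeT (fun z => normc (u z) = 1) -> norm2sq u = 1.
Proof.
move=> uL u1; apply: (@complexI R); rewrite -integralT_mulconj//.
rewrite -[RHS](integralT_cst (1%:C : R[i])); apply: integralT_eq.
by apply: (aeT1 u1) => z _ h; rewrite mul_conjc h expr1n.
Qed.

(* If |int theta| < 1, dividing infinitely often by theta kills every Fourier coefficient. *)
Lemma inner_divisible_cst theta p : bddH2 theta -> aeT (fun z => normc (theta z) = 1) ->
  (forall n, H2 (fun z => (theta z)^* ^+ n * p z)) -> ~ eqT p (fun=> 0) ->
  eqT theta (fun=> integralT theta) /\ normc (integralT theta) = 1.
Proof.
move=> hth th1 hP p0; have thL := H2_L2 (proj1 hth).
have hp : H2 p by have := hP 0%N; under eq_fun do rewrite expr0 mul1r.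
have L1 := Linfty_L2 (Linfty_cst (1 : R[i])).
set c := integralT theta.
have c1 : normc c ^+ 2 <= 1 by rewrite -(norm2sq_unimod thL th1) normc_integralT_sqr.
have [cE|cN] := eqVneq (normc c) 1.
  (* The squared distance from theta to its mean c is 1 - |c|^2. *)
  split=> //; have : norm2sq (fun z => theta z + - c * 1) = 0.
    rewrite norm2sq_addZ// normcN cE expr1n mul1r !norm2sq_unimod//; last first.
      by apply: aeTW => z _; rewrite -[1]/(1%:C) normcR normr1.
    rewrite (dotTC thL L1) (_ : dotT theta _ = c); last first.
      by congr integralT; apply/funext => z; rewrite rmorph1 mulr1.
    rewrite mulNr mul_conjc cE expr1n /=; lra.
  move=> /norm2sq_eq0 -/(_ _) h.
  have {}h := h (L2TD thL (L2TZ (- c) L1)); apply: (aeT1 h) => z _.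
  by rewrite mulr1 => /eqP; rewrite subr_eq0 => /eqP.
exfalso; apply: p0.
have clt : 0 <= normc c ^+ 2 < 1.
  rewrite sqr_ge0 lt_neqAle c1 andbT sqrf_eq1 negb_or cN andTb.
  by apply/eqP => h; have := normc_ge0 c; rewrite h ler0N1.
pose P n z := (theta z)^* ^+ n * p z.
have nP n : norm2sq (P n) = norm2sq p.
  apply: norm2sq_eq; apply: (aeT1 th1) => z _ h.
  by rewrite normcM normcX normc_conj h expr1n mul1r.
suff main j n : integralT (fun z => z^* ^+ j * P n z) = 0.
  apply: H2_eq0 => // j; rewrite -[RHS](main j 0%N); congr integralT; apply/funext => z.
  by rewrite /P expr0 mul1r.
elim/ltn_ind: j n => j IH n0.
have hQ n : H2 (fun z => z^* ^+ j * P n z).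
  by apply: H2_mulJX; [exact: hP|move=> i ij; exact: IH].
(* Here P n = theta (P n.+1). By the induction hypothesis both sides may be divided by z^j, and the
   j-th coefficient becomes an evaluation at the origin, so it is multiplicative. *)
have rec n : integralT (fun z => z^* ^+ j * P n z) =
    c * integralT (fun z => z^* ^+ j * P n.+1 z).
  rewrite -(integralT_bddH2M hth (hQ n.+1)); apply: integralT_eq; apply: (aeT1 th1) => z _ h.
  by rewrite /P exprS [RHS]mulrCA -(mulrA (theta z)^*) (mulrA (theta z)) mul_conjc h expr1n mul1r.
have rec' m : integralT (fun z => z^* ^+ j * P n0 z) =
    c ^+ m * integralT (fun z => z^* ^+ j * P (n0 + m)%N z).
  elim: m => [|m ->]; first by rewrite expr0 mul1r addn0.
  by rewrite rec addnS exprSr mulrA.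
apply/eqP; rewrite -normc_eq0 -sqrf_eq0 eq_le sqr_ge0 andbT.
apply: (le0_of_le_geometric (C := norm2sq p) clt) => m.
rewrite (rec' m) normcM normcX exprMn exprAC mulrC ler_wpM2r ?exprn_ge0 ?sqr_ge0//.
rewrite (le_trans (normc_integralT_sqr (H2_L2 (hQ _))))// -(nP (n0 + m)%N).
rewrite le_eqVlt; apply/orP; left; apply/eqP; apply: norm2sq_eq; apply: aeTW => z z1.
by rewrite normcM normcX normc_conj z1 expr1n mul1r.
Qed.

Lemma maximal_cyclic g k : ~ eqT g (fun=> 0) -> maximal_vector g k ->
  exists2 p, H2 p /\ eqT p (fun z => (z * (g z * k z))^*) & cyclic p.
Proof.
move=> g0 [gL hk k0 [[f0 [f0L kerE kf0]] kmin]].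
have kg : ker_toeplitz g k by rewrite kerE.
have [_ hp] := (proj1 (ker_toeplitzP k gL)) kg.
set p := fun z => _ in hp; exists p; first by split; [exact: hp|exact: eqT_refl].
(* As k is nonzero almost everywhere, p = 0 would force g = 0. *)
have p0 : ~ eqT p (fun=> 0).
  move=> p0; apply: g0; apply: (aeT2 p0 (H2_neq0 hk k0)) => z z1.
  move=> /(congr1 (@conjc R)); rewrite /p conjcK rmorph0 => /eqP.
  rewrite !mulf_eq0 => /orP[/eqP zE|/orP[/eqP//|/eqP kz /(_ kz)//]].
  by move: z1; rewrite zE normc0 => /eqP; rewrite eq_sym oner_eq0.
have [theta [thL th1 thp thad]] := beurling hp p0.
have hth : bddH2 theta.
  split; last exact: thL.
  apply: adherent_H2; apply: (adherentS thad) => _ _ [a ha ->].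
  by under eq_fun do rewrite mulrC; exact: H2M.
have gthL : Linfty (fun z => g z * theta z) by exact: LinftyM.
(* Minimality is applied to the symbol g theta, whose kernel contains k because conj(theta) p is in
   H^2. *)
have step f : ker_toeplitz g f -> ker_toeplitz g (fun z => theta z * f z).
  move=> hf; have kth : ker_toeplitz (fun z => g z * theta z) k.
    apply/ker_toeplitzP; first exact: gthL.
    split; first exact: hk.
    apply: H2_eq thp; apply: aeTW => z _.
    by rewrite /p -conjcM; congr (_^*); ring.
  have /ker_toeplitzP[//|fH2 h] := kmin _ gthL kth f hf.
  apply/ker_toeplitzP; first exact: gL.
  split; first exact: H2M.
  by under eq_fun do rewrite [g _ * _]mulrA.
have pow n : ker_toeplitz g (fun z => theta z ^+ n * k z).
  elim: n => [|n IH]; first by under eq_fun do rewrite expr0 mul1r.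
  by under eq_fun do rewrite exprS -mulrA; exact: step.
have hP n : H2 (fun z => (theta z)^* ^+ n * p z).
  have /ker_toeplitzP[//|_ h] := pow n.
  apply: H2_eq h; apply: aeTW => z _.
  by rewrite -conjcX /p -conjcM; congr (_^*); ring.
have [thc c1] := inner_divisible_cst hth th1 hP p0.
(* Multiplying by the conjugate of the unimodular constant turns adherence of theta into adherence
   of 1. *)
have := adherentM (W := bdd_mul p) (Linfty_cst (integralT theta)^*) thad.
move=> /(_ _)/adherent_eq; apply.
  by apply: (aeT1 thc) => z _ ->; rewrite mulrC mul_conjc c1 expr1n.
move=> _ _ [a ha ->]; exists (fun z => (integralT theta)^* * a z).
  exact: bddH2M (bddH2_cst _) ha.
by apply/funext => z; ring.
Qed.

Lemma cyclic_maximal G kappa P : Linfty G -> H2 kappa -> H2 P -> cyclic P ->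
  eqT (fun z => G z * kappa z) (fun z => (z * P z)^*) -> maximal_vector G kappa.
Proof.
move=> GL hk hP [_ cP] GkE.
have kG : ker_toeplitz G kappa.
  apply/ker_toeplitzP; first exact: GL.
  split; first exact: hk.
  apply: H2_eq hP; apply: (aeT1 GkE) => z z1 ->.
  by rewrite !conjcM !conjcK mulrA [z^* * z]mulrC mul_conjc z1 expr1n mul1r.
split; [exact: GL|exact: hk| |].
  (* If kappa were 0, then P would be 0 too, and every multiple of P would be at squared distance 1
     from the constant 1, above 1/2. *)
  move=> k0; have [v [vL [a ha vE] hv]] := cP 2^-1 ltac:(by rewrite invr_gt0).
  have : norm2sq (fun z => v z - 1) = 1.
    rewrite -[RHS](norm2sq_unimod (u := fun=> 1)); last first.
    - by apply: aeTW => z _; rewrite -[1]/(1%:C) normcR normr1.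
    - exact: Linfty_L2 (Linfty_cst (1 : R[i])).
    apply: norm2sq_eq; apply: (aeT2 GkE k0) => z z1; rewrite vE => + kz.
    rewrite kz mulr0 => /(congr1 (@conjc R)); rewrite rmorph0 conjcK => /esym/eqP.
    rewrite mulf_eq0 => /orP[/eqP zE|/eqP ->].
      by move: z1; rewrite zE normc0 => /eqP; rewrite eq_sym oner_eq0.
    by rewrite mul0r sub0r normcN.
  by move=> h; move: hv; rewrite h; lra.
split; first by exists G.
move=> h hL /ker_toeplitzP[//|_ hQ] f /ker_toeplitzP[//|hf hF].
apply/ker_toeplitzP; first exact: hL.
split; first exact: hf.
have SL : L2T (fun z => (z * (h z * f z))^*).
  apply: L2T_conj; apply: (L2TM (Linfty_id R)); apply: (L2TM hL); exact: H2_L2.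
apply: H2_of_coef0; first exact: SL.
move=> n.
have wL := L2TM (Linfty_exp R n.+1) SL.
rewrite -[RHS](@adherent_integral0 _ (bdd_mul P) (fun=> 1) _ _ wL) => [||v vL [a ha vE]].
- by congr integralT; apply/funext => z; rewrite mul1r.
- split; [exact: Linfty_L2 (Linfty_cst (1 : R[i]))|exact: cP].
have hE : bddH2 (fun z => z ^+ n * a z) by exact: bddH2M (bddH2_exp R n) ha.
(* The integrand z^(n+1) conj(z h f) P a is z times the product of conj(z h kappa) and z^n a conj(z
   G f), both in H^2. *)
rewrite -[RHS](integralT_H2M hQ (H2M hE hF)); apply: integralT_eq.
apply: (aeT1 GkE) => z z1 /(congr1 (@conjc R)); rewrite conjcK => E.
rewrite vE exprS.
have zz : z * z^* = 1 by rewrite mul_conjc z1 expr1n.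
have {}E : P z = z^* * (G z * kappa z)^* by rewrite E mulrA [z^* * z]mulrC zz mul1r.
by rewrite E !conjcM; ring.
Qed.
End ToeplitzKernels.

(** * Cyclic vectors under composition with psi *)

Section InnerComposition.
Variable R : realType.
Implicit Types (e r : R) (c : R[i]) (a b f g h k u v w p d psi theta : R[i] -> R[i]).

(** If p a is close to 1, take the multiplier b' (a o psi): its product with b (p o psi) is (p a) o
    psi, whose distance to 1 is not larger, since composition with psi contracts L^2. *)
Lemma cyclic_comp p psi b b' : H2 p -> cyclic p -> circle_contraction psi -> bddH2 psi ->
  bddH2 b -> bddH2 b' -> eqT (fun z => b z * b' z) (fun=> 1) ->
  cyclic (fun z => b z * p (psi z)).
Proof.
move=> hp [_ cp] hc hpsi hb hb' bb; have [_ _ null contr] := hc.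
split; first exact: Linfty_L2 (Linfty_cst (1 : R[i])).
move=> e /cp[v [vL [a ha vE] hv]]; pose a' z := b' z * a (psi z).
have ha' : bddH2 a' by exact: bddH2M hb' (bddH2_comp ha hc hpsi).
have h2 : H2 (fun z => a' z * (b z * p (psi z))).
  exact: H2M ha' (H2M hb (H2_comp hp hc hpsi)).
exists (fun z => b z * p (psi z) * a' z); split.
- by under eq_fun do rewrite mulrC; exact: H2_L2.
- by exists a'.
have wL : L2T (fun z => v z - 1) by exact: L2TB vL (Linfty_L2 (Linfty_cst (1 : R[i]))).
rewrite (le_trans _ hv)// (le_trans _ (proj2 (contr _ wL)))//.
rewrite le_eqVlt; apply/orP; left; apply/eqP; apply: norm2sq_eq.
apply: (aeT1 bb) => z _ h; congr (normc (_ - 1)); rewrite vE /a'.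
by rewrite mulrACA h mul1r.
Qed.
End InnerComposition.

Theorem proposition4p6 (R : realType) (g k : R[i] -> R[i])
    (gLoo : Linfty g) (g_neq0 : ~ eqT g (fun=> 0))
    (kmax : maximal_vector g k) :
  forall Psi psi hp hm : R[i] -> R[i],
    inner_function Psi psi ->
    ~ (exists c : R[i], forall z : R[i], normc z < 1 -> Psi z = c) ->
    Psi 0 = 0 ->
    invertible_in (@Hinfty R) hp ->
    invertible_in (@Hinfty_conj R) hm ->
    let G := fun z => hm z * g (psi z) * hp z in
    maximal_vector G (fun z => (hp z)^-1 * k (psi z) * (psi z / z)) /\
    ker_toeplitz G =
      mul_set (fun z => (hp z)^-1) (ker_toeplitz (fun z => g (psi z))).
Proof.
move=> Psi psi hp hm hin _ Psi0 [/Hinfty_bddH2 hpB [vp /Hinfty_bddH2 vpB hv]].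
move=> [/Hinfty_bddH2 hmB [vm /Hinfty_bddH2 vmB hmv]] G.
have [_ _ psi1] := hin; have psiB := inner_bddH2 hin; have psi0 := inner_mean0 hin Psi0.
have hc := inner_contraction psiB psi0 psi1; have [_ _ null _] := hc.
have qB := bddH2_divX psiB psi0.
have gpL := Linfty_comp gLoo hc.
have hmL : Linfty hm.
  apply: (@Linfty_eq _ (fun z => ((hm z)^*)^*)); first by apply: aeTW => z _; rewrite conjcK.
  by apply: Linfty_conj; case: hmB.
have GL : Linfty G by apply: LinftyM (proj2 hpB); exact: LinftyM.
have hpV : aeT (fun z => (hp z)^-1 = vp z).
  apply: (aeT1 hv) => z _ h; have hp0 : hp z != 0.
    by apply/eqP => h0; move: h; rewrite h0 mul0r => /esym/eqP; rewrite oner_eq0.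
  by rewrite -[RHS](mulKf hp0) h mulr1.
have [_ hk _ _] := kmax.
have [p [hpH pE] cp] := maximal_cyclic g_neq0 kmax.
split.
  (* The candidate is P = conj(hm) (p o psi), whose outer factor conj(hm) has the bounded inverse
     conj(vm). *)
  apply: (cyclic_maximal GL _ (H2M hmB (H2_comp hpH hc psiB)) (cyclic_comp hpH cp hc psiB hmB vmB _)).
  - apply: (@H2_eq _ (fun z => psi z * z^* * (vp z * k (psi z)))).
      apply: (aeT1 hpV) => z z1 ->; rewrite mulrC; congr (_ * (_ * _)).
      by rewrite conjc_unit.
    exact: H2M qB (H2M vpB (H2_comp hk hc psiB)).
  - by apply: (aeT1 hmv) => z _ h; rewrite -conjcM h rmorph1.
  (* The relation for p holds at psi z for almost every z because null sets pull back to null sets.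
     Since [z] is unimodular, 1 / z is conj z, which supplies the conjugate of the factor z in z
     P. *)
  - apply: (aeT3 (null _ pE) hv hpV) => z z1 pz hvz ->.
    rewrite pz !conjcM !conjcK /G (conjc_unit z1) -[RHS]mul1r -hvz; ring.
(* Each inclusion multiplies by H^oo functions: f by [hp] one way and by its inverse [vp] the other,
   and the conjugate of z times symbol times f by conj(vm), respectively conj(hm). *)
apply/seteqP; split=> f.
  move=> /(ker_toeplitzP _ GL)[hf hq]; exists (fun z => hp z * f z); last first.
    apply: (aeT2 hpV hv) => z _ -> h; rewrite mulrA [vp z * _]mulrC h mul1r //.
  apply/(ker_toeplitzP _ gpL); split; first exact: H2M.
  apply: (H2_eq _ (H2M vmB hq)); apply: (aeT1 hmv) => z _ h.
  rewrite -conjcM; congr (_^*); rewrite /G -[RHS]mul1r -h; ring.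
move=> [f' /(ker_toeplitzP _ gpL)[hf' hq] fE]; apply/(ker_toeplitzP _ GL); split.
  apply: (H2_eq _ (H2M vpB hf')); apply: (aeT2 fE hpV) => z _ -> ->; by [].
apply: (H2_eq _ (H2M hmB hq)); apply: (aeT3 fE hpV hv) => z _ -> -> h.
by rewrite -conjcM; congr (_^*); rewrite /G -[LHS]mul1r -h; ring.
Qed.
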